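(* Let $n\ge1$. There is a non-zero constant $c_n\in\mathbb Z$ such that $$\beta^5\wedge\beta^9\wedge\cdots\wedge\beta^{4n-3}\wedge\phi^{2n}=c_n\,\eta^{2n}.$$ In particular, the map $\omega\mapsto\omega\wedge\phi^{2n}$ from $\Omega_{nc}^\bullet(2n-1)$ to the space of differential forms $\alpha$ on $L\mathcal P_{2n}$ satisfying $\alpha(g^TXg)=\varepsilon(g)\,\alpha(X)$ for all $g\in\mathrm{GL}_{2n}(\mathbb R)$ is injective.
   Context: $\mathcal P_{2n}$ is the space of positive definite real symmetric $2n\times2n$ matrices $X=(X_{ij})$, with $\mathrm{GL}_{2n}(\mathbb R)$ acting by $X\mapsto g^TXg$; $L\mathcal P_{2n}=\mathcal P_{2n}/\mathbb R_{>0}$ is the quotient by scaling; $\varepsilon(g)=\det(g)/|\det(g)|$. For $k\geq 1$, $\beta^{4k+1}=\mathrm{tr}((X^{-1}dX)^{4k+1})$ (for $n=1$ the product of $\beta$'s is empty). $\phi^{2n}=\mathrm{Pf}(dX\cdot X^{-1}\cdot dX)/\sqrt{\det X}$, where Pf is the Pfaffian of the skew-symmetric matrix of (commuting) 2-forms and the root is positive. These forms descend to $L\mathcal P_{2n}$. The volume form is $$\eta^{2n}=\iota_{\mathcal E}\Big(\det(X)^{-\frac{2n+1}{2}}\bigwedge_{i\le j}dX_{ij}\Big),$$ the contraction with the Euler vector field $\mathcal E=\sum_{i\le j}X_{ij}\,\partial/\partial X_{ij}$, where the exterior product is ordered lexicographically in $(i,j)$; it descends to $L\mathcal P_{2n}$.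 $\Omega_{nc}^\bullet(2n-1)$ is the graded exterior $\mathbb Q$-algebra on symbols $\beta^5,\beta^9,\dots,\beta^{4n-7}$ (i.e. $\beta^{4k+1}$ with $1\le k<n-1$), evaluated as the forms above. *)

(* Defs.v *)
From HB Require Import structures.
From mathcomp Require Import all_boot all_order all_algebra all_fingroup.
From mathcomp Require Import ring.

Set Implicit Arguments.
Unset Strict Implicit.
Unset Printing Implicit Defensive.

Import Order.TTheory GRing.Theory Num.Theory.

Local Open Scope ring_scope.

Section ExteriorAlgebra.
Variables (K : comNzRingType) (I : finType).
Implicit Types (A B C D : {set I}).

(* The exterior algebra over K on generators indexed by I.  An element is the
   family of its coordinates in the basis e_A, where e_A is the product of the
   generators in A taken in the order of [enum I]. *)
Definition exterior : Type := {ffun {set I} -> K^o}.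

HB.instance Definition _ := GRing.Lmodule.on exterior.

(* The number of transpositions needed to sort A followed by B:
   e_A e_B = (-1)^(inversions A B) e_(A :|: B) for disjoint A and B. *)
Definition inversions A B : nat :=
  #|[set p in setX A B | (enum_rank p.2 < enum_rank p.1)%N]|.

Definition ext_one : exterior := [ffun C => (C == set0)%:R].

Definition ext_mul (u v : exterior) : exterior :=
  [ffun C : {set I} => \sum_(A : {set I} | A \subset C)
     (-1) ^+ inversions A (C :\: A) * u A * v (C :\: A)].

Lemma inversionsUl A B C : [disjoint A & B] ->
  inversions (A :|: B) C = (inversions A C + inversions B C)%N.
Proof.
move=> dAB; rewrite /inversions -cardsUI [X in (_ + X)%N]eq_card0 ?addn0.
  by apply: eq_card => -[x y]; rewrite !inE /= -!andb_orl.
case=> x y; rewrite !inE /=; case: (boolP (x \in A)) => //= xA.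
by rewrite (disjointFr dAB xA) /= andbF.
Qed.

Lemma inversionsUr A B C : [disjoint B & C] ->
  inversions A (B :|: C) = (inversions A B + inversions A C)%N.
Proof.
move=> dBC; rewrite /inversions -cardsUI [X in (_ + X)%N]eq_card0 ?addn0.
  by apply: eq_card => -[x y]; rewrite !inE /= andb_orr andb_orl.
case=> x y; rewrite !inE /=; case: (boolP (y \in B)) => //= yB.
  by rewrite (disjointFr dBC yB) /= !(andbF, andFb).
by rewrite !andbF.
Qed.

Lemma ext_mulA : associative ext_mul.
Proof.
move=> u v w; apply/ffunP => C; rewrite !ffunE.
transitivity (\sum_(A : {set I} | A \subset C)
    \sum_(D : {set I} | (A \subset D) && (D \subset C))
      (-1) ^+ (inversions A (D :\: A) + inversions A (C :\: D)
               + inversions (D :\: A) (C :\: D))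
      * u A * v (D :\: A) * w (C :\: D)).
  apply: eq_bigr => A sAC; rewrite ffunE mulr_sumr.
  rewrite (reindex_onto (fun D => D :\: A) (fun B => A :|: B)) /=; last first.
    move=> B /subsetDP[_ dBA]; apply/setP => x; rewrite !inE.
    by case: (boolP (x \in A)) => //= xA; rewrite (disjointFl dBA xA).
  apply: eq_big => [D|D /andP[/subsetDP[sDC _] /eqP eD]].
    apply/andP/andP => [[/subsetDP[sDC _] /eqP eD]|[sAD sDC]].
      have sAD : A \subset D by rewrite -eD subsetUl.
      by split=> //; rewrite -(setID D A) subUset sDC andbT subIset ?sAC ?orbT.
    split; first exact: setSD.
    by rewrite -[X in _ == X](setID D A) (setIidPr sAD).
  have sAD : A \subset D by rewrite -eD subsetUl.
  have sDC' : D \subset C.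
    by rewrite -(setID D A) subUset sDC andbT subIset ?sAC ?orbT.
  have -> : (C :\: A) :\: (D :\: A) = C :\: D.
    apply/setP => x; rewrite !inE; case: (boolP (x \in A)) => //= xA.
    by rewrite (subsetP sAD _ xA).
  have -> : C :\: A = (D :\: A) :|: (C :\: D).
    apply/setP => x; rewrite !inE; case: (boolP (x \in D)) => xD /=.
      by rewrite orbF (subsetP sDC' _ xD) andbT.
    rewrite andbF /=; case: (boolP (x \in A)) => //= xA.
    by rewrite (subsetP sAD _ xA) in xD.
  rewrite inversionsUr; last first.
    rewrite disjoints_subset; apply/subsetP => x; rewrite !inE.
    by case/andP => _ ->.
  by rewrite !exprD; ring.
rewrite (exchange_big_dep (fun D => D \subset C)) /=; last first.
  by move=> A D _ /andP[].
apply: eq_bigr => D sDC; rewrite ffunE mulr_sumr mulr_suml.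
apply: eq_big => [A|A /andP[sAC /andP[sAD _]]].
  rewrite sDC andbT; apply/andP/idP => [[]//|sAD].
  by split=> //; exact: subset_trans sDC.
have -> : inversions D (C :\: D)
    = (inversions A (C :\: D) + inversions (D :\: A) (C :\: D))%N.
  rewrite -inversionsUl; first by rewrite -[X in inversions X _](setID D A)
    (setIidPr sAD).
  rewrite disjoints_subset; apply/subsetP => x xA.
  by rewrite !inE xA.
by rewrite !exprD; ring.
Qed.

Lemma ext_mul1l : left_id ext_one ext_mul.
Proof.
move=> u; apply/ffunP => C; rewrite ffunE (bigD1 set0) ?sub0set //=.
rewrite big1 => [|A /andP[_ /negPf nA]]; last by rewrite ffunE nA mulr0 mul0r.
rewrite ffunE eqxx mulr1 addr0 setD0 /inversions eq_card0 ?mul1r // => -[x y].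
by rewrite !inE.
Qed.

Lemma ext_mul1r : right_id ext_one ext_mul.
Proof.
move=> u; apply/ffunP => C; rewrite ffunE (bigD1 C) //= big1; last first.
  move=> A /andP[sAC nA]; rewrite ffunE setD_eq0.
  case: (boolP (C \subset A)) => sCA; rewrite ?mulr0 //.
  by case/negP: nA; rewrite eqEsubset sAC.
rewrite ffunE setDv eqxx mulr1 addr0 /inversions eq_card0 ?mul1r // => -[x y].
by rewrite !inE andbF.
Qed.

Lemma ext_mulDl : left_distributive ext_mul +%R.
Proof.
move=> u v w; apply/ffunP => C; rewrite !ffunE -big_split /=.
by apply: eq_bigr => A _; rewrite ffunE mulrDr mulrDl.
Qed.

Lemma ext_mulDr : right_distributive ext_mul +%R.
Proof.
move=> u v w; apply/ffunP => C; rewrite !ffunE -big_split /=.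
by apply: eq_bigr => A _; rewrite ffunE mulrDr.
Qed.

Lemma ext_one_neq0 : ext_one != 0.
Proof.
apply/eqP => /ffunP/(_ set0); rewrite !ffunE eqxx => /eqP.
by rewrite oner_eq0.
Qed.

HB.instance Definition _ := GRing.Zmodule_isNzRing.Build exterior
  ext_mulA ext_mul1l ext_mul1r ext_mulDl ext_mulDr ext_one_neq0.

Lemma ext_scaleAl (a : K) (u v : exterior) : a *: (u * v) = (a *: u) * v.
Proof.
apply/ffunP => C; rewrite !ffunE scaler_sumr; apply: eq_bigr => A _.
by rewrite ffunE /GRing.scale /=; ring.
Qed.

HB.instance Definition _ := GRing.Lmodule_isLalgebra.Build K exterior
  ext_scaleAl.

Lemma ext_scaleAr (a : K) (u v : exterior) : a *: (u * v) = u * (a *: v).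
Proof.
apply/ffunP => C; rewrite !ffunE scaler_sumr; apply: eq_bigr => A _.
by rewrite ffunE /GRing.scale /=; ring.
Qed.

HB.instance Definition _ := GRing.Lalgebra_isAlgebra.Build K exterior
  ext_scaleAr.

Definition ext_gen (a : I) : exterior := [ffun C => (C == [set a])%:R].

(* The contraction with the vector of coordinates x: the antiderivation of
   degree -1 that is K-linear and sends the generator a to x a. *)
Definition interior_product (x : I -> K) (u : exterior) : exterior :=
  [ffun C : {set I} => \sum_(a | a \notin C)
     (-1) ^+ inversions [set a] C * x a * u (a |: C)].

End ExteriorAlgebra.

Section Pfaffian.
Variables (K : fieldType) (E : lalgType K) (n : nat).

Lemma lt_double_ord (i : 'I_n) : (2 * i < 2 * n)%N.
Proof. by rewrite ltn_pmul2l. Qed.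

Lemma lt_doubleS_ord (i : 'I_n) : ((2 * i).+1 < 2 * n)%N.
Proof. by rewrite !mul2n ltn_Sdouble. Qed.

(* This is used only for matrices whose entries commute pairwise, so the order
   of the factors does not matter. *)
Definition pfaffian (A : 'M[E]_(2 * n)) : E :=
  ((2 ^ n * n`!)%:R^-1 : K) *:
  \sum_(s : 'S_(2 * n)) (-1) ^+ s *
     \prod_(i < n) A (s (Ordinal (lt_double_ord i)))
                     (s (Ordinal (lt_doubleS_ord i))).

End Pfaffian.

(* Imported only here because classical_sets shadows finset lemmas. *)
From mathcomp Require Import all_classical all_reals all_analysis.
Import numFieldNormedType.Exports.

Section SymmetricMatrices.
Variables (R : realType) (m : nat).

Definition posdef (X : 'M[R]_m) : Prop :=
  X^T = X /\ forall v : 'cV[R]_m, v != 0 -> 0 < (v^T *m X *m v) 0 0.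

(* The index set of the coordinates X_ij, i <= j, on symmetric matrices. *)
Definition sym_index := {p : 'I_m * 'I_m | (p.1 <= p.2)%N}.

Definition sort_pair (i j : 'I_m) : 'I_m * 'I_m :=
  if (i <= j)%N then (i, j) else (j, i).

Lemma sort_pairP i j : ((sort_pair i j).1 <= (sort_pair i j).2)%N.
Proof. by rewrite /sort_pair; case: (leqP i j) => // /ltnW. Qed.

Definition sym_index_of (i j : 'I_m) : sym_index :=
  Sub (sort_pair i j) (sort_pairP i j).

(* The exterior algebra of the cotangent space at a point of the space of
   symmetric matrices. *)
Definition covectors := exterior R sym_index.

(* A differential form, possibly inhomogeneous, on positive definite matrices;
   its values at other matrices are irrelevant. *)
Definition form := 'M[R]_m -> covectors.

Definition eq_form (a b : form) : Prop := forall X, posdef X -> a X = b X.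

Definition dX : 'M[covectors]_m := \matrix_(i, j) ext_gen R (sym_index_of i j).

Definition const_covec (X : 'M[R]_m) : 'M[covectors]_m :=
  map_mx (in_alg covectors) X.

Definition coordinate (T : Type) (A : 'M[T]_m) (p : sym_index) : T :=
  A (val p).1 (val p).2.

Definition euler_contract (a : form) : form :=
  fun X => interior_product (coordinate X) (a X).

(* The pullback of a along a map f of symmetric matrices, where df is the
   matrix of 1-forms d(f X). *)
Definition pullback (f : 'M[R]_m -> 'M[R]_m) (df : 'M[covectors]_m)
    (a : form) : form :=
  fun X => \sum_(A : {set sym_index})
    a (f X) A *: \prod_(p in A) coordinate df p.

Definition pullback_gl (g : 'M[R]_m) : form -> form :=
  pullback (fun X => g^T *m X *m g) (const_covec g^T *m dX *m const_covec g).

Definition pullback_scale (r : R) : form -> form :=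
  pullback (fun X => r *: X) (const_covec r%:M *m dX).

(* f is of class C^k on the positive definite matrices, an open subset of the
   space of symmetric matrices: along a symmetric V, derivatives at a positive
   definite X only involve values of f at positive definite matrices. *)
Fixpoint Ck (k : nat) (f : 'M[R]_m -> R) : Prop :=
  {within [set X | posdef X], continuous f}%classic /\
  if k is k'.+1 then
    forall V : 'M[R]_m, V^T = V ->
      (forall X, posdef X -> derivable f X V) /\ Ck k' ('D_V f)
  else True.

Definition smooth_form (a : form) : Prop :=
  forall (A : {set sym_index}) (k : nat), Ck k (fun X => a X A).

(* The differential forms on the quotient by the scaling action of the positive
   reals, identified, via pullback along the quotient map, with the basic forms
   on positive definite matrices. *)
Definition LP_form (a : form) : Prop :=
  [/\ smooth_form a,
      eq_form (euler_contract a) (fun=> 0) &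
      forall r : R, 0 < r -> eq_form (pullback_scale r a) a].

Definition orientation_char (g : 'M[R]_m) : R := \det g / `|\det g|.

Definition twisted_LP_form (a : form) : Prop :=
  LP_form a /\
  forall g : 'M[R]_m, g \in unitmx ->
    eq_form (pullback_gl g a) (fun X => orientation_char g *: a X).

Definition beta_form (k : nat) : form :=
  fun X => \tr ((const_covec (invmx X) *m dX) ^+ (4 * k + 1)).

End SymmetricMatrices.

Section InvariantForms.
Variables (R : realType) (n : nat).

Definition phi_form : form R (2 * n) :=
  fun X => (Num.sqrt (\det X))^-1 *:
           pfaffian (dX R (2 * n) *m const_covec (invmx X) *m dX R (2 * n)).

Definition eta_form : form R (2 * n) :=
  euler_contract (fun X => \det X `^ (- ((2 * n + 1)%:R / 2)) *:
    \prod_(i < 2 * n) \prod_(j < 2 * n | (i <= j)%N) dX R (2 * n) i j).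

(* The index i stands for the symbol beta^(4(i+1)+1), so that i+1 runs over
   1 <= k < n-1. *)
Definition Omega_nc := exterior rat 'I_(n - 2).

Definition eval_nc (w : Omega_nc) : form R (2 * n) :=
  fun X => \sum_(A : {set 'I_(n - 2)})
             (ratr (w A) : R) *: \prod_(i in A) beta_form i.+1 X.

Definition wedge_phi (w : Omega_nc) : form R (2 * n) :=
  fun X => eval_nc w X * phi_form X.

End InvariantForms.

(* Main.v *)
(** At X = 1 put S = dX, a symmetric 2n x 2n matrix of 1-forms.

    A linear substitution g multiplies the volume element, the product of all
    the S_ij, by det(g)^(2n+1).  Hence the volume element, viewed as a tensor in
    the 2n(2n+1) subscripts of its factors, has the same symmetrization as the
    product of 2n+1 sign tensors, and positivity of the squared norm yields a
    nonzero contraction of it with these sign tensors.  One of the sign tensors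
    is kept and the others are paired; the product of two is a signed sum of
    products of Kronecker deltas, which join the factors S_ij into powers of S.
    This leaves traces of powers of S times alternating sums of products of
    entries of powers of S, which reduce to traces of powers times Pf(S^2).  Now
    tr(S^p) = 0 unless p = 1 mod 4, as S is odd and symmetric, and also for
    p > 4n, because S^(4n) = 0 by Rosset's proof of the Amitsur-Levitzki theorem.
    So by degree the surviving product tr(S) tr(S^5) ... tr(S^(4n-3)) Pf(S^2) is
    nonzero.

    The Euler contraction kills phi and all beta^(4k+1) with k > 0 and maps
    beta^1 to 2n, so contracting beta^1 beta^5 ... beta^(4n-3) phi gives the
    identity at X = 1 up to a nonzero constant, which is an integer because both
    sides are integral there; X = g^T g transports it to all X.  For injectivity,
    multiply a nonzero element of the kernel into top degree.  All coordinates
    are polynomials in the entries of X and in det(X)^(-1/2), a class that is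
    stable under differentiation. *)

Require Import Defs.
From HB Require Import structures.
From mathcomp Require Import all_boot all_order all_algebra all_fingroup.
From mathcomp Require Import ring zify.
From mathcomp Require Import reals.

Set Implicit Arguments.
Unset Strict Implicit.
Unset Printing Implicit Defensive.

Import Order.TTheory GRing.Theory Num.Theory.

Local Open Scope ring_scope.

(** * Exterior algebra *)

Section ExteriorBasics.
Variables (K : comNzRingType) (I : finType).
Implicit Types (A B C : {set I}) (a b : I).
Local Notation E := (exterior K I).
Local Notation gen := (ext_gen K).

(** No coefficient of the top product is ever evaluated: it is nonzero because otherwise all these
    contractions would vanish. The constant therefore stays inexplicit, and its integrality needs an
    argument of its own, since both the normalization of the Pfaffian and the factor 2n bring in
    denominators.

    The number 2n+1 counts the occurrences of each label as a subscript among the S_ij with i <= j.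
    It is odd, so one sign tensor is left after pairing, and its alternation over the 2n labels is
    what produces a Pfaffian. That only Pf(S^2) remains rests on S^p being symmetric for p = 0, 1
    mod 4 and skew for p = 2, 3 mod 4. Alternation kills the symmetric powers. If S^p is skew, then
    S^(p-2) is symmetric; as gl(2n) acts on a sign tensor through the trace, the surplus factor
    S^(p-2) can be traded for tr(S^(p-2)). *)

Definition ext_basis A : E := [ffun C => (C == A)%:R].

Lemma inversions1E a A :
  inversions [set a] A = #|[set b in A | (enum_rank b < enum_rank a)%N]|.
Proof.
rewrite -(card_imset _ (f := pair a)) => [|b c [] //].
congr #|pred_of_set _|; apply/setP => -[c b]; rewrite !inE /=.
apply/andP/imsetP => [|[d]].
  by case=> /andP[/eqP-> bA] lt; exists b; rewrite // inE bA.
by rewrite inE => /andP[dA lt] [-> ->]; rewrite eqxx dA.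
Qed.

Lemma inversions11 a b : a != b ->
  (inversions [set a] [set b] + inversions [set b] [set a] = 1)%N.
Proof.
move=> ab; rewrite !inversions1E.
have card c d : #|[set e in [set c] | (enum_rank e < enum_rank d)%N]|
    = (enum_rank c < enum_rank d)%N.
  case: (boolP (_ < _)%N) => h; last first.
    by apply: eq_card0 => e; rewrite !inE; case: eqP => //= ->; exact/negbTE.
  apply/eqP/cards1P; exists c; apply/setP => e; rewrite !inE.
  by case: eqP => //= ->.
have : (enum_rank a != enum_rank b :> nat) by apply: contraNneq ab => /ord_inj/enum_rank_inj->.
by rewrite !card; case: ltngtP.
Qed.

Lemma ext_genM a (u : E) C : (gen a * u) C =
  if a \in C then (-1) ^+ inversions [set a] (C :\ a) * u (C :\ a) else 0.
Proof.
rewrite [LHS]ffunE; case: ifP => aC; last first.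
  rewrite big1 // => A sAC; rewrite ffunE; case: eqP => [eA|]; last by rewrite mulr0 mul0r.
  by case/negP: (negbT aC); rewrite -sub1set -eA.
rewrite (bigD1 [set a]) ?sub1set //= ffunE eqxx mulr1 big1 ?addr0 //.
by move=> A /andP[_ /negPf nA]; rewrite ffunE nA mulr0 mul0r.
Qed.

Lemma ext_gen_basis a A : gen a * ext_basis A =
  if a \in A then 0 else (-1) ^+ inversions [set a] A *: ext_basis (a |: A).
Proof.
apply/ffunP => C; rewrite ext_genM ffunE.
case: (boolP (a \in A)) => aA.
  rewrite ffunE; case: ifP => // aC; case: eqP => [eA|]; last by rewrite mulr0.
  by move: aA; rewrite -eA !inE eqxx.
rewrite !ffunE; case: (boolP (a \in C)) => aC.
  have -> : (C :\ a == A) = (C == a |: A).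
    apply/eqP/eqP => [<-|->]; first by rewrite setD1K.
    by rewrite setU1K.
  case: eqP => [->|_]; last by rewrite !mulr0 /= /GRing.scale /= mulr0.
  by rewrite setU1K //.
case: eqP => [eC|]; last by rewrite /GRing.scale /= mulr0.
by rewrite eC !inE eqxx in aC.
Qed.

Lemma ext_genK a : gen a * gen a = 0.
Proof.
have -> : gen a = ext_basis [set a] by [].
by rewrite ext_gen_basis inE eqxx.
Qed.

Lemma ext_genC a b : gen a * gen b = - (gen b * gen a).
Proof.
have [->|ab] := eqVneq a b; first by rewrite ext_genK oppr0.
have e c : gen c = ext_basis [set c] by [].
rewrite [X in _ * X]e [X in - (_ * X)]e !ext_gen_basis !inE (eq_sym b) (negPf ab).
rewrite setUC -scaleNr; congr (_ *: _).
have := inversions11 ab; case: inversions => [|[|k]] /=; case: inversions => [|[|l]] //=.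
by rewrite expr0 expr1 opprK.
Qed.

Lemma ext_sum_basis (u : E) : u = \sum_(A : {set I}) u A *: ext_basis A.
Proof.
apply/ffunP => C; rewrite sum_ffunE (bigD1 C) //= !ffunE eqxx big1; last first.
  move=> A nA; rewrite !ffunE eq_sym (negPf nA).
  by rewrite /GRing.scale /= mulr0.
by rewrite /GRing.scale /= mulr1 addr0.
Qed.

Lemma ext_basis0 : ext_basis set0 = 1.
Proof. by []. Qed.

End ExteriorBasics.

Section UniversalProperty.
Variables (K : comNzRingType) (I : finType) (B : algType K) (x : I -> B).
Implicit Types (A C : {set I}) (a b : I).
Local Notation E := (exterior K I).
Local Notation gen := (ext_gen K).

(** [pullback] is this map, with the entries of the transported differentials as [x]. Linearity
    holds for every [x]; multiplicativity comes from the [x a] anticommuting and squaring to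
    zero. *)
Definition ext_hom (u : E) : B := \sum_(A : {set I}) u A *: \prod_(p in A) x p.

Lemma ext_hom_linear : linear ext_hom.
Proof.
move=> c u v; rewrite /ext_hom scaler_sumr -big_split /=.
by apply: eq_bigr => A _; rewrite !ffunE scalerDl scalerA.
Qed.

HB.instance Definition _ := GRing.isLinear.Build K E B *:%R ext_hom ext_hom_linear.

Lemma ext_hom_basis A : ext_hom (ext_basis K A) = \prod_(p in A) x p.
Proof.
rewrite /ext_hom (bigD1 A) //= ffunE eqxx scale1r [X in _ + X]big1 ?addr0 // => C /negPf nC.
by rewrite ffunE nC scale0r.
Qed.

Lemma ext_hom1 : ext_hom 1 = 1.
Proof. by rewrite -ext_basis0 ext_hom_basis big_set0. Qed.

Lemma ext_hom_gen a : ext_hom (gen a) = x a.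
Proof. by rewrite [gen a]/(ext_basis K [set a]) ext_hom_basis big_set1. Qed.

Hypothesis xC : forall a b, x a * x b = - (x b * x a).
Hypothesis xx : forall a, x a * x a = 0.

(** Moving [x a] to its place in [r] passes the selected elements that precede it, with one sign
    each. The general list and predicate let the induction run along the list. *)
Lemma prod_insert_gen (r : seq I) (P : pred I) a : uniq r -> a \in r -> ~~ P a ->
  x a * \prod_(b <- r | P b) x b =
  (-1) ^+ count P (take (index a r) r) * \prod_(b <- r | (b == a) || P b) x b.
Proof.
move=> ur ar nPa; elim: r ur ar => //= b r IH /andP[nbr ur].
rewrite inE !big_cons; have [eab|ba] := eqVneq a b; first subst b.
  move=> _; rewrite /= ?eqxx (negPf nPa) expr0 mul1r /=; congr (_ * _).
  rewrite [LHS]big_seq_cond [RHS]big_seq_cond; apply: eq_bigl => c.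
  by case: eqVneq => //= ->; rewrite (negPf nbr).
move=> ar; rewrite /= ?(eq_sym b) ?(negPf ba) /=.
case: ifP => Pb; last by rewrite add0n IH.
rewrite add1n mulrA xC mulNr -mulrA IH // exprS !mulrA mulN1r mulNr.
by rewrite (commr_sign (x b)) mulNr.
Qed.

Lemma prod_gen0 (r : seq I) (P : pred I) a : a \in r -> P a ->
  x a * \prod_(b <- r | P b) x b = 0.
Proof.
move=> + Pa; elim: r => //= b r IH; rewrite inE big_cons.
have [<- _|_ /= ar] := eqVneq a b; first by rewrite Pa mulrA xx mul0r.
by case: ifP => Pb; rewrite ?IH // mulrA xC mulNr -mulrA IH // mulr0 oppr0.
Qed.

(** [inversions] measures order by [enum_rank], whereas big products run along [index_enum]. Both
    follow the same list, so the two signs agree. *)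
Lemma count_index_enum a A :
  count (mem A) (take (index a (index_enum I)) (index_enum I))
    = inversions [set a] A.
Proof.
rewrite inversions1E -size_filter; set r := take _ _.
have ur : uniq r by rewrite take_uniq // index_enum_uniq.
rewrite -(card_uniqP (filter_uniq (mem A) ur)); apply: eq_card => b.
rewrite !inE mem_filter; congr (_ && _).
rewrite in_take ?mem_index_enum //.
rewrite /enum_rank !enum_rank_in.unlock !insubdK /=; last 2 first.
- by rewrite -topredE /= cardE index_mem mem_enum.
- by rewrite -topredE /= cardE index_mem mem_enum.
by rewrite enumT [index_enum I]unlock.
Qed.

Lemma mul_gen_prod a A : x a * \prod_(p in A) x p =
  if a \in A then 0
  else (-1) ^+ inversions [set a] A *: \prod_(p in a |: A) x p.
Proof.
case: ifP => aA; first by rewrite (@prod_gen0 _ (mem A)) // mem_index_enum.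
rewrite (@prod_insert_gen _ (mem A)) ?mem_index_enum ?index_enum_uniq //= ?aA //.
rewrite count_index_enum -signr_odd -[in RHS]signr_odd scaler_sign mulr_sign.
by under eq_bigl do rewrite -in_setU1.
Qed.

Lemma ext_hom_gen_mul a u : ext_hom (gen a * u) = x a * ext_hom u.
Proof.
rewrite [u in LHS]ext_sum_basis mulr_sumr raddf_sum /= [X in _ * X]/ext_hom mulr_sumr.
apply: eq_bigr => A _; rewrite -!scalerAr linearZ /= ext_gen_basis mul_gen_prod.
case: ifP => _; first by rewrite linear0.
by rewrite linearZ /= ext_hom_basis.
Qed.
End UniversalProperty.

Section BasisProducts.
Variables (K : comNzRingType) (I : finType).
Implicit Types (A : {set I}).
Local Notation E := (exterior K I).
Local Notation gen := (ext_gen K).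

Lemma prod_ext_gen A : \prod_(p in A) gen p = ext_basis K A :> E.
Proof.
have [n] := ubnP #|A|; elim: n A => // n IH A.
have [->|[a aA]] := set_0Vmem A; first by rewrite big_set0 ext_basis0.
rewrite (cardsD1 a) aA add1n ltnS => /IH eA.
have := mul_gen_prod (@ext_genC K I) (@ext_genK K I) a (A :\ a).
rewrite eA ext_gen_basis !inE eqxx /= setD1K // => /(congr1 ( *:%R ((-1) ^+ inversions [set a] (A :\ a)))).
by rewrite !scalerA -expr2 sqrr_sign !scale1r.
Qed.
End BasisProducts.

Section UniversalProperty2.
Variables (K : comNzRingType) (I : finType) (B : algType K) (x : I -> B).
Hypothesis xC : forall a b, x a * x b = - (x b * x a).
Hypothesis xx : forall a, x a * x a = 0.

Lemma ext_homM u v : ext_hom x (u * v) = ext_hom x u * ext_hom x v.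
Proof.
rewrite [u in LHS]ext_sum_basis mulr_suml raddf_sum /= [X in X * _]/ext_hom mulr_suml.
apply: eq_bigr => A _; rewrite -!scalerAl linearZ /= -prod_ext_gen; congr (_ *: _).
elim: (index_enum I) => [|a r IH]; first by rewrite !big_nil !mul1r.
rewrite !big_cons; case: ifP => // _.
by rewrite -!mulrA ext_hom_gen_mul // IH.
Qed.

End UniversalProperty2.

(** * Degrees and graded commutativity *)

Section Grading.
Variables (K : comNzRingType) (I : finType).
Implicit Types (A B C : {set I}) (d e : nat) (b c : bool).
Local Notation E := (exterior K I).
Local Notation gen := (ext_gen K).
Implicit Types u v : E.

Definition has_parity b u := forall A, odd #|A| != b -> u A = 0.

Definition homog d u := forall A, #|A| != d -> u A = 0.

Lemma homog_parity d u : homog d u -> has_parity (odd d) u.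
Proof. by move=> hu A nA; apply: hu; apply: contraNneq nA => ->. Qed.

(** Each pair of a point of A and a point of B is out of order in exactly one of the two
    concatenations. *)
Lemma inversionsC A B : [disjoint A & B] ->
  (inversions A B + inversions B A = #|A| * #|B|)%N.
Proof.
move=> dAB; have -> : inversions B A =
    #|[set p in setX A B | (enum_rank p.1 < enum_rank p.2)%N]|.
  rewrite /inversions -(card_imset _ (f := fun p => (p.2, p.1))); last first.
    by move=> [? ?] [? ?] [-> ->].
  congr #|pred_of_set _|; apply/setP => -[x y]; rewrite !inE /=.
  apply/imsetP/idP => [[[z t]]|/andP[/andP[xA yB] lt]].
    by rewrite !inE /= => /andP[/andP[zB tA] lt] [-> ->]; rewrite zB tA.
  by exists (y, x); rewrite // !inE /= xA yB.
rewrite /inversions -cardsX -cardsUI [X in (_ + X)%N]eq_card0 ?addn0; last first.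
  move=> [x y]; rewrite !inE /=; case: ltngtP; rewrite !(andbF, andFb) //.
congr #|pred_of_set _|; apply/setP => -[x y]; rewrite !inE /= -andb_orr.
case: (boolP ((x \in A) && (y \in B))) => //= /andP[xA yB].
case: ltngtP => // /ord_inj/enum_rank_inj eyx.
by subst y; rewrite (disjointFr dAB xA) in yB.
Qed.

Lemma parityC b c u v : has_parity b u -> has_parity c v ->
  u * v = (-1) ^+ (b && c) *: (v * u).
Proof.
move=> hu hv; apply/ffunP => C; rewrite !ffunE scaler_sumr.
rewrite (reindex_onto (fun A => C :\: A) (fun A => C :\: A)) /=; last first.
  by move=> A sAC; rewrite setDDr setDv set0U (setIidPr sAC).
apply: eq_big => [A|A /andP[_ /eqP eA]].
  rewrite subsetDl; apply/eqP/idP => [<-|sAC]; first exact: subsetDl.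
  by rewrite setDDr setDv set0U (setIidPr sAC).
rewrite eA /GRing.scale /=.
have [bA|nA] := boolP (odd #|C :\: A| == b); last first.
  by rewrite hu // !(mulr0, mul0r).
have [cA|nA] := boolP (odd #|A| == c); last first.
  by rewrite hv // !(mulr0, mul0r).
have d : [disjoint C :\: A & A].
  by rewrite disjoints_subset; apply/subsetP => x; rewrite !inE => /andP[].
have := inversionsC d; move/(congr1 odd); rewrite oddD oddM (eqP bA) (eqP cA).
set m := inversions _ _; set n := inversions _ _ => eo.
rewrite -(signr_odd _ m) -(signr_odd _ n).
have -> : (b && c) = odd m (+) odd n by rewrite eo.
by rewrite !mulrA -signr_addb -addbA addbb addbF -!mulrA (mulrC (u _)).
Qed.

Lemma parityM b c u v : has_parity b u -> has_parity c v ->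
  has_parity (b (+) c) (u * v).
Proof.
move=> hu hv C nC; rewrite ffunE big1 // => A sAC.
have [bA|nA] := boolP (odd #|A| == b); last first.
  by rewrite hu // !(mulr0, mul0r).
rewrite [v _]hv ?mulr0 //; apply: contra nC => /eqP <-.
by rewrite -(eqP bA) cardsD (setIidPr sAC) oddB ?subset_leq_card // addbC addbK.
Qed.

Lemma parityD b u v : has_parity b u -> has_parity b v -> has_parity b (u + v).
Proof. by move=> hu hv A nA; rewrite ffunE hu // hv // addr0. Qed.

Lemma parityN b u : has_parity b u -> has_parity b (- u).
Proof. by move=> hu A nA; rewrite ffunE hu // oppr0. Qed.

Lemma parity1 : has_parity false 1.
Proof.
by move=> A; rewrite ffunE; have [->|] := eqVneq A set0; rewrite ?cards0.
Qed.

Lemma homogM d e u v : homog d u -> homog e v -> homog (d + e) (u * v).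
Proof.
move=> hu hv C nC; rewrite ffunE big1 // => A sAC.
have [bA|nA] := eqVneq #|A| d; last by rewrite hu // !(mulr0, mul0r).
rewrite hv ?mulr0 //; apply: contraNneq nC => <-.
by rewrite -bA cardsD (setIidPr sAC) subnKC // subset_leq_card.
Qed.

Lemma homog0 d : homog d 0.
Proof. by move=> A _; rewrite ffunE. Qed.

Lemma homogD d u v : homog d u -> homog d v -> homog d (u + v).
Proof. by move=> hu hv A nA; rewrite ffunE hu // hv // addr0. Qed.

Lemma homogZ d (a : K) u : homog d u -> homog d (a *: u).
Proof. by move=> hu A nA; rewrite ffunE hu // scaler0. Qed.

Lemma homogN d u : homog d u -> homog d (- u).
Proof. by rewrite -scaleN1r; exact: homogZ. Qed.

Lemma homog_sum d (J : Type) (r : seq J) (P : pred J) (F : J -> E) :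
  (forall j, P j -> homog d (F j)) -> homog d (\sum_(j <- r | P j) F j).
Proof. by move=> h; apply: (big_ind (homog d)) => // *; [exact: homog0|exact: homogD]. Qed.

Lemma homog1 : homog 0 1.
Proof. by move=> A; rewrite ffunE cards_eq0 => /negPf->. Qed.

Lemma homog_basis A : homog #|A| (ext_basis K A).
Proof. by move=> C; rewrite ffunE; have [->|] := eqVneq C A; rewrite ?eqxx. Qed.

Lemma homog_gen (a : I) : homog 1 (gen a).
Proof. by have := @homog_basis [set a]; rewrite cards1. Qed.

Lemma homog_prod (J : Type) (r : seq J) (P : pred J) (F : J -> E) (d : J -> nat) :
  (forall j, P j -> homog (d j) (F j)) ->
  homog (\sum_(j <- r | P j) d j)%N (\prod_(j <- r | P j) F j).
Proof.
move=> h; elim: r => [|j r IH]; first by rewrite !big_nil; exact: homog1.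
by rewrite !big_cons; case: ifP => // Pj; apply: homogM => //; exact: h.
Qed.

Lemma homogC d e u v : homog d u -> homog e v ->
  u * v = (-1) ^+ (d * e) *: (v * u).
Proof.
by move=> /homog_parity hu /homog_parity hv; rewrite (parityC hu hv) -oddM signr_odd.
Qed.

Lemma homog_evenC d u v : ~~ odd d -> homog d u -> u * v = v * u.
Proof.
move=> nd /homog_parity; rewrite (negPf nd) => hu.
rewrite [v]ext_sum_basis mulr_sumr mulr_suml; apply: eq_bigr => A _.
rewrite -scalerAl -scalerAr; congr (_ *: _).
by rewrite (parityC hu (homog_parity (@homog_basis A))) /= expr0 scale1r.
Qed.

Lemma homog_top u : homog #|I| u -> u = u [set: I] *: ext_basis K [set: I].
Proof.
move=> hu; apply/ffunP => A; rewrite !ffunE.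
have [->|nA] := eqVneq A setT; first by rewrite /GRing.scale /= mulr1.
rewrite scaler0; apply: hu; apply: contraNneq nA => cA.
by rewrite eqEcard subsetT cardsT cA leqnn.
Qed.

(** The exponent is chosen before [F]: the sign depends only on the degrees and the rearrangement,
    so two products over the same lists can be compared without computing it. *)
Lemma homog_prod_perm (J : eqType) (d : J -> nat) (r r' : seq J) : perm_eq r r' ->
  exists k : nat, forall F : J -> E, (forall j, homog (d j) (F j)) ->
    \prod_(j <- r) F j = (-1) ^+ k *: \prod_(j <- r') F j.
Proof.
elim: r r' => [|j r IH] r' prr'.
  by rewrite perm_sym in prr'; rewrite (perm_nilP prr') ; exists 0%N => F _; rewrite scale1r.
have jr' : j \in r' by rewrite -(perm_mem prr') mem_head.
move: prr'; case/splitPr: jr' => r1 r2; rewrite perm_sym perm_catC /= perm_cons perm_catC.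
rewrite perm_sym => /IH[c ec].
exists (c + d j * (\sum_(i <- r1) d i))%N => F h.
have h1 : homog (\sum_(i <- r1) d i) (\prod_(i <- r1) F i) by apply: homog_prod.
rewrite big_cons ec // big_cat big_cat big_cons /= -scalerAr.
rewrite [F j * (_ * _)]mulrA (homogC (h j) h1) -scalerAl scalerA -exprD.
by rewrite -mulrA.
Qed.

End Grading.

Section Detection.
Variables (K : fieldType) (I J : finType).
Local Notation E := (exterior K I).
Variables (x : J -> E) (T : E).
Hypothesis xC : forall a b, x a * x b = - (x b * x a).
Hypothesis xx : forall a, x a * x a = 0.

Lemma ext_mul_eq0 (u : exterior K J) :
  (\prod_p x p) * T != 0 -> ext_hom x u * T = 0 -> u = 0.
Proof.
(* If A is minimal in the support of u, then e_{~A} * u is a nonzero multiple of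
   the top product. *)
move=> nT uT; apply/eqP; apply/negPn/negP => nu.
have [A0 nA0] : exists A, u A != 0.
  apply/existsP; apply: contraNT nu; rewrite negb_exists => /forallP h.
  by apply/eqP/ffunP => A; have := h A; rewrite negbK ffunE => /eqP.
case: (@arg_minnP _ A0 (fun A => u A != 0) (fun A : {set J} => #|A|) nA0) => A nA minA.
pose v := ext_basis K (~: A).
have homv : homog (#|J| - #|A|) v.
  by rewrite (_ : (_ - _)%N = #|~: A|); [exact: homog_basis | rewrite -(cardsC A) addKn].
have hvu : homog #|J| (v * u).
  move=> C nC; rewrite ffunE big1 // => B sBC; rewrite ffunE.
  case: eqP => [eB|_]; last by rewrite mulr0 mul0r.
  have [->|nB] := eqVneq (u (C :\: B)) 0; first by rewrite mulr0.
  have := minA _ nB; rewrite cardsD (setIidPr sBC).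
  have := cardsC A; rewrite -eB -cardsT => cA.
  have leC : (#|C| <= #|[set: J]|)%N by rewrite subset_leq_card ?subsetT.
  have leB := subset_leq_card sBC.
  by move=> le; case/negP: nC; rewrite -cardsT; apply/eqP; lia.
have evu : v * u = (v * u) [set: J] *: ext_basis K [set: J] by exact: homog_top.
have nvu : (v * u) [set: J] != 0.
  rewrite ffunE (bigD1 (~: A)) ?subsetT //= ffunE eqxx big1 ?addr0; last first.
    by move=> B /andP[_ /negPf nB]; rewrite ffunE nB mulr0 mul0r.
  by rewrite setTD setCK mulr1 mulf_neq0 ?signr_eq0.
have : ext_hom x (v * u) * T = 0 by rewrite ext_homM // -mulrA uT mulr0.
rewrite evu linearZ /= ext_hom_basis -scalerAl => /eqP; rewrite scaler_eq0 (negPf nvu) /=.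
by under eq_bigl do rewrite inE; exact/negP.
Qed.
End Detection.

Section Contraction.
Variables (K : comNzRingType) (I : finType) (x : I -> K).
Implicit Types (A B C : {set I}) (a b : I).
Local Notation E := (exterior K I).
Local Notation gen := (ext_gen K).
Implicit Types u v : E.
Local Notation ip := (interior_product x).

Lemma extD u v C : (u + v) C = u C + v C. Proof. by rewrite ffunE. Qed.
Lemma extN u C : (- u) C = - u C. Proof. by rewrite ffunE. Qed.
Lemma extZ (k : K) u C : (k *: u) C = k * u C. Proof. by rewrite ffunE. Qed.

Lemma interior_product_linear : linear (ip : E -> E).
Proof.
move=> c u v; apply/ffunP => C; rewrite !ffunE scaler_sumr -big_split /=.
by apply: eq_bigr => a _; rewrite !ffunE /GRing.scale /=; ring.
Qed.

HB.instance Definition _ := GRing.isLinear.Build K E E *:%R (interior_product x)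
  interior_product_linear.

Lemma interior_product_genM a u : ip (gen a * u) = x a *: u - gen a * ip u.
Proof.
apply/ffunP => C; rewrite extD extN extZ ext_genM [LHS]ffunE.
case: (boolP (a \in C)) => aC; last first.
  rewrite subr0 (bigD1 a) //= ext_genM !inE eqxx /= setU1K // big1.
    rewrite addr0; transitivity (((-1) ^+ inversions [set a] C) ^+ 2 * (x a * u C)).
      by ring.
    by rewrite sqrr_sign mul1r.
  move=> b /andP[bC ba]; rewrite ext_genM !inE (negPf aC) orbF eq_sym (negPf ba).
  by rewrite mulr0.
rewrite [ip u _]ffunE (bigD1 (P := fun b => b \notin C :\ a) a) /= ?inE ?eqxx // setD1K //.
set s := (-1) ^+ _; set T := \sum_(i | (i \notin _) && _) _.
have -> : x a * u C - s * (s * x a * u C + T) = - (s * T).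
  transitivity (x a * u C * (1 - s ^+ 2) - s * T); first by ring.
  by rewrite sqrr_sign subrr mulr0 sub0r.
rewrite mulr_sumr -sumrN; apply: eq_big => [b|b bC].
  by rewrite !inE negb_and negbK; case: eqVneq => [->|] //=; rewrite ?aC ?andbT.
have ba : b != a by apply: contraNneq bC => ->.
rewrite ext_genM !inE aC orbT (_ : (b |: C) :\ a = b |: (C :\ a)); last first.
  apply/setP => c; rewrite !inE; case: (eqVneq c b) => [->|] //=.
  by rewrite ba.
rewrite -{1}(setD1K aC) !inversionsUr ?exprD; last 2 first.
- by rewrite disjoints1 !inE (negPf bC) andbF.
- by rewrite disjoints1 !inE eqxx.
(* Removing [b] before or after inserting [a] differs by the transposition of [a] and [b], which is
   the sign in the antiderivation rule. *)
have : (-1) ^+ inversions [set b] [set a] * (-1) ^+ inversions [set a] [set b] = -1 :> K.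
  by rewrite -exprD inversions11.
move: ((-1) ^+ inversions [set b] [set a]) => s1.
move: ((-1) ^+ inversions [set a] [set b]) => s2 e12.
transitivity ((s1 * s2) * ((-1) ^+ inversions [set b] (C :\ a) *
   (-1) ^+ inversions [set a] (C :\ a) * x b * u (b |: C :\ a))); first by ring.
by rewrite e12 /s; ring.
Qed.

Lemma interior_product1 : ip 1 = 0.
Proof.
apply/ffunP => C; rewrite !ffunE big1 // => a _; rewrite ffunE.
case: eqP => [/setP/(_ a)|_]; rewrite ?mulr0 //.
by rewrite !inE eqxx.
Qed.

Lemma interior_product_gen a : ip (gen a) = (x a)%:A.
Proof. by rewrite -[gen a]mulr1 interior_product_genM interior_product1 mulr0 subr0. Qed.

Lemma interior_product_monomial (l : seq I) v :
  ip ((\prod_(a <- l) gen a) * v) =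
  ip (\prod_(a <- l) gen a) * v + (-1) ^+ size l *: ((\prod_(a <- l) gen a) * ip v).
Proof.
elim: l v => [|a l IH] v.
  by rewrite big_nil interior_product1 mul0r add0r !mul1r scale1r.
rewrite big_cons -mulrA !interior_product_genM IH /= exprS.
rewrite mulrDr mulrBl opprD addrA -!scalerAl !mulrA -scalerAr -[in RHS]scalerA scaleN1r.
by rewrite mulrA.
Qed.

Lemma interior_productM d u v : homog d u ->
  ip (u * v) = ip u * v + (-1) ^+ d *: (u * ip v).
Proof.
move=> hu; rewrite [u]ext_sum_basis !raddf_sum /= !mulr_suml raddf_sum /=.
rewrite scaler_sumr -big_split /=; apply: eq_bigr => A _.
have [->|nA] := eqVneq (u A) 0; first by rewrite !(scale0r, mul0r, linear0, scaler0, addr0).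
have <- : #|A| = d by apply/eqP; apply: contraNT nA => /hu->.
rewrite -!scalerAl !linearZ /= -!scalerAl.
rewrite -scalerDr.
congr (_ *: _); rewrite -prod_ext_gen.
rewrite -big_filter cardE -deprecated_filter_index_enum.
exact: interior_product_monomial.
Qed.

End Contraction.

(** * Matrices of homogeneous forms *)

Section MatricesOfForms.
Variables (K : numFieldType) (I : finType).
Local Notation E := (exterior K I).

Lemma eq_oppr0 (u : E) : u = - u -> u = 0.
Proof.
move/eqP; rewrite -addr_eq0 -mulr2n -scaler_nat scaler_eq0 pnatr_eq0 /=.
by move/eqP.
Qed.

Definition homog_mx m n d (M : 'M[E]_(m, n)) := forall i j, homog d (M i j).

Lemma homog_mulmx m n p d e (M : 'M[E]_(m, n)) (M' : 'M[E]_(n, p)) :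
  homog_mx d M -> homog_mx e M' -> homog_mx (d + e) (M *m M').
Proof.
by move=> hM hM' i j; rewrite mxE; apply: homog_sum => k _; apply: homogM.
Qed.

Lemma homog_const_mx m n (A : 'M[K]_(m, n)) : homog_mx 0 (map_mx (in_alg E) A).
Proof. by move=> i j; rewrite !mxE /=; apply: homogZ; exact: homog1. Qed.

Lemma homog_expmx n d (M : 'M[E]_n) p : homog_mx d M -> homog_mx (d * p) (M ^+ p).
Proof.
move=> hM; elim: p => [|p IH].
  by rewrite muln0 expr0 => i j; rewrite !mxE; case: eqP => _; [exact: homog1|exact: homog0].
by rewrite exprS mulnS; apply: homog_mulmx.
Qed.

Lemma homog_trace n d (M : 'M[E]_n) : homog_mx d M -> homog d (\tr M).
Proof. by move=> hM; apply: homog_sum => i _. Qed.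

Lemma mxtrace_homogC m n d e (M : 'M[E]_(m, n)) (M' : 'M[E]_(n, m)) :
  homog_mx d M -> homog_mx e M' ->
  \tr (M *m M') = (-1) ^+ (d * e) *: \tr (M' *m M).
Proof.
move=> hM hM'; rewrite /mxtrace scaler_sumr.
transitivity (\sum_i \sum_j (-1) ^+ (d * e) *: (M' j i * M i j)).
  apply: eq_bigr => i _; rewrite mxE; apply: eq_bigr => j _.
  exact: homogC.
rewrite exchange_big /=; apply: eq_bigr => j _.
by rewrite mxE scaler_sumr.
Qed.

Lemma mul_trmx_homog m n p d e (M : 'M[E]_(m, n)) (M' : 'M[E]_(n, p)) i j :
  homog_mx d M -> homog_mx e M' ->
  (M *m M') i j = (-1) ^+ (d * e) *: (M'^T *m M^T) j i.
Proof.
move=> hM hM'; rewrite !mxE scaler_sumr; apply: eq_bigr => k _.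
by rewrite !mxE; exact: homogC.
Qed.

Section Powers.
Variables (n : nat) (S : 'M[E]_n).
Hypothesis hS : homog_mx 1 S.

Lemma homog_pow p : homog_mx p (S ^+ p).
Proof. by have := homog_expmx (p := p) hS; rewrite mul1n. Qed.

(** Cyclicity moves one odd factor S past an odd power of S, at the cost of a sign. *)
Lemma trace_even_pow p : \tr (S ^+ p.+1.*2) = 0.
Proof.
apply: eq_oppr0; rewrite doubleS.
transitivity (\tr (S *m S ^+ p.*2.+1)); first by rewrite exprS.
rewrite [LHS](mxtrace_homogC hS (@homog_pow _)) mul1n -signr_odd /= odd_double.
by rewrite expr1 scaleN1r mulmxE -exprSr.
Qed.

Hypothesis symS : S^T = S.

(** Transposition reverses the p odd factors, and reversing p letters takes ['C(p, 2)] exchanges.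
    Thus S^p is symmetric for p = 0, 1 mod 4 and skew for p = 2, 3 mod 4. *)
Lemma pow_sym p i j : (S ^+ p) j i = (-1) ^+ 'C(p, 2) *: (S ^+ p) i j.
Proof.
elim: p i j => [|p IH] i j.
  by rewrite expr0 scale1r !mxE eq_sym.
rewrite exprS [LHS](mul_trmx_homog _ _ hS (@homog_pow p)) symS mul1n.
rewrite -exprS exprSr binS bin1 exprD mulrC -scalerA; congr (_ *: _).
rewrite -[S ^+ p * S]/(S ^+ p *m S) !mxE scaler_sumr; apply: eq_bigr => k _.
rewrite [X in X * _]mxE [X in X * _ = _]IH.
by rewrite -scalerAl.
Qed.

Lemma trace_pow3 k : \tr (S ^+ (4 * k + 3)) = 0.
Proof.
apply: eq_oppr0; rewrite /mxtrace -sumrN; apply: eq_bigr => i _.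
rewrite {1}pow_sym -scaleN1r; congr (_ *: _).
rewrite -signr_odd (_ : odd _ = true) //.
rewrite bin2 (_ : (_ * _)%N = ((4 * k + 3) * (2 * k + 1)).*2) ?doubleK; lia.
Qed.
End Powers.
End MatricesOfForms.

(** * Traces of odd matrices *)

Section PowerTraces.

Lemma deriv_big_prod (R : comNzRingType) (J : finType) (F : J -> {poly R}) :
  (\prod_j F j)^`() = \sum_j (F j)^`() * \prod_(k | k != j) F k.
Proof.
have H r : uniq r -> (\prod_(j <- r) F j)^`() =
    \sum_(j <- r) (F j)^`() * \prod_(k <- r | k != j) F k.
  elim: r => [|j r IH] /= => [_|/andP[nj ur]].
    by rewrite !big_nil -[1]/(1%:P) derivC.
  rewrite !big_cons derivM IH // eqxx mulr_sumr; congr (_ * _ + _).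
    rewrite [RHS]big_seq_cond [LHS]big_seq; apply: eq_bigl => k.
    by case: eqVneq nj => [->|] //=; [case: (j \in r) | rewrite andbT].
  rewrite [LHS]big_seq [RHS]big_seq; apply: eq_bigr => k kr.
  rewrite big_cons (_ : j != k) 1?mulrCA //.
  by apply: contraNneq nj => ->.
by rewrite H // index_enum_uniq.
Qed.

(** Jacobi's formula, obtained by grouping the permutations according to the image of the
    differentiated row. *)
Lemma deriv_det (R : comNzRingType) n (M : 'M[{poly R}]_n) :
  (\det M)^`() = \sum_i \sum_j (M i j)^`() * cofactor M i j.
Proof.
transitivity (\sum_(s : 'S_n) \sum_i
   (-1) ^+ s * ((M i (s i))^`() * \prod_(k | k != i) M k (s k))).
  rewrite /determinant linear_sum /=; apply: eq_bigr => s _.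
  by rewrite -mulr_sumr -deriv_big_prod -signr_odd; case: odd;
    rewrite !(expr1, expr0, mul1r) // !mulN1r derivN.
rewrite exchange_big; apply: eq_bigr => i _.
rewrite (partition_big (fun s : 'S_n => s i) predT) //=; apply: eq_bigr => j _.
rewrite expand_cofactor mulr_sumr; apply: eq_bigr => s /eqP ->.
rewrite mulrCA; congr (_ * (_ * _)); apply: eq_bigl => k; by rewrite eq_sym.
Qed.

Variables (R : comNzRingType) (n : nat) (A : 'M[R]_n.+1).
Hypothesis Rtf : forall (m : nat) (r : R), r *+ m.+1 = 0 -> r = 0.
Hypothesis trA : forall k, \tr (A ^+ k.+1) = 0.

Lemma deriv_char_poly : (char_poly A)^`() = \tr (\adj (char_poly_mx A)).
Proof.
rewrite deriv_det; apply: eq_bigr => i _; rewrite (bigD1 i) //= big1 => [|j ji].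
  by rewrite !mxE eqxx derivB derivX derivC subr0 mul1r addr0.
by rewrite !mxE eq_sym (negPf ji) mulr0n derivB deriv0 derivC subr0 mul0r.
Qed.

(** The matrices of the Faddeev-LeVerrier recursion: comparing coefficients in (X - A) adj(X - A) =
    char_poly(A) links [B k] to [B k.+1]. This yields Newton's identities without eigenvalues, over
    a ring that may have nilpotents. *)
Let B k : 'M[R]_n.+1 := \matrix_(i, j) (\adj (char_poly_mx A) i j)`_k.

Lemma adj_coefS k : (char_poly A)`_k.+1 *: 1%:M = B k - A *m B k.+1.
Proof.
rewrite /B; move: (\adj (char_poly_mx A)) (mul_mx_adj (char_poly_mx A)) => C /matrixP e.
apply/matrixP => i j; have := e i j; move/(congr1 (fun p : {poly R} => p`_k.+1)).
rewrite !mxE coefMn -/(char_poly A) mulr_natr => <-.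
rewrite coef_sum.
transitivity (\sum_l ((i == l)%:R * (C l j)`_k - A i l * (C l j)`_k.+1)).
  apply: eq_bigr => l _; rewrite !mxE mulrBl coefB coefCM; congr (_ - _).
  by case: eqP => _; rewrite ?mulr1n ?mulr0n ?mul0r ?coef0 // coefXM mul1r.
rewrite sumrB; congr (_ - _).
  rewrite (bigD1 i) //= eqxx mul1r big1 ?addr0 // => l li.
  by rewrite eq_sym (negPf li) mul0r.
by apply: eq_bigr => l _; rewrite mxE.
Qed.

Lemma adj_coef0 : (char_poly A)`_0 *: 1%:M = - (A *m B 0).
Proof.
rewrite /B; move: (\adj (char_poly_mx A)) (mul_mx_adj (char_poly_mx A)) => C /matrixP e.
apply/matrixP => i j; have := e i j; move/(congr1 (fun p : {poly R} => p`_0)).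
rewrite !mxE coefMn -/(char_poly A) mulr_natr => <-.
rewrite coef_sum -sumrN; apply: eq_bigr => l _; rewrite !mxE mulrBl coefB coefCM.
by case: eqP => _; rewrite ?mulr1n ?mulr0n ?mul0r ?coef0 ?sub0r // coefXM sub0r.
Qed.

Lemma adj_coef_large : exists N, forall k, (N <= k)%N -> B k = 0.
Proof.
exists (\max_(p : 'I_n.+1 * 'I_n.+1) size (\adj (char_poly_mx A) p.1 p.2))%N.
move=> k le; apply/matrixP => i j; rewrite mxE [RHS]mxE nth_default //.
apply: leq_trans le; exact: (leq_bigmax (F := fun p : 'I_n.+1 * 'I_n.+1 => size (\adj (char_poly_mx A) p.1 p.2)) (i, j)).
Qed.

(** The recursion replaces [B k] by [A *m B k.+1] up to a scalar matrix, whose contribution is a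
    trace of a power of A. Raising k repeatedly ends at zero, since the adjugate has bounded
    degree. *)
Lemma trace_adj_coef i k : \tr (A ^+ i.+1 *m B k) = 0.
Proof.
have [N hN] := adj_coef_large.
have [m] := ubnP (N - k)%N; elim: m i k => // m IH i k lt.
have [le|lt'] := leqP N k; first by rewrite hN // mulmx0 mxtrace0.
have -> : B k = (char_poly A)`_k.+1 *: 1%:M + A *m B k.+1.
  by rewrite adj_coefS subrK.
rewrite mulmxDr -scalemxAr mulmx1 mxtraceD mxtraceZ trA mulr0 add0r mulmxA mulmxE.
by rewrite -exprSr IH //; lia.
Qed.

(** The coefficient c of degree k+1 satisfies (k+1) c = tr(B k) = (n+1) c, the first equality from
    the derivative and the second from the recursion. Absence of torsion makes c vanish for k <
    n. *)
Lemma char_poly_nilp : char_poly A = 'X^(n.+1).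
Proof.
have step k : (k < n)%N -> (char_poly A)`_k.+1 = 0.
  move=> lt; have := deriv_char_poly; move/(congr1 (fun p : {poly R} => p`_k)).
  rewrite coef_deriv.
  have -> : (\tr (\adj (char_poly_mx A)))`_k = \tr (B k).
    by rewrite coef_sum; apply: eq_bigr => i _; rewrite [RHS]mxE.
  have -> : B k = (char_poly A)`_k.+1 *: 1%:M + A *m B k.+1.
    by rewrite adj_coefS subrK.
  rewrite mxtraceD mxtraceZ -[X in X *m B _]expr1 trace_adj_coef addr0 mxtrace1 mulr_natr.
  move/eqP; rewrite eq_sym -subr_eq0 -mulrnBr; last by lia.
  have [m ->] : exists m, (n.+1 - k.+1 = m.+1)%N by exists (n - k.+1)%N; lia.
  by move/eqP/Rtf.
have zero : (char_poly A)`_0 = 0.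
  have := adj_coef0; move/(congr1 mxtrace).
  rewrite mxtraceZ mxtrace1 raddfN /= -[X in X *m B _]expr1 trace_adj_coef oppr0 mulr_natr.
  by apply: Rtf.
apply/polyP => k; rewrite coefXn.
have [lt|lt|->] := ltngtP k n.+1.
- by case: k lt => // k lt; apply: step.
- by rewrite nth_default // size_char_poly.
- by have := char_poly_monic A; rewrite monicE lead_coefE size_char_poly => /eqP.
Qed.

Lemma nilp_of_traces : A ^+ n.+1 = 0.
Proof.
by have := Cayley_Hamilton A; rewrite char_poly_nilp rmorphXn /= horner_mx_X.
Qed.

End PowerTraces.

Section EvenSubring.
Variables (K : numFieldType) (I : finType).
Local Notation E := (exterior K I).

Definition even_pred : {pred E} := fun u => [forall A : {set I}, odd #|A| ==> (u A == 0)].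

Lemma even_predP (u : E) : reflect (has_parity false u) (u \in even_pred).
Proof.
apply: (iffP forallP) => h A.
  by rewrite eqbF_neg negbK => oA; have := h A; rewrite oA => /eqP.
by apply/implyP => oA; apply/eqP/h; rewrite oA.
Qed.

Lemma even_pred_subring : subring_closed even_pred.
Proof.
split; first by apply/even_predP/parity1.
  move=> u v /even_predP hu /even_predP hv; apply/even_predP.
  by apply: parityD => //; exact: parityN.
move=> u v /even_predP hu /even_predP hv; apply/even_predP.
exact: (parityM hu hv).
Qed.

HB.instance Definition _ := GRing.isSubringClosed.Build E even_pred even_pred_subring.

(** The even elements form a commutative ring, over which determinants and the Cayley-Hamilton
    theorem are available. *)
Record even_ext := EvenExt { even_val : E; _ : even_val \in even_pred }.

HB.instance Definition _ := [isSub for even_val].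
HB.instance Definition _ := [Choice of even_ext by <:].
HB.instance Definition _ := [SubChoice_isSubNzRing of even_ext by <:].

Lemma even_mulC : commutative (@GRing.mul even_ext).
Proof.
move=> u v; apply: val_inj; rewrite !rmorphM /=.
have /even_predP hu := valP u; have /even_predP hv := valP v.
by rewrite (parityC hu hv) scale1r.
Qed.

HB.instance Definition _ := GRing.PzRing_hasCommutativeMul.Build even_ext even_mulC.

(* Rosset: the square of a matrix of odd elements has commuting entries and its
   powers have zero trace. *)
Lemma odd_mx_nilp n (S : 'M[E]_n.+1) : homog_mx 1 S -> S ^+ n.+1.*2 = 0.
Proof.
move=> hS; have ev i j : (S ^+ 2) i j \in even_pred.
  by apply/even_predP; have /homog_parity := homog_pow (p := 2) hS i j.
pose A : 'M[even_ext]_n.+1 := \matrix_(i, j) EvenExt (ev i j).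
have vA k : map_mx val (A ^+ k) = S ^+ k.*2.
  rewrite rmorphXn /= -muln2 mulnC exprM; congr (_ ^+ _).
  by apply/matrixP => i j; rewrite !mxE.
have v0 : even_val 0 = 0 :> E by exact: (raddf0 \val).
have inj : injective even_val by exact: val_inj.
rewrite -vA (@nilp_of_traces _ _ A).
- by rewrite map_mx0.
- move=> m r /(congr1 even_val).
  have -> : even_val (r *+ m.+1) = even_val r *+ m.+1 by exact: (raddfMn \val).
  rewrite v0 => /eqP; rewrite -scaler_nat scaler_eq0 pnatr_eq0 /= => /eqP r0.
  by apply: inj; rewrite r0 v0.
- move=> k; apply: inj; rewrite v0 -(trace_even_pow hS k) -vA.
  by rewrite trace_map_mx.
Qed.

Lemma odd_mx_nilp_le n (S : 'M[E]_n) p : homog_mx 1 S -> (2 * n <= p)%N -> S ^+ p = 0.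
Proof.
case: n S => [|n] S hS le; first by apply/matrixP => -[].
by rewrite -(subnKC le) exprD mul2n odd_mx_nilp // mul0r.
Qed.

End EvenSubring.

(** * Symmetrization of tensors and polarization *)

Section Polarization.
Variables (K : realFieldType) (H L J : finType) (lab : H -> L).
Implicit Types (a f : {ffun H -> J}) (phi chi : {perm H}).

(** A tensor on the slots H is evaluated by putting one and the same vector into all slots with a
    given label. The resulting form sees the tensor only up to these permutations. *)
Definition lab_perm phi := [forall h, lab (phi h) == lab h].

Definition precomp a phi : {ffun H -> J} := [ffun h => a (phi h)].

(** The sum expands the product over h of -1 + [h is not in B], in which every h outside B
    contributes a zero factor. *)
Lemma alternating_subset_sum (B : {set H}) :
  \sum_(T : {set H} | B \subset T) (-1) ^+ #|T| = (B == setT)%:R * (-1) ^+ #|H| :> K.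
Proof.
transitivity (\prod_(h : H) (-1 + (h \notin B)%:R : K)).
  rewrite bigA_distr big_mkcond /=; apply: eq_bigr => T _.
  rewrite (bigID (mem T)) /= (eq_bigr (fun=> -1)) => [|h ->] //.
  rewrite prodr_const [X in _ * X](eq_bigr (fun h => (h \notin B)%:R)); last first.
    by move=> h /negPf->.
  case: ifP => sBT.
    rewrite big1 ?mulr1 // => h hT; rewrite (_ : h \notin B) //.
    by apply: contra hT; exact: (subsetP sBT).
  move/negbT/subsetPn: sBT => [h hB hT].
  by rewrite (bigD1 h) //= hB mul0r mulr0.
have [->|nB] := eqVneq B setT.
  by rewrite mul1r -[#|H|]cardsT -[in RHS]prodr_const; under eq_bigr do rewrite inE addr0; apply: eq_bigl => h; rewrite inE.
have /subsetPn[h _ hB] : ~~ (setT \subset B) by rewrite subTset.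
by rewrite (bigD1 h) //= hB addNr !mul0r.
Qed.

(* The multilinear part of the form is extracted by inclusion-exclusion over the
   set T of the variables that are switched on. *)
Lemma polarization (d : {ffun H -> J} -> K) :
  (forall x : L -> J -> K, \sum_f d f * \prod_h x (lab h) (f h) = 0) ->
  forall a, \sum_(phi | lab_perm phi) d (precomp a phi) = 0.
Proof.
move=> hd a.
(* [x T l] is the sum of the basis vectors [a h] over the slots h in T with label l. In the
   expansion [p] records the slot chosen for each factor. Inclusion-exclusion keeps the surjective
   [p], hence permutations, and [c p] forces them to preserve labels. *)
pose x (T : {set H}) l k : K := \sum_h (h \in T)%:R * ((lab h == l) && (a h == k))%:R.
pose c (p : {ffun H -> H}) f : K := \prod_h ((lab (p h) == lab h) && (a (p h) == f h))%:R.
pose im (p : {ffun H -> H}) : {set H} := [set p h | h in H].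
have cE p : \sum_f d f * c p f =
    [forall h, lab (p h) == lab h]%:R * d [ffun h => a (p h)].
  rewrite (bigD1 [ffun h => a (p h)]) //= big1 => [|f nf].
    rewrite addr0 mulrC; congr (_ * _).
    have [/forallP hl|] := boolP [forall h, lab (p h) == lab h].
      by rewrite /c big1 // => h _; rewrite hl ffunE eqxx.
    rewrite negb_forall => /existsP[h nh].
    by rewrite /c (bigD1 h) //= (negPf nh) !mul0r.
  have /existsP[h nh] : [exists h, a (p h) != f h].
    apply: contraNT nf; rewrite negb_exists => /forallP e.
    by apply/eqP/ffunP => h; rewrite ffunE; have := e h; rewrite negbK => /eqP.
  by rewrite /c (bigD1 h) //= (negPf nh) andbF mul0r mulr0.
have expand T : \sum_f d f * \prod_h x T (lab h) (f h) =
    \sum_(p : {ffun H -> H}) (im p \subset T)%:R * \sum_f d f * c p f.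
  under eq_bigr => f _ do rewrite /x bigA_distr_bigA mulr_sumr.
  rewrite exchange_big /=; apply: eq_bigr => p _; rewrite mulr_sumr.
  apply: eq_bigr => f _; rewrite mulrCA big_split /=; congr (_ * (_ * _)).
  have [/subsetP sT|/subsetPn[h /imsetP[k _ ->] nk]] := boolP (im p \subset T).
    by rewrite big1 // => h _; rewrite sT // imset_f.
  by rewrite (bigD1 k) //= (negPf nk) mul0r.
have : \sum_(T : {set H}) (-1) ^+ #|T| * (\sum_f d f * \prod_h x T (lab h) (f h)) = 0.
  by rewrite big1 // => T _; rewrite hd mulr0.
under eq_bigr => T _ do rewrite expand mulr_sumr.
rewrite exchange_big /=.
have -> : forall F : {ffun H -> H} -> K, \sum_p \sum_(T : {set H}) (-1) ^+ #|T| * ((im p \subset T)%:R * F p)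
    = (-1) ^+ #|H| * \sum_p (im p == setT)%:R * F p.
  move=> F; rewrite mulr_sumr; apply: eq_bigr => p _.
  rewrite mulrA [_ * (_ == _)%:R]mulrC -alternating_subset_sum mulr_suml [RHS]big_mkcond /=.
  by apply: eq_bigr => T _; case: ifP => _; rewrite ?mul0r ?mul1r ?mulr0.
move/eqP; rewrite mulf_eq0 signr_eq0 /= => /eqP.
have imE (p : {ffun H -> H}) : (im p == setT) = injectiveb p.
  apply/eqP/injectiveP => [e|/injF_bij[q _ pq]].
    apply/injectiveP; rewrite /injectiveb /dinjectiveb; apply/card_uniqP.
    rewrite size_map -cardT -cardsT -e; apply: eq_card => h.
    by apply/imageP/imsetP => -[k _ ->]; exists k.
  by apply/setP => h; rewrite inE; apply/imsetP; exists (q h).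
under eq_bigr => p _ do rewrite imE cE.
rewrite (bigID (fun p : {ffun H -> H} => injectiveb p)) /= [X in _ + X]big1 ?addr0; last first.
  by move=> p /negPf->; rewrite mul0r.
rewrite (reindex_onto (fun phi : {perm H} => val phi) (fun p => insubd (1%g : {perm H}) p)) /=; last first.
  by move=> p ip; rewrite insubdK.
move=> e; rewrite -[RHS]e [LHS]big_mkcond [RHS]big_mkcond /=; apply: eq_bigr => phi _.
have -> : injectiveb (val phi) by exact: (valP phi).
rewrite valKd eqxx /= mul1r.
have -> : [forall h, lab ((val phi) h) == lab h] = lab_perm phi.
  by apply: eq_forallb => h; rewrite -pvalE.
case: ifP => _; rewrite ?mul0r // mul1r; congr d.
by apply/ffunP => h; rewrite !ffunE -pvalE.
Qed.

Variables (ep ka : {ffun H -> J} -> K).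
Hypothesis same_form : forall x : L -> J -> K,
  \sum_f ka f * \prod_h x (lab h) (f h) = \sum_f ep f * \prod_h x (lab h) (f h).

(* The two tensors have the same symmetrization, so pairing ep with the
   symmetrization of ka gives a positive multiple of the squared norm of the
   symmetrization of ep. *)
Lemma symmetrized_pairing a0 : \sum_(phi | lab_perm phi) ep (precomp a0 phi) != 0 ->
  exists phi, \sum_a ep a * ka (precomp a phi) != 0.
Proof.
move=> ne; apply/existsP; apply: contraT; rewrite negb_exists => /forallP h.
have e0 phi : \sum_a ep a * ka (precomp a phi) = 0.
  by apply/eqP; have := h phi; rewrite negbK.
have sym a : \sum_(phi | lab_perm phi) ka (precomp a phi) =
             \sum_(phi | lab_perm phi) ep (precomp a phi).
  apply/eqP; rewrite -subr_eq0 -sumrB; apply/eqP.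
  apply: (polarization (d := fun f => ka f - ep f)) => x.
  by under eq_bigr do rewrite mulrBl; rewrite sumrB same_form subrr.
have Q0 : \sum_a ep a * \sum_(phi | lab_perm phi) ep (precomp a phi) = 0.
  under eq_bigr => a _ do rewrite -sym mulr_sumr.
  by rewrite exchange_big /= big1.
suff : \sum_a (\sum_(phi | lab_perm phi) ep (precomp a phi)) ^+ 2 = 0.
  move/psumr_eq0P => /(_ (fun _ _ => sqr_ge0 _)) => /(_ a0 isT) /eqP.
  by rewrite sqrf_eq0 (negPf ne).
under eq_bigr => a _ do rewrite expr2 big_distrlr /=.
rewrite exchange_big /= big1 // => phi hphi.
rewrite exchange_big /=.
(* Label-preserving permutations form a group, so after translation by [phi] the pairing of two
   symmetrizations depends on one permutation only and is the sum [Q0] for each [phi]. *)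
rewrite (reindex_inj (mulIg phi)) /=.
transitivity (\sum_(chi | lab_perm chi) \sum_a ep a * ep (precomp a chi)).
  apply: eq_big => [chi|chi _].
    apply: eq_forallb => h'; rewrite permM; congr (_ == _).
    exact/eqP/(forallP hphi).
  rewrite (reindex_onto (fun a => precomp a phi^-1) (fun a => precomp a phi)) /=; last first.
    by move=> a _; apply/ffunP => k; rewrite !ffunE permKV.
  apply: eq_big => [a|a _].
    by apply/eqP/ffunP => k; rewrite !ffunE permK.
  congr (ep _ * ep _); apply/ffunP => k; rewrite !ffunE ?permM permK //.
rewrite exchange_big /= -[RHS]Q0; apply: eq_bigr => a _.
by rewrite mulr_sumr.
Qed.

End Polarization.

(** * The action of linear substitutions on the volume element *)

Section LinearSubstitution.
Variables (K : realFieldType) (m : nat).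
Local Notation I := (sym_index m).
Local Notation E := (exterior K I).
Implicit Types (g h : 'M[K]_m) (i j a b : 'I_m) (p q : I).

Lemma homog1C (u v : E) : homog 1 u -> homog 1 v -> u * v = - (v * u).
Proof. by move=> hu hv; rewrite (homogC hu hv) mul1n expr1 scaleN1r. Qed.

Lemma homog1_sqr (u : E) : homog 1 u -> u * u = 0.
Proof. by move=> hu; apply: eq_oppr0; exact: homog1C. Qed.

Lemma sort_pairC i j : sort_pair i j = sort_pair j i.
Proof. by rewrite /sort_pair; case: ltngtP => // /ord_inj->. Qed.

Lemma sym_index_ofC i j : sym_index_of i j = sym_index_of j i.
Proof. by apply: val_inj; rewrite /= sort_pairC. Qed.

Lemma sym_index_of_val p : sym_index_of (val p).1 (val p).2 = p.
Proof.
by apply: val_inj; rewrite /= /sort_pair (valP p); case: (val p).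
Qed.

Definition symgen : 'M[E]_m := \matrix_(i, j) ext_gen K (sym_index_of i j).

Definition cmx n (A : 'M[K]_(m, n)) : 'M[E]_(m, n) := map_mx (in_alg E) A.

Lemma homog_symgen : homog_mx 1 symgen.
Proof. by move=> i j; rewrite mxE; exact: homog_gen. Qed.

Lemma symgen_tr : symgen^T = symgen.
Proof. by apply/matrixP => i j; rewrite !mxE sym_index_ofC. Qed.

Definition substmx g : 'M[E]_m := cmx g^T *m symgen *m cmx g.

Lemma substmxE g i j :
  substmx g i j = \sum_a \sum_b (g a i * g b j) *: ext_gen K (sym_index_of a b).
Proof.
rewrite mxE exchange_big /=; apply: eq_bigr => b _; rewrite !mxE mulr_suml.
apply: eq_bigr => a _; rewrite !mxE /= mulr_algl -scalerAr mulr1 scalerA mulrC.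
by [].
Qed.

Lemma homog_substmx g : homog_mx 1 (substmx g).
Proof.
move=> i j; rewrite substmxE; apply: homog_sum => a _; apply: homog_sum => b _.
apply: homogZ; exact: homog_gen.
Qed.

Lemma substmx_sym g i j : substmx g i j = substmx g j i.
Proof.
rewrite !substmxE exchange_big /=; apply: eq_bigr => a _; apply: eq_bigr => b _.
by rewrite mulrC sym_index_ofC.
Qed.

Definition subst g : E -> E := ext_hom (coordinate (substmx g)).

Lemma subst_linear g : linear (subst g).
Proof. exact: ext_hom_linear. Qed.

HB.instance Definition _ g :=
  GRing.isLinear.Build K E E *:%R (subst g) (subst_linear g).

Lemma subst_monoid g : monoid_morphism (subst g).
Proof.
split; first exact: ext_hom1.
move=> u v; apply: ext_homM => [p q|p].
  by apply: homog1C; exact: homog_substmx.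
by apply: homog1_sqr; exact: homog_substmx.
Qed.

HB.instance Definition _ g :=
  GRing.isMonoidMorphism.Build E E (subst g) (subst_monoid g).

Lemma subst_symgen g i j : subst g (symgen i j) = substmx g i j.
Proof.
rewrite mxE [LHS]ext_hom_gen /coordinate /= /sort_pair.
by case: ifP => _ //=; rewrite substmx_sym.
Qed.

Lemma subst_symgen_mx g : map_mx (subst g) symgen = substmx g.
Proof. by apply/matrixP => i j; rewrite mxE subst_symgen. Qed.

Lemma symgen_val p : ext_gen K p = symgen (val p).1 (val p).2.
Proof. by rewrite mxE sym_index_of_val. Qed.

Lemma eq_morph_gen (f f' : {lrmorphism E -> E}) :
  (forall i j, f (symgen i j) = f' (symgen i j)) -> f =1 f'.
Proof.
move=> e u; rewrite [u]ext_sum_basis !linear_sum; apply: eq_bigr => A _.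
rewrite !linearZ -prod_ext_gen !rmorph_prod; congr (_ *: _).
by apply: eq_bigr => p _; rewrite symgen_val; exact: e.
Qed.

Lemma map_cmx g' n (A : 'M[K]_(m, n)) : map_mx (subst g') (cmx A) = cmx A.
Proof.
by apply/matrixP => i j; rewrite !mxE /= linearZ /= rmorph1.
Qed.

Lemma cmxM (A B : 'M[K]_m) : cmx (A *m B) = cmx A *m cmx B.
Proof. by rewrite /cmx map_mxM. Qed.

Lemma subst_comp g h u : subst g (subst h u) = subst (g *m h) u.
Proof.
have := @eq_morph_gen (subst g \o subst h) (subst (g *m h)); apply => i j.
rewrite /= !subst_symgen.
transitivity (map_mx (subst g) (substmx h) i j); first by rewrite [RHS]mxE.
rewrite /substmx !map_mxM /= !map_cmx subst_symgen_mx /substmx trmx_mul !cmxM.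
by rewrite !mulmxA.
Qed.

Lemma homog_subst g d u : homog d u -> homog d (subst g u).
Proof.
move=> hu; rewrite [u]ext_sum_basis linear_sum; apply: homog_sum => A _.
have [->|nA] := eqVneq (u A) 0; first by rewrite scale0r linear0; exact: homog0.
have <- : #|A| = d by apply/eqP; apply: contraNT nA => /hu->.
rewrite linearZ; apply: homogZ; rewrite /= -prod_ext_gen rmorph_prod /=.
rewrite -sum1_card; apply: homog_prod => p _.
rewrite symgen_val subst_symgen; exact: homog_substmx.
Qed.

Definition vol : E := ext_basis K [set: I].

Definition jac g : K := subst g vol [set: I].

Lemma subst_vol g : subst g vol = jac g *: vol.
Proof.
apply: homog_top; apply: homog_subst; rewrite -cardsT; exact: homog_basis.
Qed.

Lemma vol_top : vol [set: I] = 1.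
Proof. by rewrite ffunE eqxx. Qed.

Lemma jacM g h : jac (g *m h) = jac g * jac h.
Proof.
rewrite {1}/jac -subst_comp subst_vol linearZ /= subst_vol scalerA.
by rewrite (extZ (jac h * jac g) vol) vol_top mulr1 [LHS]mulrC.
Qed.

Lemma prod_all_gen : \prod_p ext_gen K p = vol.
Proof. by rewrite /vol -prod_ext_gen; apply: eq_bigl => p; rewrite inE. Qed.

End LinearSubstitution.

Section TriangularProducts.
Variables (K : realFieldType) (I : finType).
Local Notation E := (exterior K I).

Lemma homog1_sum (u : E) : homog 1 u -> u = \sum_e u [set e] *: ext_gen K e.
Proof.
move=> hu; apply/ffunP => C; rewrite sum_ffunE.
have [/cards1P[e ->]|nC] := boolP (#|C| == 1%N).
  rewrite (bigD1 e) //= !ffunE eqxx big1 => [|e' ne]; first by rewrite /GRing.scale /= mulr1 addr0.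
  rewrite !ffunE (inj_eq set1_inj) eq_sym (negPf ne) scaler0 //.
rewrite hu // big1 // => e _; rewrite !ffunE; have [eC|_] := eqVneq C [set e]; last by rewrite scaler0.
by rewrite eC cards1 in nC.
Qed.

Lemma prod_gen_mulr0 (l : seq I) e : e \in l -> (\prod_(p <- l) ext_gen K p) * ext_gen K e = 0.
Proof.
move=> el; have h : homog (\sum_(p <- l) 1) (\prod_(p <- l) ext_gen K p).
  by apply: homog_prod => p _; exact: homog_gen.
rewrite (homogC h (@homog_gen _ _ e)).
by rewrite (@prod_gen0 _ _ _ _ (@ext_genC K I) (@ext_genK K I) _ predT) ?scaler0.
Qed.

Variables (y : I -> E) (rho : I -> nat).
Hypothesis hy : forall e, homog 1 (y e).
Hypothesis tri : forall e e', y e [set e'] != 0 -> e' = e \/ (rho e' < rho e)%N.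

(** The list is closed downwards for [rho], so an off-diagonal generator of the last factor already
    occurs to its left and kills the product. *)
Lemma prod_triangular_seq l :
  (forall l1 e l2, l = l1 ++ e :: l2 -> forall e', (rho e' < rho e)%N -> e' \in l1) ->
  \prod_(e <- l) y e = (\prod_(e <- l) y e [set e]) *: \prod_(e <- l) ext_gen K e.
Proof.
elim/last_ind: l => [|l e IH] cl; first by rewrite !big_nil scale1r.
rewrite !big_rcons /= IH; last first.
  by move=> l1 e' l2 el; apply: cl; rewrite el rcons_cat rcons_cons.
rewrite [y e in LHS](homog1_sum (hy e)) mulr_sumr (bigD1 e) //= [X in _ + X]big1 ?addr0.
  by rewrite -scalerAr -scalerAl scalerA mulrC.
move=> e' ne; have [->|/tri[/eqP|lt]] := eqVneq (y e [set e']) 0.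
- by rewrite scale0r mulr0.
- by rewrite (negPf ne).
rewrite -scalerAr -scalerAl prod_gen_mulr0 ?scaler0 //.
by apply: (cl _ _ [::]); rewrite ?cats1.
Qed.

Lemma prod_triangular :
  \prod_e y e = (\prod_e y e [set e]) *: \prod_e ext_gen K e.
Proof.
pose l := sort (fun e e' => rho e <= rho e')%N (index_enum I).
have pl : perm_eq (index_enum I) l by rewrite perm_sym perm_sort.
(* The same [k] serves both products, so the sign of sorting by [rho] cancels. *)
have [k hk] := homog_prod_perm K I (fun=> 1%N) pl.
rewrite (hk y hy) (hk (fun e => ext_gen K e)) => [|p]; last exact: homog_gen.
rewrite scalerA mulrC -scalerA; congr (_ *: _).
rewrite (perm_big _ pl) /=; apply: prod_triangular_seq => l1 e l2 el e' lt.
have : e' \in l by rewrite -(perm_mem pl) mem_index_enum.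
rewrite el mem_cat; case/orP => // e'l2.
have : sorted (fun e e' => rho e <= rho e')%N l.
  by apply: sort_sorted => a b; exact: leq_total.
rewrite sorted_pairwise => [|a b c]; last exact: leq_trans.
rewrite el pairwise_cat /= => /and3P[_ _ /andP[/allP all2 _]].
move: e'l2; rewrite inE => /orP[/eqP ee|/all2]; last by rewrite leqNgt lt.
by rewrite ee ltnn in lt.
Qed.
End TriangularProducts.

Section Slots.
Variable m : nat.
Local Notation I := (sym_index m).
Local Notation H := ('I_m.+1 * 'I_m)%type.

(* Each label occurs exactly m + 1 times among the endpoints of the edges
   (i, j), i <= j; a slot (c, i) is the c-th occurrence of the label i. *)
Definition slot (e : I) (b : bool) : H :=
  if b then ((if (val e).1 == (val e).2 then ord_max else lift ord_max (val e).1), (val e).2)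
  else (lift ord_max (val e).2, (val e).1).

(** In [slot], the end i of an edge {i, j} takes the slot of i numbered by the other end j. Only the
    loop at i meets i twice, and its second end takes the extra number [ord_max]. *)
Definition slot_inv (h : H) : I * bool :=
  if unlift ord_max h.1 is Some c
  then (sym_index_of h.2 c, ~~ (h.2 <= c)%N) else (sym_index_of h.2 h.2, true).

Lemma slotK e b : slot_inv (slot e b) = (e, b).
Proof.
have := valP e; have := sym_index_of_val e; case: (val e) => i j /= <- le.
rewrite /slot_inv /slot /= /sort_pair le; case: b => /=; last by rewrite liftK le.
case: eqVneq => [->|ne] /=; first by rewrite unlift_none.
rewrite liftK sym_index_ofC leqNgt ltn_neqAle le andbT.
by rewrite (inj_eq val_inj) ne.
Qed.

Lemma slot_invK h : slot (slot_inv h).1 (slot_inv h).2 = h.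
Proof.
case: h => c i; rewrite /slot_inv /=; case: unliftP => [c' ->|->] /=.
  rewrite /slot /= /sort_pair; case: leqP => //= lt.
  by rewrite -(inj_eq val_inj) /= ltn_eqF.
by rewrite /slot /= /sort_pair leqnn /= eqxx.
Qed.

Lemma big_slots (R : Type) (idx : R) (op : Monoid.com_law idx) (F : H -> R) :
  \big[op/idx]_h F h = \big[op/idx]_e op (F (slot e false)) (F (slot e true)).
Proof.
rewrite (reindex (fun p : I * bool => slot p.1 p.2)); last first.
  by exists slot_inv => [[e b] _|h _]; rewrite ?slotK ?slot_invK.
rewrite -(pair_bigA _ (fun e b => F (slot e b))) /=; apply: eq_bigr => e _.
by rewrite big_bool /= Monoid.mulmC.
Qed.

Lemma card_sym_index : (#|{: I}| * 2 = m.+1 * m)%N.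
Proof.
have := big_slots addn (fun=> 1%N); rewrite /= sum1_card card_prod !card_ord => ->.
by rewrite sum_nat_const.
Qed.
End Slots.

Arguments slot : simpl never.
Arguments slot_inv : simpl never.

Section Jacobian.
Variables (K : realFieldType) (m : nat).
Local Notation I := (sym_index m).
Local Notation E := (exterior K I).
Implicit Types (g h : 'M[K]_m) (i j a b : 'I_m) (e : I).
Local Notation S := (symgen K m).

Lemma substmx_coef g e e' : coordinate (substmx g) e [set e'] =
  \sum_a \sum_b (g a (val e).1 * g b (val e).2) * (sym_index_of a b == e')%:R.
Proof.
rewrite /coordinate substmxE sum_ffunE; apply: eq_bigr => a _.
rewrite sum_ffunE; apply: eq_bigr => b _.
by rewrite !ffunE (inj_eq set1_inj) eq_sym.
Qed.

Lemma substmx_coef_neq0 g e e' : coordinate (substmx g) e [set e'] != 0 ->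
  exists a b, [/\ g a (val e).1 != 0, g b (val e).2 != 0 & e' = sym_index_of a b].
Proof.
rewrite substmx_coef => nz.
have nz_sum (F : 'I_m -> K) : \sum_i F i != 0 -> exists i, F i != 0.
  move=> nF; apply/existsP; apply: contraNT nF; rewrite negb_exists => /forallP h.
  by rewrite big1 // => i _; apply/eqP; have := h i; rewrite negbK.
have [a /nz_sum[b]] := nz_sum _ nz.
rewrite !mulf_eq0 !negb_or => /andP[/andP[ga gb]].
case: (sym_index_of a b =P e') => [<- _|]; last by rewrite eqxx.
by exists a, b.
Qed.

(** Besides the diagonal term, the edge {i, j} is reached with its ends exchanged, which contributes
    g j i * g i j. The hypothesis kills it for upper and lower triangular matrices alike. *)
Lemma substmx_coef_diag g e :
  (forall i j, i != j -> g i j = 0 \/ g j i = 0) ->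
  coordinate (substmx g) e [set e] = g (val e).1 (val e).1 * g (val e).2 (val e).2.
Proof.
move=> tg; rewrite substmx_coef.
have := sym_index_of_val e; have := valP e; case: (val e) => i j /= le ee.
have sE a b : (sym_index_of a b == e) = ((a == i) && (b == j)) || ((a == j) && (b == i)).
  rewrite -ee -(inj_eq val_inj) /= /sort_pair le.
  case: (leqP a b) => ab; rewrite xpair_eqE.
    case: (boolP (_ && _)) => //= nab; apply/esym/negbTE.
    apply: contra nab => /andP[/eqP ea /eqP eb]; subst a b.
    have -> : i = j by apply: val_inj; apply/eqP; rewrite /= eqn_leq le ab.
    by rewrite eqxx.
  rewrite [RHS]orbC [(a == j) && _]andbC.
  case: (boolP ((b == i) && (a == j))) => //= nab; apply/esym/negbTE.
  by apply/negP => /andP[/eqP ea /eqP eb]; move: ab; rewrite ea eb ltnNge le.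
have gg a b : ((a == j) && (b == i)) -> ~~ ((a == i) && (b == j)) -> g a i * g b j = 0.
  move=> /andP[/eqP-> /eqP->]; have [->|ne _] := eqVneq i j; first by [].
  by case: (tg _ _ ne) => ->; rewrite ?(mulr0, mul0r).
rewrite (bigD1 i) //= (bigD1 j) //= sE !eqxx /= mulr1 -[RHS]addr0 -addrA; congr (_ + _).
rewrite !big1 ?addr0 // => [a ai|b bj].
  apply: big1 => b _; rewrite sE (negPf ai) /=.
  case: (boolP (_ && _)) => /= hb; last by rewrite mulr0.
  by rewrite gg ?mul0r // (negPf ai).
rewrite sE (negPf bj) andbF /=.
case: (boolP (_ && _)) => /= hb; last by rewrite mulr0.
by rewrite gg ?mul0r // (negPf bj) andbF.
Qed.

(** The product of the diagonal coefficients over edges is a product over slots, where each diagonal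
    entry of g occurs m+1 times. *)
Lemma jac_trig_prod g (rho : I -> nat) :
  (forall i j, i != j -> g i j = 0 \/ g j i = 0) ->
  (forall e e', coordinate (substmx g) e [set e'] != 0 -> e' = e \/ (rho e' < rho e)%N) ->
  jac g = (\prod_i g i i) ^+ m.+1.
Proof.
move=> tg tri.
have hy e : homog 1 (coordinate (substmx g) e) by exact: homog_substmx.
have := prod_triangular hy tri.
have -> : \prod_e coordinate (substmx g) e = subst g (vol K m).
  rewrite -prod_all_gen rmorph_prod; apply: eq_bigr => e _.
  by rewrite symgen_val /= subst_symgen.
rewrite prod_all_gen subst_vol => /(congr1 (fun u : E => u [set: I])).
rewrite !extZ vol_top !mulr1 => ->.
under eq_bigr => e _ do rewrite substmx_coef_diag //.
transitivity (\prod_(h : 'I_m.+1 * 'I_m) g h.2 h.2).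
  by rewrite big_slots; apply: eq_bigr.
rewrite -(pair_bigA _ (fun c i => g i i)) /= prodr_const card_ord.
by [].
Qed.

(** A predicate closed under products, so that it can be checked on the factors of an LUP
    decomposition. *)
Definition jac_det g := jac g = \det g ^+ m.+1.

Let lexi (e : I) := ((val e).1 * m + (val e).2)%N.

Lemma lexi_sym_index_of a b :
  lexi (sym_index_of a b) = if (a <= b)%N then (a * m + b)%N else (b * m + a)%N.
Proof. by rewrite /lexi /= /sort_pair; case: ifP. Qed.

Lemma jac_upper g : (forall a i, (i < a)%N -> g a i = 0) -> jac_det g.
Proof.
move=> ug; rewrite /jac_det -det_tr det_trig; last first.
  by apply/is_trig_mxP => i j lt; rewrite mxE ug.
rewrite (jac_trig_prod (rho := lexi)); first by under [in RHS]eq_bigr do rewrite mxE.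
  by move=> i j; rewrite neq_ltn => /orP[] /ug; [right|left].
move=> e e' /substmx_coef_neq0[a [b [ga gb ->]]].
have ai : (a <= (val e).1)%N by rewrite leqNgt; apply: contra ga => /ug->.
have bj : (b <= (val e).2)%N by rewrite leqNgt; apply: contra gb => /ug->.
have le := valP e; have ee := sym_index_of_val e; move: ai bj le ee.
rewrite lexi_sym_index_of /lexi; case: (val e) => i j /= ai bj le <-.
have bm := ltn_ord b; have im := ltn_ord i.
have [ai'|ai'|ai'] := ltngtP a i; last 2 first.
- by rewrite leqNgt ai' in ai.
- move/ord_inj: ai' => ?; subst a.
  have [bj'|bj'|/ord_inj->] := ltngtP b j; [right|by rewrite leqNgt bj' in bj|by left].
  by case: ifP => ?; nia.
by right; case: ifP => ?; nia.
Qed.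

Lemma jac_lower g : (forall a i, (a < i)%N -> g a i = 0) -> jac_det g.
Proof.
move=> lg; rewrite /jac_det det_trig; last by apply/is_trig_mxP.
rewrite (jac_trig_prod (rho := fun e => (m * m - lexi e)%N)) //.
  by move=> i j; rewrite neq_ltn => /orP[] /lg; [left|right].
move=> e e' /substmx_coef_neq0[a [b [ga gb ->]]].
have ai : ((val e).1 <= a)%N by rewrite leqNgt; apply: contra ga => /lg->.
have bj : ((val e).2 <= b)%N by rewrite leqNgt; apply: contra gb => /lg->.
have le := valP e; have ee := sym_index_of_val e; move: ai bj le ee.
rewrite lexi_sym_index_of /lexi; case: (val e) => i j /= ai bj le <-.
have bm := ltn_ord b; have am := ltn_ord a.
have [ai'|ai'|ai'] := ltngtP a i.
- by rewrite leqNgt ai' in ai.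
- by right; case: ifP => ?; nia.
move/ord_inj: ai' => ?; subst a.
have [bj'|bj'|/ord_inj->] := ltngtP b j; [by rewrite leqNgt bj' in bj|right|by left].
by case: ifP => ?; nia.
Qed.

Lemma jac_detM g h : jac_det g -> jac_det h -> jac_det (g *m h).
Proof. by rewrite /jac_det jacM det_mulmx exprMn => -> ->. Qed.

(* A transposition matrix is, up to a diagonal sign matrix, a product of three
   transvections. *)
Lemma jac_tperm i j : jac_det (tperm_mx i j).
Proof.
wlog ij : i j / (i < j)%N.
  move=> th; have [/th//|/th|/ord_inj->] := ltngtP i j.
    by rewrite /tperm_mx tpermC.
  by rewrite /tperm_mx tperm1 perm_mx1; apply: jac_upper => a b lt; rewrite mxE -(inj_eq val_inj) /= gtn_eqF.
pose T1 : 'M[K]_m := 1%:M + delta_mx i j.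
pose T2 : 'M[K]_m := 1%:M - delta_mx j i.
pose D : 'M[K]_m := 1%:M - 2 *: delta_mx i i.
have nij : (i == j) = false by rewrite -(inj_eq val_inj) /= ltn_eqF.
have nji : (j == i) = false by rewrite eq_sym.
have -> : tperm_mx i j = T1 *m T2 *m T1 *m D.
  have -> : T1 *m T2 *m T1 = 1%:M + delta_mx i j - delta_mx j i - delta_mx i i - delta_mx j j.
    rewrite /T1 /T2 !(mulmxDl, mulmxDr, mulNmx, mulmxN, mul1mx, mulmx1, mul_delta_mx_cond).
    rewrite ?nij ?nji ?eqxx !(mulr0n, mulr1n, mul_delta_mx, subr0, add0r, addr0, oppr0).
    by apply/matrixP => a b; rewrite !mxE; ring.
  rewrite /D !(mulmxDl, mulmxDr, mulNmx, mulmxN, mul1mx, mulmx1, mul_delta_mx_cond, =^~ scalemxAr).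
  rewrite ?nij ?nji ?eqxx !(mulr0n, mulr1n, subr0, addr0, oppr0, scaler0).
  apply/matrixP => a b; rewrite !mxE permE /=.
  have [->|ai] := eqVneq a i; last have [->|aj] := eqVneq a j; rewrite ?nij ?nji ?eqxx /=;
    (have [eb|bi] := eqVneq b i; last have [eb|bj] := eqVneq b j);
    rewrite ?eb ?nij ?nji ?eqxx ?(negPf ai) ?(negPf aj) /= ?mulr1n ?mulr0n; try ring.
  all: rewrite ?(eq_sym i b) ?(eq_sym j b) ?(negPf bi) ?(negPf bj) /=; try ring.
have dz a b k l : (k == l) = false -> delta_mx k l a b = 0 :> K \/ (a = k /\ b = l).
  move=> _; rewrite mxE; case: eqP => /=; [|by left].
  by case: eqP => /=; [right|left].
have z1 a b : a != b -> ~ (a = i /\ b = j) -> T1 a b = 0.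
  move=> ab h; rewrite mxE (mxE _ _ a b) (negPf ab) add0r.
  by case: (dz a b i j nij).
have z2 a b : a != b -> ~ (a = j /\ b = i) -> T2 a b = 0.
  move=> ab h; rewrite !mxE (negPf ab) sub0r.
  by case: (dz a b j i nji) => // e; rewrite mxE in e; rewrite e oppr0.
apply: jac_detM; first apply: jac_detM; first apply: jac_detM.
- apply: jac_upper => a b lt; apply: z1; first by rewrite -(inj_eq val_inj) /= gtn_eqF.
  by move=> [ea eb]; subst; rewrite ltnNge ltnW in lt.
- apply: jac_lower => a b lt; apply: z2; first by rewrite -(inj_eq val_inj) /= ltn_eqF.
  by move=> [ea eb]; subst; rewrite ltnNge ltnW in lt.
- apply: jac_upper => a b lt; apply: z1; first by rewrite -(inj_eq val_inj) /= gtn_eqF.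
  by move=> [ea eb]; subst; rewrite ltnNge ltnW in lt.
- apply: jac_upper => a b lt; rewrite !mxE -(inj_eq val_inj) /= gtn_eqF // sub0r.
  case: eqP => [ea|] /=; last by rewrite mulr0 oppr0.
  case: eqP => [eb|] /=; last by rewrite mulr0 oppr0.
  by rewrite ea eb ltnn in lt.
Qed.

Lemma jac1 : jac_det (1%:M : 'M[K]_m).
Proof. by apply: jac_upper => a b lt; rewrite mxE -(inj_eq val_inj) /= gtn_eqF. Qed.

Lemma jac_perm (s : 'S_m) : jac_det (perm_mx s).
Proof.
have [ts -> _] := prod_tpermP s.
elim: ts => [|t ts IH]; first by rewrite big_nil perm_mx1; exact: jac1.
by rewrite big_cons perm_mxM; apply: jac_detM => //; exact: jac_tperm.
Qed.
End Jacobian.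

Lemma jacE (K : realFieldType) m (g : 'M[K]_m) : jac g = \det g ^+ m.+1.
Proof.
case: m g => [|m] g.
  by have := jac1 K 0; congr (jac_det _); apply/matrixP => -[].
have := cormen_lup_correct g; have := cormen_lup_perm g.
have := @cormen_lup_lower _ _ g; have := @cormen_lup_upper _ _ g.
case: (cormen_lup g) => [[P L] U] /= up lo /is_perm_mxP[s ->] e.
have {}e : perm_mx s *m g = L *m U := e.
have -> : g = perm_mx s^-1 *m (L *m U).
  by rewrite -e mulmxA -perm_mxM mulVg perm_mx1 mul1mx.
apply: jac_detM; first exact: jac_perm.
have jU : jac_det U by apply: jac_upper => a b lt; rewrite up.
have jL : jac_det L.
  apply: jac_lower => a b lt; rewrite lo; last by rewrite ltnW.
  by rewrite -(inj_eq val_inj) /= ltn_eqF.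
exact: jac_detM.
Qed.

(** * Contraction of the volume element with sign tensors *)

Section GramContraction.
Variables (K : realFieldType) (m : nat).
Local Notation I := (sym_index m).
Local Notation E := (exterior K I).
Local Notation H := ('I_m.+1 * 'I_m)%type.
Implicit Types (f a : {ffun H -> 'I_m}) (e : I).

(** The volume element as a tensor in its subscripts: [f] fills both ends of every edge, and the
    label of each slot as its value gives back the volume element. *)
Definition edge_prod f : E :=
  \prod_e ext_gen K (sym_index_of (f (slot e false)) (f (slot e true))).

(** Putting the vector [x i] into all slots labelled i is the linear substitution with these vectors
    as columns, so the form is its Jacobian. *)
Lemma edge_prod_form (x : 'I_m -> 'I_m -> K) :
  \sum_f edge_prod f [set: I] * \prod_h x h.2 (f h) = \det (\matrix_(i, k) x i k) ^+ m.+1.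
Proof.
pose g : 'M[K]_m := \matrix_(k, i) x i k.
have <- : \det g = \det (\matrix_(i, k) x i k).
  by rewrite -det_tr; congr (\det _); apply/matrixP => i j; rewrite !mxE.
rewrite -jacE /jac -prod_all_gen rmorph_prod.
pose Q : E := \prod_(e : I) \sum_(q : ('I_m * 'I_m)%type)
    (g q.1 (val e).1 * g q.2 (val e).2) *: ext_gen K (sym_index_of q.1 q.2).
transitivity (Q [set: I]); last first.
  congr ((_ : E) _); apply: eq_bigr => e _.
  rewrite symgen_val /= subst_symgen substmxE pair_bigA /=.
  by apply: eq_bigr => -[].
rewrite /Q bigA_distr_bigA sum_ffunE.
rewrite (reindex (fun f => [ffun e : I => (f (slot e false), f (slot e true))])) /=; last first.
  exists (fun p : {ffun I -> 'I_m * 'I_m} => [ffun h =>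
     let q := slot_inv h in if q.2 then (p q.1).2 else (p q.1).1]) => f _.
    apply/ffunP => h; rewrite ffunE -[in RHS](slot_invK h).
    by case: (slot_inv h) => e b; case: b; cbn [fst snd]; rewrite ffunE.
  by apply/ffunP => e; rewrite !ffunE /= !slotK /=; case: (f e).
apply: eq_bigr => f _; rewrite scaler_prod extZ mulrC; congr (_ * _).
  rewrite big_slots; apply: eq_bigr => e _; rewrite !mxE !ffunE /slot /=.
  by [].
by congr ((_ : E) _); apply: eq_bigr => e _; rewrite ffunE.
Qed.

(** The sign tensor: the sign of c if c is a permutation, and 0 otherwise. Written as a determinant,
    it inherits its product and expansion rules from those of determinants. *)
Definition cell_det n (c : 'I_n -> 'I_n) : K := \det (\matrix_(i, k) (c i == k)%:R).

Lemma cell_detE n (c : 'I_n -> 'I_n) :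
  cell_det c = \sum_(s : 'S_n) (-1) ^+ s * \prod_i (c i == s i)%:R.
Proof.
by apply: eq_bigr => s _; congr (_ * _); apply: eq_bigr => i _; rewrite mxE.
Qed.

Lemma cell_det_perm n (s : 'S_n) : cell_det s = (-1) ^+ s.
Proof.
rewrite -(det_perm K); congr (\det _); apply/matrixP => i j; rewrite !mxE; by [].
Qed.

Definition epsilon f : K := \prod_c cell_det (fun i => f (c, i)).

Definition cell_perm (s : {ffun 'I_m.+1 -> 'S_m}) : {ffun H -> 'I_m} :=
  [ffun h => s h.1 h.2].

Lemma epsilonE f : epsilon f =
  \sum_(s : {ffun 'I_m.+1 -> 'S_m}) (\prod_c (-1) ^+ (s c)) * (f == cell_perm s)%:R.
Proof.
rewrite /epsilon; under eq_bigr do rewrite cell_detE.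
rewrite bigA_distr_bigA; apply: eq_bigr => s _; rewrite big_split /=; congr (_ * _).
case: eqP => [->|/eqP nf].
  by rewrite big1 // => c _; rewrite big1 // => i _; rewrite ffunE eqxx.
have [h nh] : exists h, f h != cell_perm s h.
  apply/existsP; apply: contraNT nf; rewrite negb_exists => /forallP e.
  by apply/eqP/ffunP => h; apply/eqP; have := e h; rewrite negbK.
move: nh; case: h => c i; rewrite ffunE /= => nci.
by rewrite (bigD1 c) //= (bigD1 i) //= (negPf nci) !mul0r.
Qed.

Lemma epsilon_form (x : 'I_m -> 'I_m -> K) :
  \sum_f epsilon f * \prod_h x h.2 (f h) = \det (\matrix_(i, k) x i k) ^+ m.+1.
Proof.
under eq_bigr => f _ do rewrite epsilonE mulr_suml.
rewrite exchange_big /=.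
transitivity (\prod_(c : 'I_m.+1) \sum_(s : 'S_m) ((-1) ^+ s * \prod_i x i (s i))); last first.
  rewrite prodr_const card_ord; congr (_ ^+ _); apply: eq_bigr => s _.
  by congr (_ * _); apply: eq_bigr => i _; rewrite mxE.
rewrite bigA_distr_bigA; apply: eq_bigr => s _.
rewrite (bigD1 (cell_perm s)) //= eqxx mulr1 [X in _ + X]big1 ?addr0; last first.
  by move=> f /negPf->; rewrite mulr0 mul0r.
rewrite big_split /=; congr (_ * _).
rewrite pair_bigA /=; apply: eq_bigr => -[c i] _ /=.
by rewrite ffunE.
Qed.

(* Pairing epsilon with its own symmetrization is nonzero because epsilon is 1 on
   the assignment of its label to each slot. *)
Lemma contraction_neq0 : exists phi : {perm H},
  (\sum_a epsilon a *: edge_prod (precomp a phi)) [set: I] != 0.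
Proof.
have same x : \sum_f edge_prod f [set: I] * \prod_h x (snd h) (f h)
    = \sum_f epsilon f * \prod_h x (snd h) (f h).
  by rewrite edge_prod_form epsilon_form.
have [|phi hphi] := @symmetrized_pairing K H 'I_m 'I_m snd epsilon _ same [ffun h => h.2].
  have e1 phi : lab_perm snd phi -> epsilon (precomp [ffun h => h.2] phi) = 1 :> K.
    move/forallP => hphi; rewrite /epsilon big1 // => c _.
    transitivity (cell_det (1%g : 'S_m)); last by rewrite cell_det_perm odd_perm1.
    congr (\det _); apply/matrixP => i k; rewrite !mxE !ffunE perm1.
    by have /eqP -> := hphi (c, i).
  rewrite (eq_bigr _ e1) sumr_const pnatr_eq0 -lt0n; apply/card_gt0P.
  by exists 1%g; apply/forallP => h; rewrite perm1.
by exists phi; rewrite sum_ffunE; under eq_bigr do rewrite extZ.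
Qed.

End GramContraction.

(** * Reduction to products of traces with a Pfaffian *)

Section Brackets.
Variables (K : realFieldType) (m : nat) (H : finType).
Local Notation I := (sym_index m).
Local Notation E := (exterior K I).
Local Notation S := (symgen K m).
Local Notation F := {ffun H -> 'I_m}.
Implicit Types (a : F) (h u v : H) (k l : 'I_m) (w : F -> K).

(* (p, (h, h')) stands for the entry of S^p at the values of h and h'. *)
Definition bracket := (nat * (H * H))%type.
Implicit Types (b : bracket) (B : seq bracket).

Definition br a b : E := (S ^+ b.1) (a b.2.1) (a b.2.2).
Definition brs a B : E := \prod_(b <- B) br a b.
Definition pairs (L : seq (H * H)) : seq H := flatten [seq [:: q.1; q.2] | q <- L].
Definition slots B : seq H := pairs [seq b.2 | b <- B].
Definition J w B : E := \sum_a w a *: brs a B.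

Definition upd a h k : F := [ffun h' => if h' == h then k else a h'].

(** Membership alone is recorded, not the coefficients: a degree count later singles out the one
    product that can reach the top. *)
Inductive trace_span (P : E) : E -> Prop :=
| TSbase : trace_span P P
| TSadd (u v : E) : trace_span P u -> trace_span P v -> trace_span P (u + v)
| TSscale c (u : E) : trace_span P u -> trace_span P (c *: u)
| TStrace p (u : E) : trace_span P u -> trace_span P (\tr (S ^+ p) * u).

Lemma trace_span0 P : trace_span P 0.
Proof. by rewrite -(scale0r P); apply/TSscale/TSbase. Qed.

Lemma trace_span_sum P (T : Type) (r : seq T) (Q : pred T) (G : T -> E) :
  (forall t, Q t -> trace_span P (G t)) -> trace_span P (\sum_(t <- r | Q t) G t).
Proof. by move=> h; apply: (big_ind (trace_span P)) => //; [exact: trace_span0|exact: TSadd]. Qed.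

Lemma slots_cons b B : slots (b :: B) = [:: b.2.1, b.2.2 & slots B].
Proof. by []. Qed.

Lemma brE a b : br a b = (S ^+ b.1) (a b.2.1) (a b.2.2).
Proof. by []. Qed.

Lemma brs_nil a : brs a [::] = 1.
Proof. exact: big_nil. Qed.

Lemma br_homog a b : homog b.1 (br a b).
Proof. exact: (homog_pow (@homog_symgen K m)). Qed.

Lemma br_flip a p u v : br a (p, (u, v)) = (-1) ^+ 'C(p, 2) *: br a (p, (v, u)).
Proof. exact: (pow_sym (@homog_symgen K m) (symgen_tr K m)). Qed.

Lemma brs_cons a b B : brs a (b :: B) = br a b * brs a B.
Proof. exact: big_cons. Qed.

Lemma updE a h k h' : upd a h k h' = if h' == h then k else a h'.
Proof. exact: ffunE. Qed.

Lemma brs_upd a h k B : h \notin slots B -> brs (upd a h k) B = brs a B.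
Proof.
elim: B => [|b B IH]; first by rewrite /brs !big_nil.
rewrite slots_cons !inE !negb_or => /and3P[h1 h2 hB].
by rewrite !brs_cons IH // /br !updE ![_ == h]eq_sym (negPf h1) (negPf h2).
Qed.

(** Exchanging the value at h with the extra index is an involution on pairs. *)
Lemma sum_swap_upd (V : nmodType) h (G : F -> 'I_m -> V) :
  \sum_a \sum_k G a k = \sum_a \sum_k G (upd a h k) (a h).
Proof.
rewrite !pair_bigA /= (reindex (fun p : F * 'I_m => (upd p.1 h p.2, p.1 h))) //=.
have inv : cancel (fun p : F * 'I_m => (upd p.1 h p.2, p.1 h))
                  (fun p : F * 'I_m => (upd p.1 h p.2, p.1 h)).
  move=> [a k] /=; rewrite updE eqxx; congr pair.
  by apply/ffunP => h'; rewrite !updE; case: eqP => // ->.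
by exists (fun p : F * 'I_m => (upd p.1 h p.2, p.1 h)) => p _.
Qed.

(** Turns the value at one slot into a separate summation index, at the price of a factor 1/m for
    the old value, which becomes redundant. *)
Lemma sum_avg h (G : F -> E) : (0 < m)%N ->
  \sum_a G a = m%:R^-1 *: \sum_a \sum_k G (upd a h k).
Proof.
move=> m0; rewrite -(sum_swap_upd h (fun a _ => G a)).
under [in RHS]eq_bigr do rewrite sumr_const card_ord -scaler_nat.
by rewrite -scaler_sumr scalerA mulVf ?scale1r // pnatr_eq0 -lt0n.
Qed.

(** Graded commutativity brings the bracket that contains h to the front, and a flip makes h its
    second end. The sign depends on the powers only, not on the assignment. *)
Lemma brs_front h B : h \in slots B -> exists p u B1 (s : nat),
  perm_eq (slots B) [:: u, h & slots B1] /\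
  forall a, brs a B = (-1) ^+ s *: (br a (p, (u, h)) * brs a B1).
Proof.
elim: B => // -[p [u v]] B IH; rewrite slots_cons !inE /= orbA.
have [->|hv] := eqVneq h v.
  by exists p, u, B, 0%N; split=> // a; rewrite scale1r brs_cons.
have [->|hu] := eqVneq h u.
  exists p, v, B, 'C(p, 2); split=> [|a]; last by rewrite brs_cons br_flip -scalerAl.
  by rewrite -(cat1s u) -(cat1s v) -[v :: u :: _]/([:: v] ++ [:: u] ++ _) perm_catCA.
move=> /= /IH[q [u' [B1 [s [pB eB]]]]].
exists q, u', ((p, (u, v)) :: B1), (s + p * q)%N; split=> [|a].
  rewrite slots_cons /=.
  have -> : [:: u, v & slots B] = [:: u; v] ++ slots B by [].
  have -> : [:: u', h, u, v & slots B1] = [:: u'; h] ++ [:: u; v] ++ slots B1 by [].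
  by rewrite perm_sym perm_catCA perm_cat2l perm_sym.
rewrite !brs_cons eB -scalerAr [br a (p, _) * (_ * _)]mulrA.
rewrite (homogC (@br_homog a (p, (u, v))) (@br_homog a (q, (u', h)))) /=.
by rewrite -scalerAl scalerA exprD -mulrA.
Qed.

Variable m0 : (0 < m)%N.

(* Identifying the values at h and h' either closes a bracket into a trace or
   merges two brackets S^p, S^q into S^(p+q). *)
Lemma J_contract w w' B h h' :
  (forall a, w a = w' a * (a h == a h')%:R) ->
  (forall a k, w' (upd a h k) = w' a) -> (forall a k, w' (upd a h' k) = w' a) ->
  h != h' -> uniq (slots B) -> h \in slots B -> h' \in slots B ->
  exists B', perm_eq (slots B) [:: h, h' & slots B'] /\
    forall P, trace_span P (J w' B') -> trace_span P (J w B).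
Proof.
move=> ew wh wh' hh' uB hB h'B.
have [p [u [B1 [s [pB eB]]]]] := brs_front hB.
have uB1 : uniq [:: u, h & slots B1] by rewrite -(perm_uniq pB).
have avg (G : F -> E) : \sum_a G a = m%:R^-1 *: (m%:R^-1 *:
    \sum_a \sum_k \sum_l G (upd (upd a h k) h' l)).
  by rewrite (sum_avg h' G m0) (sum_avg h (fun a => \sum_l G (upd a h' l)) m0).
have E1 a k l : upd (upd a h k) h' l h = k by rewrite !updE (negPf hh') eqxx.
have E2 a k l : upd (upd a h k) h' l h' = l by rewrite updE eqxx.
have E3 a k l x : x != h -> x != h' -> upd (upd a h k) h' l x = a x.
  by move=> xh xh'; rewrite !updE (negPf xh) (negPf xh').
have [uh'|uh'] := eqVneq u h'.
  subst u; exists B1; split=> [|P hP].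
    apply: perm_trans pB _; rewrite -(cat1s h) -(cat1s h') perm_catCA.
    by [].
  have -> : J w B = (m%:R^-1 * m%:R^-1) *: ((-1) ^+ s *: (\tr (S ^+ p) * J w' B1)).
    rewrite /J avg scalerA; congr (_ *: _).
    rewrite mulr_sumr scaler_sumr; apply: eq_bigr => a _.
    transitivity (\sum_k \sum_l (w' a * (k == l)%:R) *:
                     ((-1) ^+ s *: ((S ^+ p) l k * brs a B1))).
      apply: eq_bigr => k _; apply: eq_bigr => l _.
      rewrite ew wh' wh E1 E2 eB /br E1 E2 /=.
      by move: uB1 => /= /and3P[]; rewrite inE negb_or => /andP[_ n1] n2 _; rewrite !brs_upd.
    under eq_bigr => k _.
      rewrite (bigD1 k) //= eqxx mulr1 big1 ?addr0; last first.
        by move=> l lk; rewrite eq_sym (negPf lk) mulr0 scale0r.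
      over.
    rewrite -!scaler_sumr -mulr_suml -scalerAr scalerA mulrC -scalerA.
    by [].
  by do 2!apply: TSscale; apply: TStrace.
have h'B1 : h' \in slots B1.
  by move: h'B; rewrite (perm_mem pB) !inE eq_sym (negPf uh') eq_sym (negPf hh').
have [q [v [B2 [t [pB1 eB1]]]]] := brs_front h'B1.
have pBB : perm_eq (slots B) [:: u, h, v, h' & slots B2].
  by apply: perm_trans pB _; rewrite !perm_cons.
exists ((p + q, (u, v))%N :: B2); split=> [|P hP].
  apply: perm_trans pBB _; rewrite slots_cons /=.
  have -> : [:: u, h, v, h' & slots B2] = [:: u; h; v; h'] ++ slots B2 by [].
  have -> : [:: h, h', u, v & slots B2] = [:: h; h'; u; v] ++ slots B2 by [].
  rewrite perm_cat2r; apply/seq.permP => x /=.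
  move: (nat_of_bool (x u)) (nat_of_bool (x h)) (nat_of_bool (x v)) (nat_of_bool (x h')).
  by clear => A1 A2 A3 A4; lia.
have {}uB : uniq [:: u, h, v, h' & slots B2] by rewrite -(perm_uniq pBB).
move: uB; rewrite /= !inE !negb_or => /and5P[/and4P[n1 n2 n3 n4] /and3P[n5 n6 n7]].
move=> /andP[n8 n9] n10 _; have vh : v != h by rewrite eq_sym.
(* The sign ['C(q, 2)] comes from flipping the second bracket, so that the identified values are
   adjacent and their sum is a matrix product. *)
have -> : J w B = (m%:R^-1 * m%:R^-1) *: ((-1) ^+ (s + t + 'C(q, 2)) *: J w' ((p + q, (u, v))%N :: B2)).
  rewrite /J avg scalerA; congr (_ *: _).
  rewrite scaler_sumr; apply: eq_bigr => a _.
  transitivity (\sum_k \sum_l (w' a * (k == l)%:R) *: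
       ((-1) ^+ (s + t + 'C(q, 2)) *: ((S ^+ p) (a u) k * (S ^+ q) l (a v) * brs a B2))).
    apply: eq_bigr => k _; apply: eq_bigr => l _.
    rewrite ew wh' wh E1 E2 eB eB1 (br_flip _ q) /br E1 E2 /= !E3 // !brs_upd //.
    congr (_ *: _); rewrite -scalerAl -!scalerAr !scalerA -!exprD addnA.
    by rewrite mulrA.
  under eq_bigr => k _.
    rewrite (bigD1 k) //= eqxx mulr1 big1 ?addr0; last first.
      by move=> l lk; rewrite eq_sym (negPf lk) mulr0 scale0r.
    over.
  rewrite -!scaler_sumr -mulr_suml scalerA mulrC -scalerA; congr (_ *: (_ *: _)).
  rewrite brs_cons /br /= exprD -[S ^+ p * S ^+ q]/(S ^+ p *m S ^+ q) mxE.
  by [].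
by do 2!apply: TSscale.
Qed.

(** Each link is one Kronecker delta, removed by one contraction. As [w0] ignores the linked slots,
    brackets on Z with weight [w0] remain at the end. *)
Lemma J_links (w0 : F -> K) (Z : seq H) P (L : seq (H * H)) B :
  (forall B0, perm_eq (slots B0) Z -> uniq (slots B0) -> trace_span P (J w0 B0)) ->
  (forall a h k, h \in pairs L -> w0 (upd a h k) = w0 a) ->
  uniq (slots B) -> perm_eq (slots B) (Z ++ pairs L) ->
  trace_span P (J (fun a => w0 a * \prod_(q <- L) (a q.1 == a q.2)%:R) B).
Proof.
move=> hZ; elim: L B => [|[h h'] L IH] B hw uB pB.
  have -> : J (fun a => w0 a * \prod_(q <- [::]) (a q.1 == a q.2)%:R) B = J w0 B.
    by apply: eq_bigr => a _; rewrite big_nil mulr1.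
  by apply: hZ => //; rewrite cats0 in pB.
have uZ : uniq (Z ++ [:: h, h' & pairs L]) by rewrite -(perm_uniq pB).
have : uniq ([:: h, h' & pairs L] ++ Z) by rewrite uniq_catC.
rewrite /= !inE !mem_cat !negb_or => /and3P[/and3P[nh nhL nhZ] /andP[nL nZ] _].
have nw' x : x \notin pairs L -> forall a k,
    \prod_(q <- L) (upd a x k q.1 == upd a x k q.2)%:R = \prod_(q <- L) (a q.1 == a q.2)%:R :> K.
  elim: (L) => [|q L' IHL] /=; first by move=> _ a k; rewrite !big_nil.
  rewrite !inE !negb_or => /and3P[x1 x2 x3] a k; rewrite !big_cons IHL // !updE.
  by rewrite ![_ == x]eq_sym (negPf x1) (negPf x2).
have [|a k|a k|||||B' [pB' hB']] := @J_contract
    (fun a => w0 a * \prod_(q <- (h, h') :: L) (a q.1 == a q.2)%:R)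
    (fun a => w0 a * \prod_(q <- L) (a q.1 == a q.2)%:R) B h h'.
- by move=> a; rewrite big_cons /= -mulrA [X in _ * X = _]mulrC.
- by rewrite nw' // hw // !inE eqxx.
- by rewrite nw' // hw // !inE eqxx orbT.
- exact: nh.
- exact: uB.
- by rewrite (perm_mem pB) mem_cat !inE eqxx orbT.
- by rewrite (perm_mem pB) mem_cat !inE eqxx !orbT.
apply: hB'.
have pp : perm_eq [:: h, h' & slots B'] [:: h, h' & Z ++ pairs L].
  rewrite perm_sym; apply: perm_trans pB'; rewrite perm_sym; apply: perm_trans pB _.
  by rewrite -[pairs _]/([:: h; h'] ++ pairs L) perm_catCA.
apply: IH.
- by move=> a x k xL; apply: hw; rewrite !inE xL !orbT.
- by have : uniq [:: h, h' & slots B'] by [rewrite -(perm_uniq pB')]; case/and3P.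
- by rewrite !perm_cons in pp.
Qed.

End Brackets.

Section Reduction.
Variables (K : realFieldType) (m : nat) (H : finType).
Local Notation I := (sym_index m).
Local Notation E := (exterior K I).
Local Notation S := (symgen K m).
Local Notation F := {ffun H -> 'I_m}.
Local Notation bracket := (bracket H).
Local Notation br := (@br K m H).
Local Notation brs := (@brs K m H).
Implicit Types (a : F) (h u v : H) (k l : 'I_m) (b : bracket) (B : seq bracket).

Lemma slots_cat B B' : slots (B ++ B') = slots B ++ slots B'.
Proof. by rewrite /slots /pairs !map_cat flatten_cat. Qed.

Lemma brs_cat a B B' : brs a (B ++ B') = brs a B * brs a B' :> E.
Proof. exact: big_cat. Qed.

(* [insertions] lists the ways to multiply one of the powers in B by S^j, with
   the sign for moving S^j past the preceding brackets; the two ends of the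
   bracket S^p contribute equally up to the sign (-1)^(j p). *)
Definition bump j b : bracket := ((b.1 + j)%N, b.2).

Fixpoint insertions j B : seq (K * seq bracket) :=
  if B is b :: B' then
    (1 + (-1) ^+ (j * b.1), bump j b :: B') ::
    [seq ((-1) ^+ (j * b.1) * x.1, b :: x.2) | x <- insertions j B']
  else [::].

Definition degs B : nat := \sum_(b <- B) b.1.

Lemma insertions_cat j B B' : insertions j (B ++ B') =
  [seq (x.1, x.2 ++ B') | x <- insertions j B] ++
  [seq ((-1) ^+ (j * degs B) * x.1, B ++ x.2) | x <- insertions j B'].
Proof.
elim: B => [|b B IH] /=.
  rewrite /degs big_nil muln0 expr0 -[LHS]map_id; apply: eq_map => -[c x] /=.
  by rewrite mul1r.
rewrite IH map_cat -!map_comp; congr (_ :: _ ++ _).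
apply: eq_map => x /=; rewrite /degs big_cons mulnDr exprD mulrA.
by [].
Qed.

Lemma degs_even B : all (fun b => b.1 == 2%N) B -> odd (degs B) = false.
Proof.
elim: B => [|b B IH] /=; first by rewrite /degs big_nil.
by move=> /andP[/eqP eb /IH]; rewrite /degs big_cons eb oddD.
Qed.

Lemma size_insertions j B : size (insertions j B) = size B.
Proof. by elim: B => //= b B IH; rewrite size_map IH. Qed.

Lemma mem_insertions j B x : x \in insertions j B -> exists B0 b B1,
  [/\ B = B0 ++ b :: B1, x.2 = B0 ++ bump j b :: B1 &
      x.1 = (-1) ^+ (j * degs B0) * (1 + (-1) ^+ (j * b.1))].
Proof.
elim: B x => //= b B IH x; rewrite inE => /orP[/eqP->|/mapP[y /IH]].
  by exists [::], b, B; rewrite /degs big_nil muln0 mul1r.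
move=> [B0 [b' [B1 [-> -> ->]]]] ->; exists (b :: B0), b', B1; split=> //=.
by rewrite /degs big_cons mulnDr exprD mulrA.
Qed.

Lemma brs_insertions j a B : ~~ odd 'C(j, 2) -> uniq (slots B) ->
  \sum_(h <- slots B) \sum_l (S ^+ j) (a h) l * brs (upd a h l) B =
  \sum_(x <- insertions j B) x.1 *: brs a x.2.
Proof.
move=> oj; elim: B => [|[p [u v]] B IH]; first by rewrite !big_nil.
rewrite slots_cons => uB; rewrite /= !big_cons.
move: uB; rewrite /= inE negb_or => /and3P[/andP[uv uB] vB uniqB].
have vu : v == u = false by rewrite eq_sym (negPf uv).
have -> : \sum_l (S ^+ j) (a u) l * brs (upd a u l) ((p, (u, v)) :: B)
        = brs a (bump j (p, (u, v)) :: B).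
  rewrite brs_cons brE /= addnC exprD -[S ^+ j * S ^+ p]/(S ^+ j *m S ^+ p) mxE mulr_suml.
  apply: eq_bigr => l _.
  by rewrite brs_cons brE /= !updE eqxx vu brs_upd // mulrA.
have -> : \sum_l (S ^+ j) (a v) l * brs (upd a v l) ((p, (u, v)) :: B)
        = (-1) ^+ (j * p) *: brs a (bump j (p, (u, v)) :: B).
  rewrite brs_cons brE /= exprD -[S ^+ p * S ^+ j]/(S ^+ p *m S ^+ j) mxE mulr_suml.
  rewrite scaler_sumr; apply: eq_bigr => l _.
  rewrite brs_cons brE /= !updE eqxx (negPf uv) brs_upd //.
  have -> : (S ^+ j) (a v) l = (S ^+ j) l (a v).
    rewrite (pow_sym (@homog_symgen K m) (symgen_tr K m)).
    by rewrite -signr_odd (negPf oj) expr0 scale1r.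
  rewrite mulrA (homogC (homog_pow (@homog_symgen K m) _ _) (homog_pow (@homog_symgen K m) _ _)).
  by rewrite -scalerAl.
have -> : \sum_(h <- slots B) \sum_l (S ^+ j) (a h) l * brs (upd a h l) ((p, (u, v)) :: B)
  = (-1) ^+ (j * p) *: (br a (p, (u, v)) * \sum_(x <- insertions j B) x.1 *: brs a x.2).
  rewrite -IH // mulr_sumr scaler_sumr big_seq [RHS]big_seq; apply: eq_bigr => h hB.
  rewrite mulr_sumr scaler_sumr; apply: eq_bigr => l _.
  have uh : u != h by apply: contraNneq uB => ->.
  have vh : v != h by apply: contraNneq vB => ->.
  rewrite brs_cons brE /= !updE (negPf uh) (negPf vh).
  rewrite mulrA (homogC (homog_pow (@homog_symgen K m) _ _) (@br_homog _ _ _ a (p, (u, v)))).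
  by rewrite -scalerAl mulrA.
rewrite addrA -[X in X + _ *: _ + _]scale1r -scalerDl /=; congr (_ + _).
rewrite big_map mulr_sumr scaler_sumr; apply: eq_bigr => x _ /=.
by rewrite brs_cons -scalerAr scalerA.
Qed.

Variables (w : F -> K) (Z : seq H).
Hypothesis uZ : uniq Z.
Hypothesis w_insert : forall a k l,
  \sum_(h <- Z | a h == l) w (upd a h k) = (k == l)%:R * w a.
Hypothesis w_swap : forall a h h', h \in Z -> h' \in Z -> h != h' ->
  w (precomp a (tperm h h')) = - w a.

(** [w_insert] says that gl(m) acts on the weight through the trace. Applied to S^j, it expresses
    tr(S^j) times the weight by replacing one value at a time; exchanging old and new values carries
    the action over to the brackets. *)
Lemma trace_J j B : ~~ odd 'C(j, 2) -> perm_eq (slots B) Z ->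
  \tr (S ^+ j) * J w B = \sum_(x <- insertions j B) x.1 *: J w x.2.
Proof.
move=> oj pB; have uB : uniq (slots B) by rewrite (perm_uniq pB).
transitivity (\sum_a w a *: \sum_(x <- insertions j B) x.1 *: brs a x.2 : E); last first.
  rewrite /J; under [RHS]eq_bigr do rewrite scaler_sumr.
  rewrite [RHS]exchange_big; apply: eq_bigr => a _; rewrite scaler_sumr.
  by apply: eq_bigr => x _; rewrite !scalerA mulrC.
transitivity (\sum_(h <- Z) \sum_a \sum_k w a *: ((S ^+ j) (a h) k * brs (upd a h k) B)); last first.
  rewrite exchange_big /=; apply: eq_bigr => a _.
  rewrite -brs_insertions // (perm_big _ pB) scaler_sumr; apply: eq_bigr => h _.
  by rewrite scaler_sumr.
transitivity (\sum_(h <- Z) \sum_a \sum_k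
   w (upd a h k) *: ((S ^+ j) k (a h) * brs a B)); last first.
  apply: eq_bigr => h _; rewrite (sum_swap_upd h).
  apply: eq_bigr => a _; apply: eq_bigr => k _.
  have -> : upd (upd a h k) h (a h) = a.
    by apply/ffunP => x; rewrite !updE; case: eqP => // ->.
  by rewrite updE eqxx.
rewrite exchange_big /J mulr_sumr /=; apply: eq_bigr => a _.
rewrite exchange_big -scalerAr /mxtrace mulr_suml scaler_sumr /=.
apply: eq_bigr => k _.
transitivity (\sum_l \sum_(h <- Z | a h == l) w (upd a h k) *: ((S ^+ j) k l * brs a B)).
  under eq_bigr => l _ do rewrite -scaler_suml w_insert.
  rewrite (bigD1 k) //= eqxx mul1r [X in _ + X]big1 ?addr0 // => l lk.
  by rewrite eq_sym (negPf lk) mul0r scale0r.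
rewrite (exchange_big_dep predT) //=; apply: eq_bigr => h _.
by rewrite (big_pred1 (a h)) // => l /=; rewrite eq_sym.
Qed.

Lemma brs_precomp (phi : {perm H}) a B : (forall x, x \in slots B -> phi x = x) ->
  brs (precomp a phi) B = brs a B.
Proof.
move=> h; elim: B h => [|b B IH] h; first by rewrite !brs_nil.
rewrite !brs_cons IH => [|x xB]; last by apply: h; rewrite slots_cons !inE xB !orbT.
by rewrite !brE !ffunE !h // slots_cons !inE eqxx ?orbT.
Qed.

Lemma J_precomp (phi : {perm H}) (c : K) B B' :
  (forall a, w (precomp a phi) = c * w a) ->
  (forall a, brs (precomp a phi) B = brs a B') ->
  J w B = c *: J w B'.
Proof.
move=> hw hb; rewrite /J (reindex_onto (fun a => precomp a phi) (fun a => precomp a phi^-1)) /=.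
  rewrite scaler_sumr; apply: eq_big => [a|a _].
    by apply/eqP/ffunP => x; rewrite !ffunE permKV.
  by rewrite hw hb scalerA.
by move=> a _; apply/ffunP => x; rewrite !ffunE permK.
Qed.

(** Exchanging the two ends negates the weight and preserves a symmetric power, so the sum equals
    its own negative. *)
Lemma J_symmetric0 B0 p h h' B1 : ~~ odd 'C(p, 2) ->
  uniq (slots (B0 ++ (p, (h, h')) :: B1)) -> h \in Z -> h' \in Z ->
  J w (B0 ++ (p, (h, h')) :: B1) = 0.
Proof.
move=> op; rewrite slots_cat slots_cons -[_ :: _]/([:: h; h'] ++ slots B1) uniq_catCA /=.
  rewrite !inE !mem_cat !negb_or.
move=> /and3P[/and3P[hh' h0 h1] /andP[h0' h1'] _] hZ hZ'.
apply: eq_oppr0; rewrite -scaleN1r; apply: (J_precomp (phi := tperm h h')) => a.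
  by rewrite w_swap // mulN1r.
rewrite !brs_cat !brs_cons !brs_precomp.
- congr (_ * (_ * _)); rewrite !brE /= !ffunE tpermL tpermR.
  rewrite (pow_sym (@homog_symgen K m) (symgen_tr K m)).
  by rewrite -signr_odd (negPf op) expr0 scale1r.
- by move=> x xB; rewrite tpermD //; apply: contraTneq xB => <-.
- by move=> x xB; rewrite tpermD //; apply: contraTneq xB => <-.
Qed.

(** Exchanging the slots of two brackets is a product of two transpositions and leaves the weight
    unchanged. Only the sign for commuting the two powers remains. *)
Lemma J_swap B0 p q h h' u u' B1 :
  let B' r s := B0 ++ (r, (h, h')) :: (s, (u, u')) :: B1 in
  uniq (slots (B' p q)) -> {subset [:: h; h'; u; u'] <= Z} ->
  J w (B' p q) = (-1) ^+ (p * q) *: J w (B' q p).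
Proof.
move=> B'; rewrite /B' slots_cat !slots_cons /= => uB sZ.
have : uniq ([:: h; h'; u; u'] ++ slots B0 ++ slots B1).
  by rewrite uniq_catCA /=.
rewrite /= !inE !negb_or !mem_cat !negb_or => 
  /and5P[/and5P[n1 n2 n3 n4 n5] /and4P[n6 n7 n8 n9] /and3P[n10 n11 n12] /andP[n13 n14] _].
pose phi := (tperm h u * tperm h' u')%g.
have zh : h \in Z by apply: sZ; rewrite !inE eqxx.
have zh' : h' \in Z by apply: sZ; rewrite !inE eqxx ?orbT.
have zu : u \in Z by apply: sZ; rewrite !inE eqxx ?orbT.
have zu' : u' \in Z by apply: sZ; rewrite !inE eqxx ?orbT.
transitivity (J w (B0 ++ (p, (u, u')) :: (q, (h, h')) :: B1)).
  rewrite -[RHS]scale1r; apply: (J_precomp (phi := phi)) => a.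
    have -> : precomp a phi = precomp (precomp a (tperm h' u')) (tperm h u).
      by apply/ffunP => x; rewrite !ffunE permM.
    by rewrite !w_swap // opprK mul1r.
  have ph : phi h = u by rewrite /phi permM tpermL tpermD // eq_sym.
  have pu : phi u = h by rewrite /phi permM tpermR tpermD // eq_sym.
  have ph' : phi h' = u' by rewrite /phi permM (@tpermD _ h u h') ?tpermL // eq_sym.
  have pu' : phi u' = h' by rewrite /phi permM (@tpermD _ h u u') ?tpermR.
  rewrite !brs_cat !brs_cons !brs_precomp.
  - by congr (_ * (_ * (_ * _))); rewrite !brE /= !ffunE ?ph ?ph' ?pu ?pu'.
  - move=> x xB; rewrite /phi permM !tpermD //; apply: contraTneq xB => <-; by [].
  - move=> x xB; rewrite /phi permM !tpermD //; apply: contraTneq xB => <-; by [].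
rewrite /J scaler_sumr; apply: eq_bigr => a _.
rewrite !brs_cat !brs_cons.
rewrite [br a _ * (br a _ * _)]mulrA (homogC (@br_homog _ _ _ a (p, _)) (@br_homog _ _ _ a (q, _))) /=.
rewrite -scalerAl -scalerAr !scalerA mulrC; congr (_ *: (_ * _)).
by rewrite mulrA.
Qed.

Variable P : E.
Hypothesis base : forall B, perm_eq (slots B) Z -> all (fun b => b.1 == 2%N) B ->
  trace_span P (J w B).

(** The surplus S^j travels by exchanges with brackets of power 2. These commute with everything, so
    no sign appears. *)
Lemma J_move2 j B0 u u' T h h' R :
  all (fun b => b.1 == 2%N) T ->
  perm_eq (slots (B0 ++ ((2 + j)%N, (u, u')) :: T ++ (2%N, (h, h')) :: R)) Z ->
  J w (B0 ++ ((2 + j)%N, (u, u')) :: T ++ (2%N, (h, h')) :: R) =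
  J w (B0 ++ (2%N, (u, u')) :: T ++ ((2 + j)%N, (h, h')) :: R).
Proof.
elim: T B0 u u' => [|[t [v v']] T IH] B0 u u' /=.
  move=> _ pB; rewrite J_swap; last 2 first.
  - by rewrite (perm_uniq pB).
  - by move=> x xs; rewrite -(perm_mem pB) slots_cat mem_cat !slots_cons; move: xs; rewrite !inE => /or4P[] ->; rewrite ?orbT.
  by rewrite -signr_odd oddM andbF expr0 scale1r.
move=> /andP[/eqP /= -> aT] pB; rewrite J_swap; last 2 first.
- by rewrite (perm_uniq pB).
- by move=> x xs; rewrite -(perm_mem pB) slots_cat mem_cat !slots_cons; move: xs; rewrite !inE => /or4P[] ->; rewrite ?orbT.
rewrite -signr_odd oddM andbF expr0 scale1r.
rewrite -cat_rcons IH //; first by rewrite cat_rcons.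
apply: perm_trans pB.
by rewrite cat_rcons !slots_cat !slots_cons.
Qed.

(* Brackets are brought one at a time to power 2.  A power p for which S^p is
   symmetric contributes zero, since w is alternating; for the others S^(p-2) is
   symmetric, and expanding tr(S^(p-2)) times the expression with power 2 instead
   of p gives a positive multiple of the wanted one, plus terms in which this
   bracket has power 2. *)
Lemma J_reduce B : perm_eq (slots B) Z -> trace_span P (J w B).
Proof.
(* T holds the brackets already brought to power 2, and the induction is on the number of brackets
   in R. *)
suff main n T R : (size R <= n)%N -> all (fun b => b.1 == 2%N) T ->
    perm_eq (slots (T ++ R)) Z -> trace_span P (J w (T ++ R)).
  by move=> pB; apply: (main (size B) [::] B).
elim: n T R => [|n IH] T [|[p [h h']] R] //=; rewrite ?cats0.
- by move=> _ aT pB; apply: base.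
- by move=> _ aT pB; apply: base.
rewrite ltnS => sR aT pB.
have [p2|p2] := eqVneq p 2%N.
  rewrite -cat_rcons; apply: IH => //; first by rewrite all_rcons /= p2 aT.
  by rewrite cat_rcons.
have hZ : h \in Z by rewrite -(perm_mem pB) slots_cat mem_cat slots_cons !inE eqxx ?orbT.
have hZ' : h' \in Z by rewrite -(perm_mem pB) slots_cat mem_cat slots_cons !inE eqxx ?orbT.
have [op|ep] := boolP (odd 'C(p, 2)); last first.
  rewrite J_symmetric0 //; first exact: trace_span0.
  by rewrite (perm_uniq pB).
(* ['C(2 + j, 2)] is ['C(j, 2)] plus the odd number 2j+1, so lowering the power by 2 exchanges skew
   and symmetric. *)
have [j ej oj] : exists2 j, p = (2 + j)%N & ~~ odd 'C(j, 2).
  have p_ge : (2 <= p)%N by case: p op {p2 pB} => [|[|]].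
  exists (p - 2)%N; first by rewrite subnKC.
  move: op; rewrite -{1}(subnKC p_ge) addSn addSn add0n !binS !bin1 bin0 !oddD /=.
  by case: (odd 'C(p - 2, 2)); case: (odd (p - 2)).
subst p.
have pB2 : perm_eq (slots (T ++ (2%N, (h, h')) :: R)) Z.
  by apply: perm_trans pB; rewrite !slots_cat !slots_cons.
have := trace_J oj pB2.
move=> trX; pose X := J w (T ++ ((2 + j)%N, (h, h')) :: R).
have two i : (1 + (-1) ^+ (i * 2) : K) = 2.
  by rewrite -signr_odd oddM andbF expr0.
(* The trace inserts S^j into each bracket of T and into the current one, every time with
   coefficient 2. By [J_move2] all these terms equal X. *)
have eX : X = (2 * (size T).+1%:R)^-1 *:
    (\tr (S ^+ j) * J w (T ++ (2%N, (h, h')) :: R)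
    - \sum_(x <- insertions j R)
        ((-1) ^+ (j * degs T) * ((-1) ^+ (j * 2) * x.1)) *:
          J w (T ++ (2%N, (h, h')) :: x.2)).
  rewrite trX insertions_cat big_cat !big_map /= big_cons big_map /=.
  rewrite (eq_big_seq (fun=> 2 *: X)) /=; last first.
    move=> x /mem_insertions[B0 [b [B1 [eT -> ->]]]].
    have : all (fun b => b.1 == 2%N) (B0 ++ b :: B1) by rewrite -eT.
    rewrite all_cat /= => /and3P[aB0 /eqP b2 aB1].
    rewrite b2 two -signr_odd oddM degs_even // andbF expr0 mul1r; congr (_ *: _).
    move: eT b2; case: b => t [v v'] /= eT t2; subst t.
    rewrite /X eT -!catA /= /bump /=. apply: J_move2 => //.
    apply: perm_trans pB; rewrite eT -catA /= !slots_cat !slots_cons !slots_cat !slots_cons.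
    by [].
  rewrite two -signr_odd oddM degs_even // andbF expr0 !mul1r.
  rewrite big_const_seq count_predT size_insertions iter_addr_0 -scaler_nat scalerA.
  set Y := \sum_(x <- _) _.
  have -> : (size T)%:R * 2 *: X + (2 *: X + Y) - Y = (2 * (size T).+1%:R) *: X.
    by rewrite addrA addrK -scalerDl -natr1; congr (_ *: _); ring.
  by rewrite scalerA mulVf ?scale1r // mulf_neq0 // pnatr_eq0.
rewrite -/X eX; apply: TSscale; apply: TSadd.
  apply: TStrace; rewrite -cat_rcons; apply: IH => //; first by rewrite all_rcons /= aT.
  by rewrite cat_rcons.
rewrite -scaleN1r; apply: TSscale; rewrite big_seq; apply: trace_span_sum => x xR.
apply: TSscale; rewrite -cat_rcons.
have [B0 [b [B1 [eR eR' _]]]] := mem_insertions xR.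
apply: IH.
- by rewrite eR'; move: sR; rewrite eR !size_cat.
- by rewrite all_rcons /= aT.
rewrite cat_rcons eR'; apply: perm_trans pB2.
by rewrite eR !slots_cat !slots_cons !slots_cat !slots_cons.
Qed.
End Reduction.

Section CellDeterminants.
Variables (K : realFieldType) (m : nat).
Implicit Types (c : 'I_m -> 'I_m) (i j k l : 'I_m).
Local Notation cell_det := (@cell_det K m).

(** An entry of adj(M) M = det(M): replacing row i of M by the k-th unit vector turns the
    determinant into the cofactor at (i, k). *)
Lemma cell_det_insert c k l :
  \sum_(i | c i == l) cell_det (fun x => if x == i then k else c x) =
  (k == l)%:R * cell_det c.
Proof.
pose M : 'M[K]_m := \matrix_(i, j) (c i == j)%:R.
have := mul_adj_mx M => /matrixP/(_ k l); rewrite !mxE -[_ *+ _]mulr_natl -[\det M]/(cell_det c) => <-.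
rewrite big_mkcond /=; apply: eq_bigr => i _; rewrite !mxE.
case: ifP => _; last by rewrite mulr0.
rewrite mulr1 /cell_det; set M' := \matrix_(_, _) _.
have -> : cofactor M i k = cofactor M' i k.
  rewrite /cofactor; congr (_ * \det _); apply/matrixP => x y; rewrite !mxE.
  by rewrite (eq_sym (lift _ _)) (negPf (neq_lift _ _)).
rewrite (expand_det_row _ i) (bigD1 k) //= !mxE !eqxx mul1r big1 ?addr0 // => j jk.
by rewrite !mxE eqxx eq_sym (negPf jk) mul0r.
Qed.

Lemma cell_det_precomp c (s : 'S_m) : cell_det (fun i => c (s i)) = (-1) ^+ s * cell_det c.
Proof.
rewrite -(det_perm K) -det_mulmx -row_permE; congr (\det _).
by apply/matrixP => i j; rewrite !mxE.
Qed.

(** The epsilon-delta identity, read off from the determinant of a product. *)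
Lemma cell_det_mul c c' : cell_det c * cell_det c' =
  \sum_(s : 'S_m) (-1) ^+ s * \prod_i (c i == c' (s i))%:R.
Proof.
rewrite /cell_det -[X in _ * X]det_tr -det_mulmx; apply: eq_bigr => s _.
congr (_ * _); apply: eq_bigr => i _; rewrite !mxE (bigD1 (c i)) //= !mxE eqxx mul1r.
rewrite big1 ?addr0 ?(eq_sym (c i)) // => j ji; rewrite !mxE eq_sym (negPf ji) mul0r.
by [].
Qed.
End CellDeterminants.

Section Doubling.
Variable n : nat.
Local Notation o0 i := (Ordinal (lt_double_ord i)).
Local Notation o1 i := (Ordinal (lt_doubleS_ord i)).

Lemma double_ord_cases (c : 'I_(2 * n)) :
  exists i : 'I_n, c = o0 i \/ c = o1 i.
Proof.
have lt : (c./2 < n)%N by have := ltn_ord c; lia.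
exists (Ordinal lt); case: (boolP (odd c)) => oc; [right|left]; apply: val_inj => /=; lia.
Qed.

Lemma big_double (R : Type) (idx : R) (op : Monoid.com_law idx) (F : 'I_(2 * n) -> R) :
  \big[op/idx]_c F c = \big[op/idx]_(i < n) op (F (o0 i)) (F (o1 i)).
Proof.
have half_lt (c : 'I_(2 * n)) : (c./2 < n)%N by have := ltn_ord c; lia.
rewrite (reindex (fun p : 'I_n * bool => if p.2 then o1 p.1 else o0 p.1)); last first.
  exists (fun c => (Ordinal (half_lt c), odd c)) => [[i b] _|c _] /=.
    case: b; congr pair; rewrite /= ?oddM //; apply: val_inj => /=.
      by rewrite mul2n uphalf_double.
    by rewrite mul2n doubleK.
  by case: ifP => oc; apply: val_inj; rewrite /=; lia.
rewrite -(pair_bigA _ (fun i b => F (if b then o1 i else o0 i))) /=.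
by apply: eq_bigr => i _; rewrite big_bool Monoid.mulmC.
Qed.
End Doubling.

Lemma nth_pairs (H : finType) (x : H) (L : seq (H * H)) r :
  nth x (pairs L) (2 * r) = (nth (x, x) L r).1 /\
  nth x (pairs L) (2 * r).+1 = (nth (x, x) L r).2.
Proof.
elim: L r => [|[u v] L IH] r; first by rewrite /pairs /= !nth_nil.
by case: r => [|r] //; rewrite mulnS; exact: IH.
Qed.

Lemma size_pairs (H : finType) (L : seq (H * H)) : size (pairs L) = (2 * size L)%N.
Proof. by elim: L => //= q L IH; rewrite IH; lia. Qed.

Lemma cover_perm (H : finType) (s : seq H) :
  (forall x, x \in s) -> size s = #|H| -> perm_eq s (enum H).
Proof.
move=> cov sz; apply: uniq_perm; last by move=> x; rewrite cov mem_enum.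
  by apply/card_uniqP; rewrite sz; apply: eq_card => x; rewrite cov.
exact: enum_uniq.
Qed.

Section Assembly.
Variables (K : realFieldType) (n : nat).
Hypothesis n0 : (0 < n)%N.
Local Notation m := (2 * n)%N.
Local Notation I := (sym_index m).
Local Notation E := (exterior K I).
Local Notation S := (symgen K m).
Local Notation H := ('I_m.+1 * 'I_m)%type.
Local Notation F := {ffun H -> 'I_m}.
Local Notation o0 i := (Ordinal (lt_double_ord i)).
Local Notation o1 i := (Ordinal (lt_doubleS_ord i)).
Implicit Types (a : F) (h : H).

Definition pf : E := pfaffian (S ^+ 2).

(** The sign tensor that is kept, on the cell [ord0]; the remaining 2n cells are paired. *)
Definition w0 a : K := cell_det K (fun i => a (ord0, i)).
Definition Z0 : seq H := [seq (ord0, i) | i <- enum 'I_m].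

Lemma mem_Z0 h : (h \in Z0) = (h.1 == ord0).
Proof.
case: h => c i; apply/mapP/eqP => [[j _ [->]] //|/= ->].
by exists i; rewrite // mem_enum.
Qed.

Lemma Z0_uniq : uniq Z0.
Proof. by rewrite map_inj_uniq ?enum_uniq // => i j []. Qed.

Lemma w0_insert a (k l : 'I_m) :
  \sum_(h <- Z0 | a h == l) w0 (upd a h k) = (k == l)%:R * w0 a.
Proof.
rewrite big_map big_enum_cond /= -cell_det_insert; apply: eq_big => // i _.
rewrite /w0; congr (\det _); apply/matrixP => x y; rewrite !mxE updE.
by rewrite xpair_eqE eqxx.
Qed.

Lemma w0_swap a h h' : h \in Z0 -> h' \in Z0 -> h != h' ->
  w0 (precomp a (tperm h h')) = - w0 a.
Proof.
rewrite !mem_Z0; case: h => c i; case: h' => c' i' /= /eqP-> /eqP-> ne.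
have ii' : i != i' by apply: contraNneq ne => ->.
rewrite /w0 -mulN1r.
have <- : (-1) ^+ (tperm i i') = -1 :> K by rewrite odd_tperm ii' expr1.
rewrite -cell_det_precomp; congr (\det _); apply/matrixP => x y; rewrite !mxE ffunE.
congr (a _ == y)%:R.
have [->|xi] := eqVneq x i; first by rewrite !tpermL.
have [->|xi'] := eqVneq x i'; first by rewrite !tpermR.
by rewrite !tpermD // ?xpair_eqE ?eqxx /= 1?eq_sym.
Qed.

Lemma w0_upd a h k : h \notin Z0 -> w0 (upd a h k) = w0 a.
Proof.
rewrite mem_Z0; case: h => c i /= c0; congr (\det _); apply/matrixP => x y; rewrite !mxE updE.
by rewrite xpair_eqE (eq_sym ord0) (negPf c0).
Qed.

Lemma pf_sum (pi : 'S_m) :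
  \sum_(s : 'S_m) (-1) ^+ s *: \prod_(r < n) (S ^+ 2) (s (pi (o0 r))) (s (pi (o1 r))) =
  ((-1) ^+ pi * (2 ^ n * n`!)%:R) *: pf.
Proof.
rewrite /pf /pfaffian scalerA -mulrA mulfV ?mulr1; last first.
  by rewrite pnatr_eq0 -lt0n muln_gt0 expn_gt0 fact_gt0.
rewrite (reindex_inj (mulgI pi^-1%g)) scaler_sumr; apply: eq_bigr => s _.
rewrite odd_permM odd_permV signr_addb -scalerA; congr (_ *: _).
have -> : forall u : E, (-1) ^+ s * u = (-1) ^+ s *: u.
  by move=> u; rewrite mulr_sign scaler_sign.
congr (_ *: _); apply: eq_bigr => r _.
by rewrite !permM !permK.
Qed.

Lemma J_base B : perm_eq (slots B) Z0 -> all (fun b => b.1 == 2%N) B ->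
  trace_span pf (J w0 B).
Proof.
move=> pB aB.
have uB : uniq (slots B) by rewrite (perm_uniq pB) Z0_uniq.
have sB : size B = n.
  have := perm_size pB; rewrite size_map -cardE card_ord /slots size_pairs size_map.
  by move/eqP; rewrite eqn_pmul2l // => /eqP.
have ssz : size (slots B) = m by rewrite /slots size_pairs size_map sB.
pose d0 : H := (ord0, o0 (Ordinal n0)).
pose f (r : 'I_m) : 'I_m := (nth d0 (slots B) r).2.
have cov (r : 'I_m) : nth d0 (slots B) r = (ord0, f r).
  have : nth d0 (slots B) r \in Z0 by rewrite -(perm_mem pB) mem_nth // ssz.
  by rewrite mem_Z0 /f => /eqP <-; case: nth.
have f_inj : injective f.
  move=> r r' e; apply/val_inj/eqP; rewrite /= -(nth_uniq d0 _ _ uB) ?ssz //.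
  by rewrite !cov e.
pose pi := perm f_inj.
(* The number of assignments with prescribed values on [Z0], contributed by the free slots outside
   [Z0]. It is the same for every permutation s. *)
pose c0 : K := \sum_(a : F) (\prod_i (a (ord0, i) == i)%:R).
have cs (s : 'S_m) : \sum_(a : F) (\prod_i (a (ord0, i) == s i)%:R) = c0.
  rewrite (reindex_inj (h := fun a => [ffun h => s (a h)])) /=.
    apply: eq_bigr => a _; apply: eq_bigr => i _.
    by rewrite ffunE (inj_eq perm_inj).
  by move=> a a' /ffunP e; apply/ffunP => h; have := e h; rewrite !ffunE => /perm_inj.
suff -> : J w0 B = (c0 * ((-1) ^+ pi * (2 ^ n * n`!)%:R)) *: pf by apply/TSscale/TSbase.
rewrite -scalerA -pf_sum /J.
under eq_bigr => a _ do rewrite /w0 cell_detE scaler_suml.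
rewrite exchange_big scaler_sumr /=; apply: eq_bigr => s _.
rewrite scalerA mulrC -(cs s) mulr_sumr scaler_suml; apply: eq_bigr => a _.
have [/forallP e|] := boolP [forall i, a (ord0, i) == s i]; last first.
  by rewrite negb_forall => /existsP[i /negPf ni]; rewrite (bigD1 i) //= ni !(mul0r, mulr0, scale0r).
congr (_ *: _); rewrite /brs (big_nth (0%N, (d0, d0))) sB big_mkord.
apply: eq_bigr => r _.
set b := nth _ _ _.
have bB : b \in B by rewrite mem_nth // sB.
have := allP aB _ bB; move/eqP => b1.
have [] := nth_pairs d0 [seq b.2 | b <- B] r.
rewrite -/(slots B) (nth_map (0%N, (d0, d0))) ?sB // -/b => e0 e1.
have E0 : b.2.1 = (ord0, pi (o0 r)) by rewrite permE -cov.
have E1 : b.2.2 = (ord0, pi (o1 r)) by rewrite permE -cov.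
by rewrite brE b1 E0 E1 (eqP (e _)) (eqP (e _)).
Qed.

(** The cells after [ord0] are paired two by two, and [t r] is the permutation that the
    epsilon-delta identity yields for the r-th pair. *)
Lemma epsilon_pairs a : epsilon K a = w0 a *
  \sum_(t : {ffun 'I_n -> 'S_m}) (\prod_r (-1) ^+ t r) *
     \prod_r \prod_i (a (lift ord0 (o0 r), i) == a (lift ord0 (o1 r), t r i))%:R.
Proof.
rewrite /epsilon big_ord_recl; congr (_ * _).
rewrite big_double /=.
under eq_bigr do rewrite cell_det_mul.
rewrite bigA_distr_bigA; apply: eq_bigr => t _.
by rewrite big_split.
Qed.

Definition edges (phi : {perm H}) : seq (bracket H) :=
  [seq (1%N, (phi (slot e false), phi (slot e true))) | e <- index_enum I].

Lemma brs_edges a phi : brs K a (edges phi) = edge_prod K (precomp a phi).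
Proof.
rewrite /brs big_map; apply: eq_bigr => e _.
by rewrite brE expr1 mxE !ffunE.
Qed.

Lemma card_slots : #|{: H}| = (m.+1 * m)%N.
Proof. by rewrite card_prod !card_ord. Qed.

Lemma edges_perm phi : perm_eq (slots (edges phi)) (enum {: H}).
Proof.
apply: cover_perm => [h|]; last first.
  rewrite card_slots -card_sym_index /slots size_pairs !size_map mulnC.
  by rewrite [#|_|]cardE enumT [index_enum I]unlock.
rewrite -(permKV phi h) -(slot_invK (phi^-1%g h)).
case: (slot_inv _) => e b /=; apply/flatten_mapP.
exists (phi (slot e false), phi (slot e true)); last first.
  by case: b; rewrite !inE eqxx ?orbT.
rewrite -map_comp; apply/mapP; exists e => //; exact: mem_index_enum.
Qed.

Definition links (t : {ffun 'I_n -> 'S_m}) : seq (H * H) :=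
  [seq ((lift ord0 (o0 r), i), (lift ord0 (o1 r), t r i)) | r <- enum 'I_n, i <- enum 'I_m].

Lemma prod_links a t : \prod_(q <- links t) (a q.1 == a q.2)%:R =
  \prod_r \prod_i (a (lift ord0 (o0 r), i) == a (lift ord0 (o1 r), t r i))%:R :> K.
Proof.
rewrite big_allpairs_dep big_enum /=; apply: eq_bigr => r _.
by rewrite big_enum.
Qed.

Lemma mem_pairs (x : H) (L : seq (H * H)) :
  reflect (exists2 q, q \in L & x = q.1 \/ x = q.2) (x \in pairs L).
Proof.
apply: (iffP flatten_mapP) => -[q qL].
  by rewrite !inE => /orP[] /eqP ->; exists q => //; [left|right].
by move=> e; exists q => //; rewrite !inE; case: e => ->; rewrite eqxx ?orbT.
Qed.

Lemma links_perm t : perm_eq (Z0 ++ pairs (links t)) (enum {: H}).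
Proof.
apply: cover_perm => [[c i]|]; last first.
  rewrite card_slots size_cat size_pairs size_map size_enum_ord size_allpairs !size_enum_ord.
  by rewrite mulSn mulnA.
rewrite mem_cat mem_Z0 /=; case: (unliftP ord0 c) => [c' ->|->] //=.
apply/mem_pairs; have [r [->|->]] := double_ord_cases c'.
  exists ((lift ord0 (o0 r), i), (lift ord0 (o1 r), t r i)); last by left.
  by apply: allpairs_f; rewrite mem_enum.
exists ((lift ord0 (o0 r), ((t r)^-1)%g i), (lift ord0 (o1 r), t r ((t r)^-1%g i))).
  by apply: allpairs_f; rewrite mem_enum.
by right; rewrite /= permKV.
Qed.

Lemma contraction_span phi :
  trace_span pf (\sum_a epsilon K a *: edge_prod K (precomp a phi)).
Proof.
pose sg (t : {ffun 'I_n -> 'S_m}) : K := \prod_r (-1) ^+ t r.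
have -> : \sum_a epsilon K a *: edge_prod K (precomp a phi) =
    \sum_(t : {ffun 'I_n -> 'S_m}) sg t *:
       J (fun a => w0 a * \prod_(q <- links t) (a q.1 == a q.2)%:R) (edges phi).
  rewrite /J; under [RHS]eq_bigr do rewrite scaler_sumr.
  rewrite [RHS]exchange_big /=; apply: eq_bigr => a _.
  rewrite epsilon_pairs -brs_edges mulr_sumr scaler_suml; apply: eq_bigr => t _.
  by rewrite scalerA prod_links mulrCA.
apply: trace_span_sum => t _; apply: TSscale.
have m0 : (0 < m)%N by rewrite muln_gt0.
have uLZ : uniq (Z0 ++ pairs (links t)) by rewrite (perm_uniq (links_perm t)) enum_uniq.
apply: (J_links m0 (Z := Z0)) => [B pB uB|a h k hL||].
- apply: (J_reduce Z0_uniq w0_insert w0_swap) => // B' pB' aB'.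
  exact: J_base.
- apply: w0_upd; apply/negP => hZ; move: uLZ; rewrite cat_uniq => /and3P[_ /hasPn/(_ _ hL)].
  by rewrite /= hZ.
- by rewrite (perm_uniq (edges_perm phi)) enum_uniq.
- by rewrite (permPl (edges_perm phi)) perm_sym links_perm.
Qed.

Lemma trace_span_top : exists2 u, trace_span pf u & u [set: I] != 0.
Proof.
have [phi h] := contraction_neq0 K m.
by exists (\sum_a epsilon K a *: edge_prod K (precomp a phi)); first exact: contraction_span.
Qed.
End Assembly.

Lemma odd_degree k : odd (4 * k + 1)%N.
Proof. lia. Qed.

(** * The top product at the identity *)

Section TopProduct.
Variables (K : realFieldType) (n : nat).
Hypothesis n0 : (0 < n)%N.
Local Notation m := (2 * n)%N.
Local Notation I := (sym_index m).
Local Notation E := (exterior K I).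
Local Notation S := (symgen K m).
Local Notation pf := (pf K n).

Definition alpha (k : nat) : E := \tr (S ^+ (4 * k + 1)).

Lemma homog_alpha k : homog (4 * k + 1)%N (alpha k).
Proof. exact/homog_trace/(homog_pow (@homog_symgen K m)). Qed.

Lemma alphaC k l : alpha k * alpha l = - (alpha l * alpha k).
Proof.
rewrite (homogC (@homog_alpha k) (@homog_alpha l)) -signr_odd oddM !odd_degree.
by rewrite expr1 scaleN1r.
Qed.

Lemma alpha_sqr k : alpha k * alpha k = 0.
Proof. by apply: eq_oppr0; exact: alphaC. Qed.

Lemma alpha_large k : (n <= k)%N -> alpha k = 0.
Proof.
move=> le; rewrite /alpha (odd_mx_nilp_le (@homog_symgen K m)) ?mxtrace0 //; lia.
Qed.

Lemma trace_pow_cases p : (exists c : K, \tr (S ^+ p) = c%:A) \/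
  exists k, \tr (S ^+ p) = alpha k.
Proof.
have hS := @homog_symgen K m; have sS := symgen_tr K m.
case: (posnP p) => [->|p0].
  by left; exists m%:R; rewrite expr0 mxtrace1 scaler_nat.
have [op|ep] := boolP (odd p); last first.
  left; exists 0; rewrite scale0r -(trace_even_pow hS p./2.-1); congr (\tr (S ^+ _)); lia.
have [b|b] := boolP (odd p./2).
  left; exists 0; rewrite scale0r -(trace_pow3 hS sS p./2./2); congr (\tr (S ^+ _)); lia.
right; exists p./2./2; rewrite /alpha; congr (\tr (S ^+ _)); lia.
Qed.

(** The traces that are neither scalars nor zero are the [alpha k] with k < n. They anticommute and
    square to zero, so every word in them is an exterior polynomial in n generators. *)
Lemma trace_span_hom u : trace_span pf u ->
  exists t : exterior K 'I_n, u = ext_hom (fun k : 'I_n => alpha k) t * pf.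
Proof.
elim=> [|x y _ [t ->] _ [t' ->]|c x _ [t ->]|p x _ [t ->]].
- by exists 1; rewrite ext_hom1 mul1r.
- by exists (t + t'); rewrite linearD mulrDl.
- by exists (c *: t); rewrite linearZ scalerAl.
have [[c ->]|[k ->]] := trace_pow_cases p.
  by exists (c *: t); rewrite linearZ /= mulr_algl scalerAl.
have [lt|le] := ltnP k n; last first.
  by exists 0; rewrite alpha_large // linear0 !mul0r.
exists (ext_gen K (Ordinal lt) * t); rewrite ext_hom_gen_mul ?mulrA // => [a b|a].
  exact: alphaC.
exact: alpha_sqr.
Qed.

Lemma homog_pf : homog m pf.
Proof.
apply: homogZ; apply: homog_sum => s _.
have e : (\sum_(i < n) 2 = m)%N by rewrite sum_nat_const card_ord mulnC.
have h : homog (\sum_(i < n) 2)%N (\prod_(i < n) (S ^+ 2) (s (Ordinal (lt_double_ord i)))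
    (s (Ordinal (lt_doubleS_ord i)))).
  by apply: homog_prod => i _; exact: (homog_pow (@homog_symgen K m)).
rewrite e in h; rewrite mulr_sign; case: ifP => // _; exact: homogN.
Qed.

(** The degrees of the alphas add up to n(2n-1). Adding 2n for the Pfaffian gives n(2n+1), the
    dimension of the symmetric matrices. *)
Lemma alpha_degrees : (\sum_(k < n) (4 * k + 1) + m = #|{: I}|)%N.
Proof.
apply/eqP; rewrite -(eqn_pmul2r (m := 2)) // card_sym_index; apply/eqP.
elim: n => [|k IH]; first by rewrite big_ord0.
rewrite big_ord_recr /=; move: IH; move: (\sum_(_ < k) _)%N => s IH; nia.
Qed.

(** Omitting any [alpha k] lowers the degree below the top. If the full product vanished there, so
    would the whole span, against [trace_span_top]. *)
Lemma alpha_pf_top : ((\prod_(k < n) alpha k) * pf) [set: I] != 0.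
Proof.
have [u tu] := trace_span_top K n0; have [t ->] := trace_span_hom tu.
apply: contraNneq => top0; rewrite /ext_hom mulr_suml sum_ffunE big1 // => A _.
rewrite -scalerAl extZ.
have [->|nA] := eqVneq A setT.
  by under eq_bigl do rewrite inE; rewrite top0 mulr0.
have hA : homog (\sum_(k in A) (4 * k + 1) + m) ((\prod_(k in A) alpha k) * pf).
  by apply: homogM; [apply: homog_prod => k _; exact: homog_alpha|exact: homog_pf].
rewrite hA ?mulr0 // cardsT -alpha_degrees eqn_add2r neq_ltn; apply/orP; right.
have /subsetPn[k _ kA] : ~~ (setT \subset A) by rewrite subTset.
rewrite [X in (_ < X)%N](bigID (mem A)) /= -[X in (X < _)%N]addn0 ltn_add2l.
by rewrite (bigD1 k) //= addn1 addSn.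
Qed.

End TopProduct.

(** * Integrality of the Pfaffian *)

Section Hyperoctahedral.
Variable n : nat.
Local Notation m := (2 * n)%N.
Local Notation o0 i := (Ordinal (lt_double_ord i)).
Local Notation o1 i := (Ordinal (lt_doubleS_ord i)).
Implicit Types (t : 'S_n) (e : {ffun 'I_n -> bool}) (x : 'I_m) (i : 'I_n).

Lemma half_ord_lt x : (x./2 < n)%N.
Proof. by have := ltn_ord x; lia. Qed.

Definition block x : 'I_n := Ordinal (half_ord_lt x).
Definition in_block i (b : bool) : 'I_m := if b then o1 i else o0 i.

Lemma block_in i b : block (in_block i b) = i.
Proof.
by apply: val_inj; case: b; rewrite /= ?mul2n ?uphalf_double ?doubleK.
Qed.

Lemma odd_in i b : odd (in_block i b) = b.
Proof. by case: b; rewrite /= oddM. Qed.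

Lemma in_blockK x : in_block (block x) (odd x) = x.
Proof. by apply: val_inj; rewrite /in_block; case: ifP => o /=; lia. Qed.

(** An element of the hyperoctahedral group: t permutes the blocks {2i, 2i+1}, and e tells which
    blocks are flipped. *)
Definition wreath_fun t e x := in_block (t (block x)) (e (block x) (+) odd x).

Lemma wreath_inj t e : injective (wreath_fun t e).
Proof.
move=> x y exy; rewrite -(in_blockK x) -(in_blockK y).
have /perm_inj eb : t (block x) = t (block y).
  by rewrite -[LHS](block_in _ (e (block x) (+) odd x)) -/(wreath_fun t e x) exy block_in.
have : e (block x) (+) odd x = e (block y) (+) odd y.
  by rewrite -[LHS](odd_in (t (block x))) -/(wreath_fun t e x) exy odd_in.
by rewrite eb => /addbI ->.
Qed.

Definition wreath (p : 'S_n * {ffun 'I_n -> bool}) : 'S_m := perm (@wreath_inj p.1 p.2).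

Lemma wreathE t e i b : wreath (t, e) (in_block i b) = in_block (t i) (e i (+) b).
Proof. by rewrite permE /wreath_fun block_in odd_in. Qed.

Lemma wreathM t e t' e' :
  (wreath (t, e) * wreath (t', e'))%g = wreath ((t * t')%g, [ffun i => e i (+) e' (t i)]).
Proof.
apply/permP => x; rewrite -(in_blockK x) permM !wreathE ffunE permM.
by rewrite [e _ (+) e' _]addbC addbA.
Qed.

Lemma wreath1 : wreath (1%g, [ffun=> false]) = 1%g.
Proof. by apply/permP => x; rewrite -(in_blockK x) wreathE ffunE !perm1. Qed.

Lemma wreath_is_inj : injective wreath.
Proof.
move=> [t e] [t' e'] /permP w; congr pair.
  by apply/permP => i; have := w (in_block i false); rewrite !wreathE => /(congr1 block); rewrite !block_in.
apply/ffunP => i; have := w (in_block i false).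
by rewrite !wreathE => /(congr1 (fun x : 'I_m => odd x)); rewrite !odd_in !addbF.
Qed.

Lemma in_block_eq i b j c : (in_block i b == in_block j c) = (i == j) && (b == c).
Proof.
apply/eqP/andP => [e|[/eqP-> /eqP->] //].
by split; apply/eqP; [rewrite -(block_in i b) e block_in|rewrite -(odd_in i b) e odd_in].
Qed.

Lemma eq_perm_in_block (s s' : 'S_m) :
  (forall i b, s (in_block i b) = s' (in_block i b)) -> s = s'.
Proof. by move=> h; apply/permP => x; rewrite -(in_blockK x). Qed.

Lemma tperm_in_block i b j c k d :
  (i != k) || (b != d) -> (j != k) || (c != d) ->
  tperm (in_block i b) (in_block j c) (in_block k d) = in_block k d.
Proof. by move=> h1 h2; rewrite tpermD // in_block_eq negb_and. Qed.

Lemma wreath_tperm i j : wreath (tperm i j, [ffun=> false]) =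
  (tperm (in_block i false) (in_block j false) * tperm (in_block i true) (in_block j true))%g.
Proof.
apply: eq_perm_in_block => k b; rewrite wreathE ffunE permM.
have [->|ki] := eqVneq k i.
  case: b; first by rewrite tpermL (@tperm_in_block i false j false i true) ?orbT // tpermL.
  by rewrite !tpermL tperm_in_block ?orbT.
have [->|kj] := eqVneq k j.
  case: b; first by rewrite tpermR (@tperm_in_block i false j false j true) ?orbT // tpermR.
  by rewrite !tpermR tperm_in_block ?orbT.
have ik : i != k by rewrite eq_sym.
have jk : j != k by rewrite eq_sym.
by rewrite tpermD // !tperm_in_block ?ik ?jk.
Qed.

Lemma wreath_flip i e : e i ->
  wreath (1%g, e) = (tperm (in_block i false) (in_block i true) *
    wreath (1%g, [ffun j => if j == i then false else e j]))%g.
Proof.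
move=> ei; apply: eq_perm_in_block => k b; rewrite permM wreathE perm1.
have [->|ki] := eqVneq k i.
  by case: b; rewrite ?(tpermL, tpermR) wreathE perm1 ffunE eqxx ei.
by rewrite tperm_in_block ?wreathE ?perm1 ?ffunE ?(negPf ki) // eq_sym ki.
Qed.

(** Permuting blocks is even, because exchanging two blocks takes two transpositions. Each flip is a
    single transposition. *)
Lemma odd_wreath t e : odd_perm (wreath (t, e)) = \big[addb/false]_i e i.
Proof.
have -> : wreath (t, e) = (wreath (1%g, e) * wreath (t, [ffun=> false]))%g.
  rewrite wreathM mul1g; congr (wreath (_, _)).
  by apply/ffunP => i; rewrite !ffunE addbF.
rewrite odd_permM [X in _ (+) X](_ : _ = false) ?addbF; last first.
  have [ts -> _] := prod_tpermP t.
  elim: ts => [|[i j] ts IH]; first by rewrite big_nil wreath1 odd_perm1.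
  rewrite big_cons.
  have -> : wreath ((tperm (i, j).1 (i, j).2 * \prod_(s <- ts) tperm s.1 s.2)%g, [ffun=> false])
    = (wreath (tperm i j, [ffun=> false]) * wreath ((\prod_(s <- ts) tperm s.1 s.2)%g, [ffun=> false]))%g.
    rewrite wreathM; congr (wreath (_, _)).
    by apply/ffunP => k; rewrite !ffunE.
  rewrite odd_permM IH addbF wreath_tperm.
  by rewrite odd_permM !odd_tperm !in_block_eq !andbT addbb.
have [N] := ubnP (\sum_i e i)%N; elim: N e => // N IH e lt.
have [/existsP[i ei]|] := boolP [exists i, e i]; last first.
  rewrite negb_exists => /forallP h.
  have -> : e = [ffun=> false] by apply/ffunP => i; rewrite ffunE; exact/negbTE.
  by rewrite wreath1 odd_perm1 big1 // => i _; rewrite ffunE.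
rewrite (wreath_flip ei) odd_permM odd_tperm in_block_eq eqxx /= IH; last first.
  move: lt; rewrite (bigD1 i) //= ei add1n ltnS; apply: leq_trans.
  rewrite (bigD1 i) //= ffunE eqxx add0n ltnS.
  by apply: leq_sum => j /negPf ji; rewrite ffunE ji.
rewrite (bigD1 i) //= ffunE eqxx addFb [RHS](bigD1 i) //= ei; congr (~~ _).
by apply: eq_bigr => j /negPf ji; rewrite ffunE ji.
Qed.

Definition wreath_set : {set 'S_m} := [set wreath p | p in [set: 'S_n * {ffun 'I_n -> bool}]].

Lemma wreath_group_set : group_set wreath_set.
Proof.
apply/group_setP; split.
  by apply/imsetP; exists (1%g, [ffun=> false]); rewrite ?inE ?wreath1.
move=> _ _ /imsetP[[t e] _ ->] /imsetP[[t' e'] _ ->].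
by rewrite wreathM; apply/imsetP; eexists; last reflexivity; rewrite inE.
Qed.

Canonical wreath_group := Group wreath_group_set.

Lemma card_wreath : #|wreath_set| = (2 ^ n * n`!)%N.
Proof.
rewrite card_imset; last exact: wreath_is_inj.
by rewrite cardsT card_prod card_ffun card_bool card_ord card_Sn mulnC.
Qed.
End Hyperoctahedral.

Arguments in_block : simpl never.

Section Integrality.
Variables (K : realFieldType) (I : finType).
Local Notation E := (exterior K I).
Implicit Types u v : E.

Definition integral u := forall A : {set I}, exists z : int, u A = z%:~R.

Lemma integral0 : integral 0.
Proof. by move=> A; exists 0; rewrite ffunE. Qed.

Lemma integral1 : integral 1.
Proof. by move=> A; exists ((A == set0) : nat)%:Z; rewrite ffunE. Qed.

Lemma integralD u v : integral u -> integral v -> integral (u + v).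
Proof.
by move=> hu hv A; have [x ex] := hu A; have [y ey] := hv A; exists (x + y); rewrite extD ex ey intrD.
Qed.

Lemma integralN u : integral u -> integral (- u).
Proof. by move=> hu A; have [x ex] := hu A; exists (- x); rewrite extN ex intrN. Qed.

Lemma integral_sum (J : Type) (r : seq J) (P : pred J) (F : J -> E) :
  (forall j, P j -> integral (F j)) -> integral (\sum_(j <- r | P j) F j).
Proof. by move=> h; apply: (big_ind integral) => //; [exact: integral0|exact: integralD]. Qed.

Lemma integralM u v : integral u -> integral v -> integral (u * v).
Proof.
move=> hu hv A; rewrite ffunE.
apply: (big_ind (fun x : K => exists z : int, x = z%:~R)) => [|_ _ [x ->] [y ->]|B _].
- by exists 0.
- by exists (x + y); rewrite intrD.
have [x ->] := hu B; have [y ->] := hv (A :\: B).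
by exists ((-1) ^+ inversions B (A :\: B) * x * y); rewrite !rmorphM /= rmorphXn rmorphN1.
Qed.

Lemma integral_prod (J : Type) (r : seq J) (P : pred J) (F : J -> E) :
  (forall j, P j -> integral (F j)) -> integral (\prod_(j <- r | P j) F j).
Proof. by move=> h; apply: (big_ind integral) => //; [exact: integral1|exact: integralM]. Qed.

Lemma integral_gen (a : I) : integral (ext_gen K a).
Proof. by move=> A; exists ((A == [set a]) : nat)%:Z; rewrite ffunE. Qed.

Definition integral_mx p q (M : 'M[E]_(p, q)) := forall i j, integral (M i j).

Lemma integral_mulmx p q r (M : 'M[E]_(p, q)) (M' : 'M[E]_(q, r)) :
  integral_mx M -> integral_mx M' -> integral_mx (M *m M').
Proof. by move=> h h' i j; rewrite mxE; apply: integral_sum => k _; exact: integralM. Qed.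

Lemma integral_expmx p (M : 'M[E]_p) k : integral_mx M -> integral_mx (M ^+ k).
Proof.
move=> h; elim: k => [|k IH].
  by move=> i j; rewrite expr0 mxE; case: eqP => _; [exact: integral1|exact: integral0].
by rewrite exprS; exact: integral_mulmx.
Qed.

Lemma integral_trace p (M : 'M[E]_p) : integral_mx M -> integral (\tr M).
Proof. by move=> h; apply: integral_sum. Qed.

(* The hyperoctahedral group acts freely on permutations and leaves the terms of
   the Pfaffian unchanged, so each distinct term occurs 2^n n! times. *)
Lemma integral_pfaffian n (S : 'M[E]_(2 * n)) : homog_mx 1 S -> S^T = S ->
  integral_mx S -> integral (pfaffian (S ^+ 2)).
Proof.
move=> hS sS iS.
have ev i j : (S ^+ 2) i j \in even_pred (K := K) (I := I).
  by apply/even_predP; have /homog_parity := homog_pow (p := 2) hS i j.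
(* The entries are moved into a commutative ring so that the factors of a term can be reindexed by a
   permutation of the blocks. *)
pose A i j : even_ext K I := EvenExt (ev i j).
have skew i j : A j i = - A i j.
  apply: val_inj; rewrite rmorphN /= (pow_sym hS sS) expr1 scaleN1r.
  by [].
pose f (s : 'S_(2 * n)) : even_ext K I := (-1) ^+ s *
   \prod_(i < n) A (s (in_block i false)) (s (in_block i true)).
have fE s : even_val (f s) = (-1) ^+ s *
  \prod_(i < n) (S ^+ 2) (s (Ordinal (lt_double_ord i))) (s (Ordinal (lt_doubleS_ord i))).
  rewrite /f -[even_val _]/(\val (f s)) rmorphM rmorph_sign rmorph_prod.
  by [].
have f_inv h s : h \in wreath_set n -> f (h * s)%g = f s.
  case/imsetP => -[t e] _ ->; rewrite /f odd_permM odd_wreath signr_addb.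
  rewrite -mulrA mulrCA; congr (_ * _).
  rewrite [RHS](reindex_inj (@perm_inj _ t)) /=.
  rewrite (big_morph (fun b : bool => (-1) ^+ b : even_ext K I) (id1 := 1) (op1 := *%R)) //; last exact: signr_addb.
  rewrite -big_split /=; apply: eq_bigr => i _.
  rewrite !permM !wreathE addbF addbT; case: (e i); last by rewrite expr0 mul1r.
  by rewrite expr1 mulN1r skew opprK.
rewrite /pfaffian.
have -> : \sum_(s : 'S_(2 * n)) (-1) ^+ s *
    \prod_(i < n) (S ^+ 2) (s (Ordinal (lt_double_ord i))) (s (Ordinal (lt_doubleS_ord i)))
  = \sum_(s in [set: 'S_(2 * n)]%g) even_val (f s).
  by apply: eq_big => [s|s _]; rewrite ?inE // fE.
have [/eqP cov triv _] := and3P (rcosets_partition (subsetT (wreath_group n))).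
rewrite -cov (big_trivIset _ triv) scaler_sumr; apply: integral_sum => C.
case/rcosetsP => s _ ->.
rewrite (eq_bigr (fun=> even_val (f s))) => [|x]; last first.
  by case/rcosetP => h hW ->; congr even_val; exact: f_inv.
rewrite sumr_const card_rcoset card_wreath -scaler_nat scalerA mulVf ?scale1r; last first.
  by rewrite pnatr_eq0 -lt0n muln_gt0 expn_gt0 fact_gt0.
rewrite fE mulr_sign; have h : integral (\prod_(i < n) (S ^+ 2) (s (Ordinal (lt_double_ord i)))
   (s (Ordinal (lt_doubleS_ord i)))).
  by apply: integral_prod => i _; exact: integral_expmx.
by case: ifP => // _; exact: integralN.
Qed.
End Integrality.

(** * Cancellation in matrix products *)

Section Cancellation.
Variables (R : pzRingType) (n : nat).
Implicit Types A B C D M N : 'M[R]_n.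

Lemma mulmx_cancel A B C D M N : C *m D = 1%:M ->
  A *m B *m C *m (D *m M *m N) = A *m (B *m M) *m N.
Proof. by move=> e; rewrite !mulmxA -(mulmxA (A *m B) C D) e mulmx1. Qed.

Lemma mulmx_conj A B M N : A *m B = 1%:M ->
  (B *m M *m A) *m (B *m N *m A) = B *m (M *m N) *m A.
Proof. exact: mulmx_cancel. Qed.

Lemma mulmx_cancel2 A B C D M N : C *m D = 1%:M -> A *m B = 1%:M ->
  (D *m M *m A) *m (B *m N *m C) *m (D *m M *m A) = D *m (M *m N *m M) *m A.
Proof.
move=> e1 e2; rewrite (mulmx_cancel _ _ _ _ e2).
by rewrite (mulmx_cancel _ _ _ _ e1).
Qed.
End Cancellation.

(** * Contraction and equivariance *)

Section InvariantFormsAt.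
Variables (K : realFieldType) (m : nat).
Local Notation I := (sym_index m).
Local Notation E := (exterior K I).
Local Notation S := (symgen K m).
Implicit Types (X g : 'M[K]_m) (k p : nat).

(** The form X^-1 dX, of Maurer-Cartan type. The matrix dX X^-1 dX, named [curv] below, is X times
    its square. *)
Definition mc X : 'M[E]_m := cmx (invmx X) *m S.

Definition beta X k : E := \tr (mc X ^+ (4 * k + 1)).

Definition curv X : 'M[E]_m := S *m cmx (invmx X) *m S.

Lemma homog_cmx n (A : 'M[K]_(m, n)) : homog_mx 0 (cmx A).
Proof. exact: homog_const_mx. Qed.

Lemma homog_mc X : homog_mx 1 (mc X).
Proof. exact: (homog_mulmx (homog_cmx _) (@homog_symgen K m)). Qed.

Lemma homog_curv X : homog_mx 2 (curv X).
Proof.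
apply: (homog_mulmx (d := 1) (e := 1)); last exact: homog_symgen.
exact: (homog_mulmx (@homog_symgen K m) (homog_cmx _)).
Qed.

Lemma homog_beta X k : homog (4 * k + 1)%N (beta X k).
Proof. exact/homog_trace/homog_pow/homog_mc. Qed.

Lemma betaC X k l : beta X k * beta X l = - (beta X l * beta X k).
Proof.
rewrite (homogC (@homog_beta X k) (@homog_beta X l)) -signr_odd oddM !odd_degree.
by rewrite expr1 scaleN1r.
Qed.

Lemma beta_sqr X k : beta X k * beta X k = 0.
Proof. by apply: eq_oppr0; exact: betaC. Qed.

Lemma cmx1 : cmx (1%:M : 'M[K]_m) = 1%:M.
Proof. exact: map_mx1. Qed.

Section EulerContraction.
Variable X : 'M[K]_m.
Hypotheses (symX : X^T = X) (unitX : X \in unitmx).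
Local Notation ip := (interior_product (coordinate X)).

Lemma ip_mulmx d (M M' : 'M[E]_m) : homog_mx d M ->
  map_mx ip (M *m M') = map_mx ip M *m M' + (-1) ^+ d *: (M *m map_mx ip M').
Proof.
move=> hM; apply/matrixP => i j; rewrite !mxE linear_sum mulr_sumr -big_split.
apply: eq_bigr => k _; rewrite !mxE /= (interior_productM _ _ (hM i k)).
by rewrite -signr_odd -[in RHS]signr_odd mulr_sign scaler_sign.
Qed.

Lemma ip_symgen : map_mx ip S = cmx X.
Proof.
apply/matrixP => i j; rewrite !mxE interior_product_gen /coordinate /= /sort_pair.
by case: ifP => //= _; rewrite -[in LHS]symX mxE.
Qed.

Lemma ip_cmx (A : 'M[K]_m) : map_mx ip (cmx A) = 0.
Proof.
by apply/matrixP => i j; rewrite !mxE /= linearZ /= interior_product1 scaler0.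
Qed.

Lemma ip_mc : map_mx ip (mc X) = 1%:M.
Proof.
rewrite (ip_mulmx _ (homog_cmx _)) ip_cmx mul0mx add0r expr0 scale1r ip_symgen.
by rewrite -cmxM mulVmx // cmx1.
Qed.

(** The contraction of X^-1 dX is the identity, so each of the p factors contributes the same power
    with alternating signs; one copy survives if p is odd. *)
Lemma ip_mc_pow p : map_mx ip (mc X ^+ p) = if odd p then mc X ^+ p.-1 else 0.
Proof.
elim: p => [|p IH] /=.
  by rewrite expr0 -[1]/(1%:M) -cmx1 ip_cmx.
rewrite exprS (ip_mulmx _ (homog_mc X)) IH ip_mc mul1mx expr1 scaleN1r.
case: (boolP (odd p)) => op /=; last by rewrite mulmx0 subr0.
by rewrite mulmxE -exprS prednK ?subrr // odd_gt0.
Qed.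

Lemma ip_trace (M : 'M[E]_m) : ip (\tr M) = \tr (map_mx ip M).
Proof. by rewrite linear_sum; apply: eq_bigr => i _; rewrite mxE. Qed.

(** The contraction leaves the trace of the 4k-th power, which vanishes for k > 0 as an even power
    and is m for k = 0. *)
Lemma ip_beta k : ip (beta X k) = if k is 0 then m%:R else 0.
Proof.
rewrite ip_trace ip_mc_pow odd_degree addn1 /=.
case: k => [|k]; first by rewrite muln0 expr0 -[1]/(1%:M) mxtrace1.
by rewrite -(trace_even_pow (homog_mc X) (2 * k).+1); congr (\tr (_ ^+ _)); lia.
Qed.

(** The two factors dX contribute X X^-1 dX and -dX X^-1 X, which cancel. *)
Lemma ip_curv : map_mx ip (curv X) = 0.
Proof.
have h := homog_mulmx (@homog_symgen K m) (homog_cmx (invmx X)).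
rewrite (ip_mulmx _ h) (ip_mulmx _ (@homog_symgen K m)) ip_cmx mulmx0 scaler0 addr0.
rewrite ip_symgen addn0 expr1 scaleN1r -mulmxA -mulmxA -!cmxM.
by rewrite [cmx X *m _]mulmxA -cmxM mulmxV // mulVmx // cmx1 mul1mx mulmx1 subrr.
Qed.

Lemma ip_prod0 (J : Type) (r : seq J) (P : pred J) (F : J -> E) (d : J -> nat) u :
  (forall j, P j -> homog (d j) (F j)) -> (forall j, P j -> ip (F j) = 0) ->
  ip u = 0 -> ip ((\prod_(j <- r | P j) F j) * u) = 0.
Proof.
move=> hd h0 u0; elim: r => [|j r IH]; first by rewrite big_nil mul1r.
rewrite big_cons; case: ifP => // Pj.
by rewrite -mulrA (interior_productM _ _ (hd _ Pj)) h0 // IH mul0r mulr0 scaler0 addr0.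
Qed.
End EulerContraction.

Section Equivariance.
Variables (X g : 'M[K]_m).
Hypotheses (unitg : g \in unitmx) (unitX : X \in unitmx).
Local Notation X' := (g^T *m X *m g).

Lemma invmx_congr : invmx X' = invmx g *m invmx X *m invmx g^T.
Proof.
have ugt : g^T \in unitmx by rewrite unitmx_tr.
have uX' : X' \in unitmx by rewrite !unitmx_mul ugt unitX.
have e : (invmx g *m invmx X *m invmx g^T) *m X' = 1%:M.
  by rewrite !mulmxA mulmxKV // mulmxKV // mulVmx.
by rewrite -[RHS](mulmxK uX') e mul1mx.
Qed.

Lemma cmx_mulV (A : 'M[K]_m) : A \in unitmx -> cmx A *m cmx (invmx A) = 1%:M.
Proof. by move=> u; rewrite -cmxM mulmxV // cmx1. Qed.

Lemma cmx_Vmul (A : 'M[K]_m) : A \in unitmx -> cmx (invmx A) *m cmx A = 1%:M.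
Proof. by move=> u; rewrite -cmxM mulVmx // cmx1. Qed.

(** X^-1 dX transforms by conjugation, hence the betas are invariant. In contrast dX X^-1 dX
    transforms by congruence, which gives its Pfaffian the factor det(g). *)
Lemma mc_congr : map_mx (subst g) (mc X') = cmx (invmx g) *m mc X *m cmx g.
Proof.
rewrite /mc map_mxM map_cmx subst_symgen_mx invmx_congr /substmx.
rewrite (cmxM (invmx g *m invmx X)) (cmxM (invmx g)).
by apply: mulmx_cancel; apply: cmx_Vmul; rewrite unitmx_tr.
Qed.

Lemma conj_pow (M : 'M[E]_m) p :
  (cmx (invmx g) *m M *m cmx g) ^+ p = cmx (invmx g) *m M ^+ p *m cmx g.
Proof.
elim: p => [|p IH].
  by rewrite !expr0 -![1]/(1%:M) mulmx1 cmx_Vmul.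
rewrite !exprS IH; apply: mulmx_conj; exact: cmx_mulV.
Qed.

Lemma subst_beta k : subst g (beta X' k) = beta X k.
Proof.
rewrite /beta -trace_map_mx rmorphXn /= mc_congr conj_pow -mulmxA.
have hp := homog_mulmx (homog_pow (homog_mc X) (p := (4 * k + 1)%N)) (homog_cmx g).
rewrite (mxtrace_homogC (homog_cmx (invmx g)) hp) mul0n expr0 scale1r.
by rewrite -mulmxA cmx_mulV // mulmx1.
Qed.

Lemma curv_congr : map_mx (subst g) (curv X') = cmx g^T *m curv X *m cmx g.
Proof.
rewrite /curv !map_mxM map_cmx subst_symgen_mx invmx_congr /substmx.
rewrite (cmxM (invmx g *m invmx X)) (cmxM (invmx g)).
apply: mulmx_cancel2; last exact: cmx_mulV.
by apply: cmx_Vmul; rewrite unitmx_tr.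
Qed.
End Equivariance.
End InvariantFormsAt.

Section PfaffianCongruence.
Variables (K : realFieldType) (I : finType) (n : nat).
Local Notation E := (exterior K I).
Local Notation m := (2 * n)%N.
Local Notation o0 i := (Ordinal (lt_double_ord i)).
Local Notation o1 i := (Ordinal (lt_doubleS_ord i)).

(** The sign tensor extends the sum from permutations to all functions, the index set that arises on
    expanding the entries of g^T A g. *)
Lemma pfaffian_cell (A : 'M[E]_m) :
  \sum_(s : 'S_m) (-1) ^+ s * \prod_(i < n) A (s (o0 i)) (s (o1 i)) =
  \sum_(f : {ffun 'I_m -> 'I_m}) cell_det K f *: \prod_(i < n) A (f (o0 i)) (f (o1 i)).
Proof.
under [RHS]eq_bigr do rewrite cell_detE scaler_suml.
rewrite exchange_big /=; apply: eq_bigr => s _.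
rewrite (bigD1 [ffun x => s x]) //= [X in _ + X]big1 => [|f nf].
  rewrite [X in (_ * X) *: _]big1 ?mulr1 ?addr0 => [|x _]; last by rewrite ffunE eqxx.
  rewrite mulr_sign scaler_sign.
  by under [in RHS]eq_bigr do rewrite !ffunE.
have [x nx] : exists x, f x != s x.
  apply/existsP; apply: contraNT nf; rewrite negb_exists => /forallP e.
  by apply/eqP/ffunP => x; rewrite ffunE; apply/eqP; have := e x; rewrite negbK.
by rewrite (bigD1 x) //= (negPf nx) mul0r mulr0 scale0r.
Qed.

(** After expansion, the sum over permutations for fixed [f] is a determinant, which factors into
    det(g) and the sign tensor of [f]. *)
Lemma pfaffian_congr (g : 'M[K]_m) (A : 'M[E]_m) :
  pfaffian (map_mx (in_alg E) g^T *m A *m map_mx (in_alg E) g) = \det g *: pfaffian A.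
Proof.
rewrite /pfaffian scalerA mulrC -scalerA; congr (_ *: _).
set A' := _ *m _ *m _.
have A'E x y : A' x y = \sum_(q : ('I_m * 'I_m)%type) (g q.1 x * g q.2 y) *: A q.1 q.2.
  rewrite mxE -(pair_bigA _ (fun a b => (g a x * g b y) *: A a b)) /= exchange_big /=.
  apply: eq_bigr => b _; rewrite !mxE mulr_suml; apply: eq_bigr => a _.
  by rewrite !mxE /= mulr_algl -scalerAr mulr1 scalerA mulrC.
transitivity (\sum_(s : 'S_m) \sum_(f : {ffun 'I_m -> 'I_m})
  ((-1) ^+ s * \prod_x g (f x) (s x)) *: \prod_(i < n) A (f (o0 i)) (f (o1 i))).
  apply: eq_bigr => s _; under eq_bigr do rewrite A'E.
  rewrite bigA_distr_bigA /= mulr_sumr.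
  rewrite (reindex (fun f : {ffun 'I_m -> 'I_m} => [ffun i : 'I_n => (f (o0 i), f (o1 i))])) /=; last first.
    exists (fun p : {ffun 'I_n -> 'I_m * 'I_m} => [ffun x : 'I_m =>
       if odd x then (p (block x)).2 else (p (block x)).1]) => f _.
      apply/ffunP => x; rewrite !ffunE /= -[in RHS](in_blockK x) /in_block.
      by case: (odd x).
    apply/ffunP => i; rewrite !ffunE /=.
    have -> : block (o0 i) = i by exact: (block_in i false).
    have -> : block (o1 i) = i by exact: (block_in i true).
    by rewrite oddM /=; case: (f i).
  apply: eq_bigr => f _; under eq_bigr do rewrite ffunE /=.
  rewrite scaler_prod big_double mulr_sign -scalerA scaler_sign.
  by case: ifP.
rewrite exchange_big /= pfaffian_cell scaler_sumr; apply: eq_bigr => f _.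
rewrite -scaler_suml scalerA; congr (_ *: _).
rewrite mulrC /cell_det -det_mulmx; apply: eq_bigr => s _; congr (_ * _).
apply: eq_bigr => x _; rewrite mxE (bigD1 (f x)) //= mxE eqxx mul1r big1 ?addr0 // => k kf.
by rewrite mxE eq_sym (negPf kf) mul0r.
Qed.
End PfaffianCongruence.

(** * Forms on positive definite matrices *)

Section PositiveDefinite.
Variable R : realType.

Lemma posdef_cholesky m (X : 'M[R]_m) : posdef X ->
  exists2 g : 'M[R]_m, g \in unitmx & X = g^T *m g.
Proof.
elim: m X => [|m IH] X pX.
  by exists 1%:M; [exact: unitmx1|apply/matrixP => -[]].
move: X pX; change (forall X : 'M[R]_(1 + m), posdef X ->
  exists2 g : 'M[R]_(1 + m), g \in unitmx & X = g^T *m g) => X [sX pX].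
pose a := ulsubmx X 0 0; pose b := dlsubmx X; pose C := drsubmx X.
have ea : ulsubmx X = a%:M by rewrite [LHS]mx11_scalar.
have eb : ursubmx X = b^T by rewrite trmx_dlsub sX.
have eC : C^T = C by rewrite trmx_drsub sX.
have eX : X = block_mx a%:M b^T b C by rewrite -ea -eb submxK.
have quad (x : 'M[R]_1) (v : 'cV[R]_m) :
    (col_mx x v)^T *m X *m col_mx x v =
    x^T *m (a *: x) + x^T *m (b^T *m v) + (v^T *m b) *m x + v^T *m C *m v.
  rewrite eX tr_col_mx mul_row_block mul_row_col !mulmxDl mul_mx_scalar.
  rewrite -!scalemxAl -scalemxAr !mulmxA !addrA.
  by congr (_ + _); rewrite addrAC.
have a0 : 0 < a.
  have := pX (col_mx 1%:M 0); rewrite quad trmx1 trmx0 !(mul0mx, mulmx0, addr0) mul1mx.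
  rewrite !mxE eqxx mulr1; apply.
  by apply/eqP => /colP/(_ (lshift _ 0)); rewrite col_mxEu !mxE /= => /eqP; rewrite oner_eq0.
have ane : a != 0 by rewrite gt_eqF.
pose Y := C - a^-1 *: (b *m b^T).
have [sY pY] : posdef Y.
  split=> [|v v0].
    by rewrite /Y linearB linearZ /= trmx_mul trmxK eC.
  (* This first coordinate minimizes the quadratic form of X for fixed v; the minimum is the value
     at v of the Schur complement [Y]. *)
  have nz : col_mx (- a^-1 *: (b^T *m v)) v != 0.
    by apply: contraNneq v0 => /(congr1 dsubmx); rewrite col_mxKd linear0 => ->.
  have := pX _ nz; rewrite quad.
  have -> : v^T *m b = (b^T *m v)^T by rewrite trmx_mul trmxK.
  have -> : v^T *m Y *m v = v^T *m C *m v - a^-1 *: ((b^T *m v)^T *m (b^T *m v)).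
    rewrite /Y mulmxBr mulmxBl -scalemxAr -scalemxAl trmx_mul trmxK.
    by rewrite !mulmxA.
  set y := b^T *m v.
  have -> : (- a^-1 *: y)^T = - a^-1 *: y^T by rewrite linearZ.
  rewrite -!scalemxAl -!scalemxAr !scalerA -!scalerDl.
  have -> : - a^-1 * (a * - a^-1) + - a^-1 + - a^-1 = - a^-1 by field.
  by rewrite scaleNr addrC.
have [g' ug' eg'] := IH Y (conj sY pY).
pose r := Num.sqrt a.
have r2 : r * r = a by rewrite -expr2 sqr_sqrtr ?ltW.
have r0 : r != 0 by rewrite gt_eqF // sqrtr_gt0.
exists (block_mx r%:M (r^-1 *: b^T) 0 g').
  rewrite unitmxE det_ublock det_scalar1 unitrM unitfE r0 /=.
  by rewrite -unitmxE.
have ebr : (r^-1 *: b^T)^T = r^-1 *: b by apply/matrixP => i j; rewrite !mxE.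
rewrite tr_block_mx mulmx_block eX !trmx0 tr_scalar_mx ebr.
rewrite !(mul0mx, mulmx0, addr0) -scalar_mxM r2 mul_scalar_mx mul_mx_scalar.
rewrite !scalerA mulfV // !scale1r -eg' -scalemxAl -scalemxAr scalerA -invfM r2.
by rewrite /Y addrC subrK.
Qed.

Lemma posdef_unit m (X : 'M[R]_m) : posdef X -> X \in unitmx.
Proof. by case/posdef_cholesky => g ug ->; rewrite unitmx_mul unitmx_tr ug. Qed.

Lemma posdef_det m (X : 'M[R]_m) : posdef X -> 0 < \det X.
Proof.
case/posdef_cholesky => g ug ->; rewrite det_mulmx det_tr -expr2 exprn_even_gt0 //=.
by rewrite -unitfE -unitmxE.
Qed.

Lemma posdef1 m : posdef (1%:M : 'M[R]_m).
Proof.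
split=> [|v v0]; first exact: trmx1.
rewrite mulmx1 mxE; have [i vi] : exists i, v i 0 != 0.
  apply/existsP; apply: contraNT v0; rewrite negb_exists => /forallP h.
  by apply/eqP/matrixP => i j; rewrite ord1 !mxE; apply/eqP; have := h i; rewrite negbK.
rewrite (bigD1 i) //= ltr_pwDl //.
  by rewrite mxE -expr2 exprn_even_gt0.
by apply: sumr_ge0 => j _; rewrite mxE -expr2 sqr_ge0.
Qed.

End PositiveDefinite.

(** An odd power of D carries the sign of D, which cancels the orientation character and leaves |D|.
    It serves for the Jacobian, the power 2n+1 of det(g). *)
Lemma mul_odd_pow_sign (F : realFieldType) k (D t t1 : F) : D != 0 ->
  t * D ^+ (2 * k).+1 = D / `|D| * t1 -> t = t1 * (`|D| ^+ (2 * k).+1)^-1.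
Proof.
move=> D0; rewrite !exprS !exprM -normrX (ger0_norm (sqr_ge0 D)).
have : (D ^+ 2) ^+ k != 0 by rewrite !expf_neq0.
move: ((D ^+ 2) ^+ k) => Q Q0 e.
have nD0 : `|D| != 0 by rewrite normr_eq0.
have DQ0 : D * Q != 0 by rewrite mulf_neq0.
apply: (mulIf DQ0); rewrite e; field.
by rewrite ?nD0 ?Q0.
Qed.

Section FormsOnPositiveDefinite.
Variables (R : realType) (n : nat).
Local Notation m := (2 * n)%N.
Local Notation I := (sym_index m).
Local Notation E := (exterior R I).
Implicit Types (X g : 'M[R]_m) (w : Omega_nc n).

Lemma beta_formE k X : beta_form k X = beta X k.
Proof. by []. Qed.

Lemma phi_formE X : phi_form X = (Num.sqrt (\det X))^-1 *: pfaffian (curv X).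
Proof. by []. Qed.

Lemma homog_pfaffian_curv X : homog m (pfaffian (curv X)).
Proof.
apply: homogZ; apply: homog_sum => s _.
have e : (\sum_(i < n) 2 = m)%N by rewrite sum_nat_const card_ord mulnC.
have h : homog (\sum_(i < n) 2)%N (\prod_(i < n) (curv X) (s (Ordinal (lt_double_ord i)))
    (s (Ordinal (lt_doubleS_ord i)))).
  by apply: homog_prod => i _; exact: homog_curv.
rewrite e in h; rewrite mulr_sign; case: ifP => // _; exact: homogN.
Qed.

Lemma homog_phi X : homog m (phi_form X).
Proof. by apply: homogZ; exact: homog_pfaffian_curv. Qed.

Section Contraction.
Variable X : 'M[R]_m.
Hypothesis pX : posdef X.
Local Notation ip := (interior_product (coordinate X)).

Lemma ip_phi : ip (phi_form X) = 0.
Proof.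
have [sX _] := pX; have uX := posdef_unit pX.
rewrite phi_formE linearZ /= /pfaffian linearZ /= linear_sum /= big1 ?scaler0 // => s _.
rewrite mulr_sign; set u := \prod_(i < n) _.
suff u0 : ip u = 0 by case: ifP; rewrite ?linearN /= u0 ?oppr0.
rewrite -[u]mulr1; apply: (@ip_prod0 R m X _ _ _ _ (fun=> 2%N)).
- by move=> i _; exact: homog_curv.
- move=> i _; have /matrixP h := ip_curv sX uX.
  by have := h (s (Ordinal (lt_double_ord i))) (s (Ordinal (lt_doubleS_ord i))); rewrite !mxE.
- exact: interior_product1.
Qed.

Lemma ip_betaS k : (0 < k)%N -> ip (beta X k) = 0.
Proof.
have [sX _] := pX; have uX := posdef_unit pX.
by case: k => // k _; rewrite (ip_beta sX uX).
Qed.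

Lemma ip_wedge_phi w : ip (wedge_phi w X) = 0.
Proof.
rewrite /wedge_phi /eval_nc mulr_suml linear_sum big1 // => A _.
rewrite -scalerAl linearZ /= (@ip_prod0 R m X _ _ _ _ (fun i : 'I_(n - 2) => (4 * i.+1 + 1)%N)) ?scaler0 //.
- by move=> i _; exact: homog_beta.
- by move=> i _; exact: ip_betaS.
- exact: ip_phi.
Qed.
End Contraction.

Lemma subst_pfaffian g (A : 'M[E]_m) :
  subst g (pfaffian A) = pfaffian (map_mx (subst g) A).
Proof.
rewrite /pfaffian linearZ /=; congr (_ *: _); rewrite linear_sum; apply: eq_bigr => s _.
rewrite rmorphM rmorph_sign rmorph_prod; congr (_ * _).
by apply: eq_bigr => i _; rewrite mxE.
Qed.

Lemma substZ g (c : R) (u : E) : subst g (c *: u) = c *: subst g u.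
Proof. exact: linearZ. Qed.

Lemma subst_phi X g : posdef X -> g \in unitmx ->
  subst g (phi_form (g^T *m X *m g)) = orientation_char g *: phi_form X.
Proof.
move=> pX ug; have uX := posdef_unit pX.
rewrite (phi_formE (g^T *m X *m g)) (phi_formE X) substZ.
rewrite subst_pfaffian (curv_congr ug uX).
have -> : pfaffian (cmx g^T *m curv X *m cmx g) = \det g *: pfaffian (curv X).
  exact: (pfaffian_congr g (curv X)).
move: (pfaffian (curv X)) => P; rewrite !scalerA; congr (_ *: _).
have -> : \det (g^T *m X *m g) = \det g ^+ 2 * \det X.
  by rewrite !det_mulmx det_tr; ring.
rewrite sqrtrM ?sqr_ge0 // sqrtr_sqr invfM /orientation_char.
by rewrite mulrAC [X in X * _ = _]mulrC.
Qed.

Lemma pullback_glE g (a : Defs.form R m) X :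
  pullback_gl g a X = subst g (a (g^T *m X *m g)).
Proof. by []. Qed.

Lemma wedge_phi_gl w g X : posdef X -> g \in unitmx ->
  pullback_gl g (wedge_phi w) X = orientation_char g *: wedge_phi w X.
Proof.
move=> pX ug; have uX := posdef_unit pX.
rewrite pullback_glE /wedge_phi rmorphM /= subst_phi // -scalerAr; congr (_ *: (_ * _)).
rewrite /eval_nc linear_sum; apply: eq_bigr => A _.
rewrite linearZ /= rmorph_prod; congr (_ *: _); apply: eq_bigr => i _.
exact: subst_beta.
Qed.

(** Scaling by r is the congruence by the scalar matrix with entry sqrt(r), so scale invariance is a
    case of equivariance. *)
Lemma pullback_scaleE (r : R) (a : Defs.form R m) X : 0 < r ->
  pullback_scale r a X = pullback_gl (Num.sqrt r)%:M a X.
Proof.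
move=> r0; have rr : Num.sqrt r * Num.sqrt r = r by rewrite -expr2 sqr_sqrtr ?ltW.
rewrite /pullback_scale /pullback_gl /pullback.
have -> : (Num.sqrt r)%:M^T *m X *m (Num.sqrt r)%:M = r *: X.
  by rewrite tr_scalar_mx mul_scalar_mx mul_mx_scalar scalerA rr.
have -> // : const_covec r%:M *m dX R m =
   const_covec (Num.sqrt r)%:M^T *m dX R m *m const_covec (Num.sqrt r)%:M.
have cm (x : R) (M : 'M[E]_m) : const_covec x%:M *m M = x%:A *: M.
  by rewrite /const_covec map_scalar_mx mul_scalar_mx.
have mc (x : R) (M : 'M[E]_m) : M *m const_covec x%:M = x%:A *: M.
  apply/matrixP => i j; rewrite !mxE (bigD1 j) //= big1 => [|k kj].
    by rewrite !mxE eqxx mulr1n addr0 /= mulr_algl mulr_algr.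
  by rewrite !mxE (negPf kj) mulr0n /= scale0r mulr0.
by rewrite tr_scalar_mx cm mc cm scalerA mulr_algl scalerA rr.
Qed.

Lemma wedge_phi_scale w r X : 0 < r -> posdef X ->
  pullback_scale r (wedge_phi w) X = wedge_phi w X.
Proof.
move=> r0 pX; rewrite pullback_scaleE // wedge_phi_gl //; last first.
  by rewrite unitmxE det_scalar unitfE expf_neq0 // gt_eqF // sqrtr_gt0.
rewrite /orientation_char det_scalar gtr0_norm ?exprn_gt0 ?sqrtr_gt0 //.
by rewrite divff ?scale1r // gt_eqF // exprn_gt0 // sqrtr_gt0.
Qed.

Definition wedge_all X : E := (\prod_(1 <= k < n) beta_form k X) * phi_form X.

Lemma ip_wedge_all X : posdef X -> interior_product (coordinate X) (wedge_all X) = 0.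
Proof.
move=> pX; rewrite /wedge_all big_nat; apply: (@ip_prod0 R m X _ _ _ _ (fun k => (4 * k + 1)%N)).
- by move=> k _; exact: homog_beta.
- by move=> k /andP[k0 _]; exact: ip_betaS.
- exact: ip_phi.
Qed.

Lemma subst_wedge_all X g : posdef X -> g \in unitmx ->
  subst g (wedge_all (g^T *m X *m g)) = orientation_char g *: wedge_all X.
Proof.
move=> pX ug; have uX := posdef_unit pX.
rewrite /wedge_all rmorphM /= subst_phi // -scalerAr; congr (_ *: (_ * _)).
by rewrite rmorph_prod; apply: eq_bigr => k _; exact: subst_beta.
Qed.

Hypothesis n0 : (0 < n)%N.

Lemma beta1 k : beta (1%:M : 'M[R]_m) k = alpha R n k.
Proof. by rewrite /beta /mc invmx1 cmx1 mul1mx. Qed.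

Lemma phi1 : phi_form (1%:M : 'M[R]_m) = pf R n.
Proof. by rewrite phi_formE det1 sqrtr1 invr1 scale1r /curv invmx1 cmx1 mulmx1. Qed.

Definition top X : E := beta X 0 * wedge_all X.

Lemma top1_neq0 : top 1%:M [set: I] != 0.
Proof.
have e : \prod_(k < n) alpha R n k = alpha R n 0 * \prod_(1 <= k < n) alpha R n k.
  by rewrite -(big_mkord (fun=> true) (fun k => alpha R n k)) big_ltn //.
have -> : top 1%:M = (\prod_(k < n) alpha R n k) * pf R n.
  rewrite e -[RHS]mulrA /top beta1; congr (_ * _).
  rewrite /wedge_all; apply: congr2; last exact: phi1.
  by apply: eq_bigr => k _; exact: beta1.
exact: alpha_pf_top.
Qed.

Lemma homog_top_form X : homog #|{: I}| (top X).
Proof.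
rewrite -(alpha_degrees n0) -(big_mkord (fun=> true) (fun k => 4 * k + 1)%N) big_ltn //.
rewrite -addnA; apply: homogM; first exact: homog_beta.
apply: homogM; last exact: homog_phi.
by apply: homog_prod => k _; exact: homog_beta.
Qed.

Lemma top_form_vol X : top X = top X [set: I] *: vol R m.
Proof. exact/homog_top/homog_top_form. Qed.

Lemma ip_top X : posdef X ->
  interior_product (coordinate X) (top X) = m%:R *: wedge_all X.
Proof.
move=> pX; have [sX _] := pX; have uX := posdef_unit pX.
rewrite /top (interior_productM _ _ (@homog_beta _ _ X 0)) (ip_beta sX uX).
by rewrite ip_wedge_all // mulr0 scaler0 addr0 -scaler_nat mulr_algl.
Qed.

(** Pulling back along g compares the form at g^T g with the one at 1: the volume element
    contributes the Jacobian, the form its orientation character. *)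
Lemma top_coef_congr g : g \in unitmx ->
  top (g^T *m g) [set: I] = top 1%:M [set: I] * (`|\det g| ^+ m.+1)^-1.
Proof.
move=> ug; have p1 := @posdef1 R m; have u1 := posdef_unit p1.
have e : subst g (top (g^T *m g)) = orientation_char g *: top 1%:M.
  rewrite -[X in X *m g]mulmx1 /top rmorphM /= subst_wedge_all // -scalerAr.
  by congr (_ *: (_ * _)); exact: subst_beta.
move: e; rewrite {1}[top (g^T *m g)]top_form_vol substZ subst_vol jacE.
move/(congr1 (fun u : E => u [set: I])); rewrite scalerA (extZ _ (vol R m)) vol_top mulr1.
rewrite extZ => e.
have d0 : \det g != 0 by rewrite -unitfE -unitmxE.
exact: mul_odd_pow_sign d0 e.
Qed.

End FormsOnPositiveDefinite.

(** * The volume element in lexicographic order *)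

Section EtaForm.
Variables (R : realType) (m : nat).
Local Notation I := (sym_index m).
Local Notation E := (exterior R I).

Definition upper_entries : seq I :=
  [seq sym_index_of i j | i : 'I_m <- index_enum 'I_m,
     j : 'I_m <- [seq j : 'I_m <- index_enum 'I_m | (i <= j)%N]].

Lemma big_upper (T : Type) (idx : T) (op : Monoid.law idx) (F : I -> T) :
  \big[op/idx]_(i < m) \big[op/idx]_(j < m | (i <= j)%N) F (sym_index_of i j) =
  \big[op/idx]_(e <- upper_entries) F e.
Proof.
rewrite /upper_entries big_allpairs_dep; apply: eq_bigr => i _.
by rewrite big_filter.
Qed.

Lemma upper_perm : perm_eq upper_entries (index_enum I).
Proof.
apply/seq.permP => p; rewrite -!sum1_count !(big_mkcond p) /=.
rewrite -(big_upper _ (fun e => if p e then 1%N else 0%N)) pair_big_dep /=.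
rewrite (reindex_onto (fun e : I => val e) (fun q => sym_index_of q.1 q.2)) /=.
  apply: eq_big => [e|e _]; last by rewrite sym_index_of_val.
  by rewrite sym_index_of_val eqxx andbT (valP e).
by move=> [i j] /= le; rewrite /sort_pair le.
Qed.

(** The lexicographic order and that of [index_enum] are compared by an undetermined sign, which is
    absorbed into the constant. *)
Lemma eta_vol : exists s : nat,
  \prod_(i < m) \prod_(j < m | (i <= j)%N) dX R m i j = (-1) ^+ s *: vol R m.
Proof.
have [s hs] := homog_prod_perm R I (fun=> 1%N) upper_perm.
exists s; rewrite -prod_all_gen -(hs (fun e => ext_gen R e)); last first.
  by move=> e; exact: homog_gen.
rewrite -big_upper; apply: eq_bigr => i _; apply: eq_bigr => j _.
by rewrite mxE.
Qed.
End EtaForm.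

(** * The identity and its constant *)

Section MainIdentity.
Variables (R : realType) (n : nat).
Hypothesis n0 : (0 < n)%N.
Local Notation m := (2 * n)%N.
Local Notation I := (sym_index m).
Local Notation E := (exterior R I).
Implicit Types (X g : 'M[R]_m).
Local Notation ip X := (interior_product (coordinate X)).

(** The constant relative to [vol]. The divisor m is the contraction of the beta of degree 1, so
    integrality is not visible from this formula. *)
Definition kappa : R := (m%:R)^-1 * top (1%:M : 'M[R]_m) [set: I].

Lemma kappa_neq0 : kappa != 0.
Proof.
rewrite mulf_neq0 ?top1_neq0 // invr_eq0 pnatr_eq0 -lt0n muln_gt0.
by rewrite n0.
Qed.

Lemma wedge_all_vol g : g \in unitmx -> posdef (g^T *m g) ->
  wedge_all (g^T *m g) = (kappa * (`|\det g| ^+ m.+1)^-1) *: ip (g^T *m g) (vol R m).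
Proof.
move=> ug pX; have m0 : m%:R != 0 :> R by rewrite pnatr_eq0 -lt0n muln_gt0.
apply: (scalerI m0); rewrite -(ip_top pX) (top_form_vol n0) linearZ /=.
by rewrite (top_coef_congr n0 ug) scalerA /kappa !mulrA mulfV // mul1r.
Qed.

Lemma integral_wedge_all1 : integral (wedge_all (1%:M : 'M[R]_m)).
Proof.
have iS : integral_mx (symgen R m) by move=> i j; rewrite mxE; exact: integral_gen.
rewrite /wedge_all; apply: integralM.
  apply: integral_prod => k _; rewrite beta_formE beta1.
  by apply: integral_trace; apply: integral_expmx.
rewrite phi1; apply: integral_pfaffian => //; first exact: homog_symgen.
exact: symgen_tr.
Qed.

(* The coordinate of iota_1 vol at the complement of (0, 0) is a sign. *)
Lemma kappa_int : exists z : int, kappa = z%:~R.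
Proof.
have m0 : (0 < m)%N by rewrite muln_gt0.
pose i0 := Ordinal m0; pose e0 := sym_index_of i0 i0.
have e : ip 1%:M (vol R m) [set~ e0] = (-1) ^+ inversions [set e0] [set~ e0].
  rewrite ffunE (bigD1 e0) /= ?inE ?eqxx // big1 ?addr0 => [|a]; last first.
    by rewrite !inE negbK => /andP[/eqP-> ]; rewrite eqxx.
  have -> : coordinate (1%:M : 'M[R]_m) e0 = 1.
    rewrite /coordinate /= /sort_pair.
    by rewrite mxE eqxx.
  by rewrite setUCr vol_top !mulr1.
have [z ez] := integral_wedge_all1 [set~ e0].
exists ((-1) ^+ inversions [set e0] [set~ e0] * z).
have := @wedge_all_vol 1%:M (unitmx1 _ _); rewrite trmx1 mul1mx => /(_ (@posdef1 R m)).
rewrite det1 normr1 expr1n invr1 mulr1 => /(congr1 (fun u : E => u [set~ e0])).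
rewrite (extZ kappa) e ez => ek.
rewrite rmorphM rmorphXn rmorphN1 /= ek mulrC -mulrA -expr2 sqrr_sign mulr1.
by [].
Qed.
End MainIdentity.

(** * Injectivity *)

Section Injectivity.
Variables (R : realType) (n : nat).
Hypothesis n0 : (0 < n)%N.
Local Notation m := (2 * n)%N.
Local Notation I := (sym_index m).
Local Notation E := (exterior R I).

(** The generators stop one short of the full product. The missing last beta is multiplied on and
    moved past phi, which has even degree. For n = 1 the truncated n - 2 is 0 and both products are
    empty. *)
Lemma beta_nc_phi_neq0 :
  (\prod_(i < n - 2) beta (1%:M : 'M[R]_m) i.+1) * phi_form (1%:M : 'M[R]_m) != 0.
Proof.
apply: contraNneq (top1_neq0 R n0) => e0.
suff e : wedge_all (1%:M : 'M[R]_m) = 0 by rewrite /top e mulr0 ffunE.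
rewrite /wedge_all; case: n n0 e0 => [|[|k]] // _.
  by rewrite big_ord0 mul1r big_geq // mul1r.
move=> e0; rewrite big_nat_recr //= -mulrA.
have -> : beta_form k.+1 1%:M * phi_form 1%:M = phi_form 1%:M * beta_form k.+1 (1%:M : 'M[R]_(2 * k.+2)).
  rewrite (@homog_evenC R _ (2 * k.+2)%N (phi_form 1%:M) (beta_form k.+1 1%:M) _ (homog_phi _)) // oddM //.
rewrite mulrA big_add1 /= big_mkord.
have -> : \prod_(i < k) beta_form i.+1 (1%:M : 'M[R]_(2 * k.+2)) * phi_form 1%:M = 0.
  by rewrite -[RHS]e0 subn2.
exact: mul0r.
Qed.

Lemma eval_nc_hom (w : Omega_nc n) (X : 'M[R]_m) :
  eval_nc w X = ext_hom (fun i : 'I_(n - 2) => beta X i.+1)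
    ([ffun A => ratr (w A)] : exterior R 'I_(n - 2)).
Proof. by apply: eq_bigr => A _; rewrite ffunE. Qed.

(* Restricting to the single point X = 1 is enough. *)
Lemma wedge_phi_inj (w1 w2 : Omega_nc n) :
  wedge_phi w1 (1%:M : 'M[R]_m) = wedge_phi w2 1%:M -> w1 = w2.
Proof.
rewrite /wedge_phi !eval_nc_hom => /eqP; rewrite -subr_eq0 -mulrBl -linearB /=.
move/eqP/(ext_mul_eq0 (fun i j : 'I_(n - 2) => betaC _ i.+1 j.+1) (fun i => beta_sqr _ i.+1) beta_nc_phi_neq0).
move=> /ffunP h; apply/ffunP => A; have := h A; rewrite !ffunE => /eqP.
by rewrite subr_eq0 => /eqP/fmorph_inj.
Qed.
End Injectivity.

From mathcomp Require Import all_classical all_reals all_analysis.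
Import numFieldNormedType.Exports.

Local Open Scope classical_set_scope.

(** * Smoothness *)

Section NearEq.
Variables (R : realType) (V : normedModType R).
Implicit Types (f g : V -> R) (x v : V).

(** The coordinates of the forms have a good formula only where the determinant is positive, so
    continuity and derivatives are transferred between functions that agree near a point. *)
Lemma near_eq_quotient f g x v : (\forall y \near x, f y = g y) ->
  \forall h \near 0^', h^-1 *: ((f \o shift x) (h *: v) - f x) =
                       h^-1 *: ((g \o shift x) (h *: v) - g x).
Proof.
move=> fg; have fgx : f x = g x by exact: nbhs_singleton fg.
have c : (fun h : R => h *: v + x) @ 0^' --> x.
  apply: cvg_within_filter.
  have : (fun h : R => h *: v + x) @ 0 --> (0 : R) *: v + x.
    by apply: cvgD; [exact: cvgZr_tmp (@cvg_id _ _)|exact: cvg_cst].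
  by rewrite scale0r add0r.
near=> h; have /= -> : f (h *: v + x) = g (h *: v + x) by near: h; exact: c _ fg.
by rewrite fgx.
Unshelve. all: by end_near. Qed.

Lemma near_eq_continuous f g x : (\forall y \near x, f y = g y) ->
  {for x, continuous f} -> {for x, continuous g}.
Proof.
move=> fg; have fgx : f x = g x := nbhs_singleton fg.
rewrite /prop_for /continuous_at -fgx; apply: cvg_trans.
by apply: near_eq_cvg; exact: fg.
Qed.

Lemma near_eq_derivable f g x v : (\forall y \near x, f y = g y) ->
  derivable f x v -> derivable g x v.
Proof.
move=> fg /cvg_ex[l fl]; apply/cvg_ex; exists l; apply: cvg_trans fl.
by apply: near_eq_cvg; exact: near_eq_quotient.
Qed.

Lemma near_eq_derive f g x v : (\forall y \near x, f y = g y) ->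
  'D_v f x = 'D_v g x.
Proof.
move=> fg; rewrite /derive; congr (lim _).
have gf : \forall y \near x, g y = f y by apply: filterS fg => y ->.
apply/seteqP; split; first by apply: near_eq_cvg; exact: near_eq_quotient.
by apply: near_eq_cvg; exact: near_eq_quotient.
Qed.

End NearEq.

Section SmoothFunctions.
Variables (R : realType) (m : nat).
Local Notation M := 'M[R]_m.
Implicit Types (f g : M -> R) (X V : M).

Definition rsd X : R := (Num.sqrt (\det X))^-1.

(** [G] holds the generators beyond constants and coordinates: none for the determinant, and
    det(X)^(-1/2) for the forms. *)
Inductive ring_closure (G : set (M -> R)) : (M -> R) -> Prop :=
| closure_gen f of G f : ring_closure G f
| closure_cst c : ring_closure G (fun=> c)
| closure_coord i j : ring_closure G (fun X => X i j)
| closure_add f g of ring_closure G f & ring_closure G g :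
    ring_closure G (fun X => f X + g X)
| closure_mul f g of ring_closure G f & ring_closure G g :
    ring_closure G (fun X => f X * g X).

Lemma closure_sum G (T : Type) (r : seq T) (P : pred T) (F : T -> M -> R) :
  (forall i, ring_closure G (F i)) ->
  ring_closure G (fun X => \sum_(i <- r | P i) F i X).
Proof.
move=> GF; elim: r => [|a r IH].
  by under eq_fun => X do rewrite big_nil; exact: closure_cst.
case Pa: (P a); under eq_fun => X do rewrite big_cons Pa; last exact: IH.
exact: closure_add.
Qed.

Lemma closure_prod G (T : Type) (r : seq T) (P : pred T) (F : T -> M -> R) :
  (forall i, ring_closure G (F i)) ->
  ring_closure G (fun X => \prod_(i <- r | P i) F i X).
Proof.
move=> GF; elim: r => [|a r IH].
  by under eq_fun => X do rewrite big_nil; exact: closure_cst.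
case Pa: (P a); under eq_fun => X do rewrite big_cons Pa; last exact: IH.
exact: closure_mul.
Qed.

Lemma closure_sub G H f : G `<=` H -> ring_closure G f -> ring_closure H f.
Proof.
move=> GH; elim=> {f} [f Gf|c|i j|f g _ Hf _ Hg|f g _ Hf _ Hg].
- by apply: closure_gen; exact: GH.
- exact: closure_cst.
- exact: closure_coord.
- exact: closure_add.
- exact: closure_mul.
Qed.

Lemma closure_det_mx G k (A : M -> 'M[R]_k) :
  (forall i j, ring_closure G (fun X => A X i j)) ->
  ring_closure G (fun X => \det (A X)).
Proof.
move=> GA; apply: closure_sum => s; apply: closure_mul; first exact: closure_cst.
by apply: closure_prod => i; exact: GA.
Qed.

Lemma derive_coord i j X V : 'D_V (fun Y : M => Y i j) X = V i j.
Proof.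
apply: cvg_lim => //; apply: (@cvg_trans _ ((fun=> V i j) @ 0^')); last exact: cvg_cst.
apply: near_eq_cvg; near=> h.
have h0 : h != 0 by near: h; exact: nbhs_dnbhs_neq.
by rewrite /= !mxE addrK [_ *: _]mulrA mulVf // mul1r.
Unshelve. all: by end_near. Qed.

(* The set [0 < \det X] contains the positive definite matrices and, unlike them,
   is open among all matrices. *)
Definition stably_differentiable (P : set (M -> R)) f :=
  (forall X, 0 < \det X -> differentiable f X) /\
  forall V, exists2 f', P f' & forall X, 0 < \det X -> 'D_V f X = f' X.

Lemma closure_differentiable (G : set (M -> R)) :
  (forall f, G f -> stably_differentiable (ring_closure G) f) ->
  forall f, ring_closure G f -> stably_differentiable (ring_closure G) f.
Proof.
move=> GD f; elim=> {f} [f /GD //|c|i j|f g Gf [df Df] Gg [dg Dg]|f g Gf [df Df] Gg [dg Dg]].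
- split=> [X _|V]; first exact: differentiable_cst.
  exists (fun=> 0); first exact: closure_cst.
  by move=> X _; exact: derive_cst.
- split=> [X _|V]; first exact: differentiable_coord.
  exists (fun=> V i j); first exact: closure_cst.
  by move=> X _; exact: derive_coord.
- split=> [X pX|V]; first by apply: differentiableD; [exact: df|exact: dg].
  have [f' Gf' ef] := Df V; have [g' Gg' eg] := Dg V.
  exists (fun X => f' X + g' X); first exact: closure_add.
  move=> X pX; rewrite -ef // -eg //; apply: deriveD; apply: diff_derivable; [exact: df|exact: dg].
- split=> [X pX|V]; first by apply: differentiableM; [exact: df|exact: dg].
  have [f' Gf' ef] := Df V; have [g' Gg' eg] := Dg V.
  exists (fun X => f X * g' X + g X * f' X).
    by apply: closure_add; exact: closure_mul.
  move=> X pX; rewrite -ef // -eg //; apply: deriveM; apply: diff_derivable; [exact: df|exact: dg].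
Qed.

Lemma closure_det G : ring_closure G (fun X => \det X).
Proof. by apply: closure_det_mx => i j; exact: closure_coord. Qed.

Lemma det_differentiable : stably_differentiable (ring_closure set0) (fun X => \det X).
Proof. by apply: closure_differentiable => //; exact: closure_det. Qed.

Local Notation sm := (ring_closure [set rsd]).

Lemma rsd_differentiable : stably_differentiable sm rsd.
Proof.
have [dd Dd] := det_differentiable.
have ds1 X : 0 < \det X -> differentiable (Num.sqrt : R -> R) (\det X).
  by move=> pX; apply/derivable1_diffP; exact: (@ex_derive _ _ _ _ _ _ _ (is_derive1_sqrt pX)).
have ds X : 0 < \det X -> differentiable (fun Y : M => Num.sqrt (\det Y)) X.
  move=> pX; apply: (@differentiable_comp _ _ _ _ (fun Y : M => \det Y) Num.sqrt); first exact: dd.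
  exact: ds1.
have s0 X : 0 < \det X -> Num.sqrt (\det X) != 0 by move=> pX; rewrite gt_eqF // sqrtr_gt0.
split=> [X pX|V].
  by apply: differentiableV; [exact: ds|exact: s0].
have [d' sd' ed] := Dd V.
(* The derivative of det^(-1/2) is -1/2 det^(-3/2) times that of det, and det^(-3/2) is the cube of
   [rsd]. *)
exists (fun X => (- 2^-1) * (rsd X * (rsd X * (rsd X * d' X)))).
  apply: closure_mul; first exact: closure_cst.
  do 3![apply: closure_mul; first by apply: closure_gen].
  exact: closure_sub sd'.
move=> X pX.
have dsX : derivable (fun Y : M => Num.sqrt (\det Y)) X V by apply: diff_derivable; exact: ds.
rewrite /rsd (deriveV (f := fun Y : M => Num.sqrt (\det Y)) (s0 X pX) dsX) -ed //.
have -> : 'D_V (fun Y : M => Num.sqrt (\det Y)) X = (2 * Num.sqrt (\det X))^-1 * 'D_V (fun Y : M => \det Y) X.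
  have dq := ds1 X pX.
  rewrite (deriveE _ (ds X pX)) (diff_comp (dd X pX) dq) /= (deriveE _ (dd X pX)).
  rewrite deriv1E; [rewrite derive1E derive_sqrt //; exact: mulrC|exact: (derivable1_diffP _ _).2 dq].
move: ('D_V _ X) => d; have -> : forall a b : R, a *: b = a * b by [].
by field; exact: s0.
Qed.

Lemma near_det_gt0 X : 0 < \det X -> \forall Y \near X, 0 < \det Y.
Proof.
move=> pX; have [dd _] := det_differentiable.
exact: cvgr_gt (differentiable_continuous (dd X pX)) _ pX.
Qed.

(** Agreement is asked only where det(X) > 0: [invmx] is the adjugate times [rsd] squared there, but
    elsewhere [invmx] and [Num.sqrt] may take default values. *)
Definition tame (f : M -> R) :=
  exists2 g, sm g & forall X, 0 < \det X -> f X = g X.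

(** Directional derivatives of a tame function are tame again, so the induction on k closes. *)
Lemma tame_Ck k f : tame f -> Ck k f.
Proof.
have GD h : [set rsd] h -> stably_differentiable sm h.
  by move=> ->; exact: rsd_differentiable.
elim: k f => [|k IH] f [g sg fg]; have [dg Dg] := closure_differentiable GD sg.
all: have gf X : 0 < \det X -> \forall Y \near X, g Y = f Y.
1,3: by move=> /near_det_gt0; apply: filterS => Y /fg ->.
all: split=> //; first (apply: continuous_in_subspaceT => X; rewrite inE => /posdef_det pX).
1,2: exact: near_eq_continuous (gf X pX) (differentiable_continuous (dg X pX)).
move=> V _; split=> [X /posdef_det pX|].
  by apply: near_eq_derivable (gf X pX) _; apply: diff_derivable; exact: dg.
have [g' sg' eg'] := Dg V; apply: IH; exists g' => // X pX.
by rewrite -eg' //; apply/esym; apply: near_eq_derive; exact: gf.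
Qed.

Lemma tame_cst c : tame (fun=> c).
Proof. by exists (fun=> c) => //; exact: closure_cst. Qed.

Lemma tame_add f g : tame f -> tame g -> tame (fun X => f X + g X).
Proof.
move=> [f' sf ef] [g' sg eg]; exists (fun X => f' X + g' X); first exact: closure_add.
by move=> X pX; rewrite ef // eg.
Qed.

Lemma tame_mul f g : tame f -> tame g -> tame (fun X => f X * g X).
Proof.
move=> [f' sf ef] [g' sg eg]; exists (fun X => f' X * g' X); first exact: closure_mul.
by move=> X pX; rewrite ef // eg.
Qed.

Lemma tame_sum (T : Type) (r : seq T) (P : pred T) (F : T -> M -> R) :
  (forall i, tame (F i)) -> tame (fun X => \sum_(i <- r | P i) F i X).
Proof.
move=> GF; elim: r => [|a r IH].
  by under eq_fun => X do rewrite big_nil; exact: tame_cst.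
case Pa: (P a); under eq_fun => X do rewrite big_cons Pa; last exact: IH.
exact: tame_add.
Qed.

Lemma tame_rsd : tame rsd.
Proof. by exists rsd => //; exact: closure_gen. Qed.

Lemma tame_invmx i j : tame (fun X => invmx X i j).
Proof.
exists (fun X => rsd X * rsd X * cofactor X j i).
  do 2![apply: closure_mul]; try exact: closure_gen.
    exact: closure_cst.
  apply: closure_det_mx => k l; under eq_fun => X do rewrite !mxE.
  exact: closure_coord.
move=> X pX; have uX : X \in unitmx by rewrite unitmxE unitfE gt_eqF.
by rewrite /invmx uX !mxE /rsd -invfM -expr2 sqr_sqrtr // ltW.
Qed.

Local Notation E := (covectors R m).
Definition tame_form (F : M -> E) := forall A, tame (fun X => F X A).

Lemma tame_form_cst u : tame_form (fun=> u).
Proof. by move=> A; exact: tame_cst. Qed.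

Lemma tame_form_add F G : tame_form F -> tame_form G -> tame_form (fun X => F X + G X).
Proof.
move=> tF tG A; under eq_fun => X do rewrite ffunE; exact: tame_add.
Qed.

Lemma tame_form_mul F G : tame_form F -> tame_form G -> tame_form (fun X => F X * G X).
Proof.
move=> tF tG A; under eq_fun => X do rewrite ffunE.
by apply: tame_sum => B; apply: tame_mul => //; apply: tame_mul => //; exact: tame_cst.
Qed.

Lemma tame_form_scale f F : tame f -> tame_form F -> tame_form (fun X => f X *: F X).
Proof.
move=> tf tF A; under eq_fun => X do rewrite ffunE; exact: tame_mul.
Qed.

Lemma tame_form_sum (T : Type) (r : seq T) (P : pred T) (F : T -> M -> E) :
  (forall i, tame_form (F i)) -> tame_form (fun X => \sum_(i <- r | P i) F i X).
Proof.
move=> GF; elim: r => [|a r IH].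
  by under eq_fun => X do rewrite big_nil; exact: tame_form_cst.
case Pa: (P a); under eq_fun => X do rewrite big_cons Pa; last exact: IH.
exact: tame_form_add.
Qed.

Lemma tame_form_prod (T : Type) (r : seq T) (P : pred T) (F : T -> M -> E) :
  (forall i, tame_form (F i)) -> tame_form (fun X => \prod_(i <- r | P i) F i X).
Proof.
move=> GF; elim: r => [|a r IH].
  by under eq_fun => X do rewrite big_nil; exact: tame_form_cst.
case Pa: (P a); under eq_fun => X do rewrite big_cons Pa; last exact: IH.
exact: tame_form_mul.
Qed.

Definition tame_mx (A : M -> 'M[E]_m) := forall i j, tame_form (fun X => A X i j).

Lemma tame_mx_mul A B : tame_mx A -> tame_mx B -> tame_mx (fun X => A X *m B X).
Proof.
move=> tA tB i j; under eq_fun => X do rewrite mxE.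
by apply: tame_form_sum => k; apply: tame_form_mul.
Qed.

Lemma tame_mx_cst B : tame_mx (fun=> B).
Proof. by move=> i j; exact: tame_form_cst. Qed.

Lemma tame_mx_exp A k : tame_mx A -> tame_mx (fun X => A X ^+ k).
Proof.
move=> tA; elim: k => [|k IH]; first exact: tame_mx_cst.
by under eq_fun => X do rewrite exprS; exact: tame_mx_mul.
Qed.

Lemma tame_const_invmx : tame_mx (fun X => const_covec (invmx X)).
Proof.
move=> i j; under eq_fun => X do rewrite mxE.
by apply: tame_form_scale; [exact: tame_invmx|exact: tame_form_cst].
Qed.

Lemma tame_beta k : tame_form (beta_form k).
Proof.
apply: tame_form_sum => i.
apply: (@tame_mx_exp (fun X => const_covec (invmx X) *m dX R m)).
by apply: tame_mx_mul; [exact: tame_const_invmx|exact: tame_mx_cst].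
Qed.
End SmoothFunctions.

Section SmoothForms.
Variables (R : realType) (n : nat).

Lemma tame_phi : tame_form (@phi_form R n).
Proof.
apply: tame_form_scale; first exact: tame_rsd.
apply: tame_form_scale; first exact: tame_cst.
apply: tame_form_sum => s; apply: tame_form_mul; first exact: tame_form_cst.
apply: tame_form_prod => i.
apply: (@tame_mx_mul _ _ (fun X => dX R _ *m const_covec (invmx X)) (fun=> dX R _)).
  by apply: tame_mx_mul; [exact: tame_mx_cst|exact: tame_const_invmx].
exact: tame_mx_cst.
Qed.

Lemma tame_wedge_phi (w : Omega_nc n) : tame_form (wedge_phi (R := R) w).
Proof.
apply: tame_form_mul; last exact: tame_phi.
apply: tame_form_sum => A; apply: tame_form_scale; first exact: tame_cst.
by apply: tame_form_prod => i; exact: tame_beta.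
Qed.

Lemma wedge_phi_smooth (w : Omega_nc n) : smooth_form (wedge_phi (R := R) w).
Proof. by move=> A k; apply: tame_Ck; exact: tame_wedge_phi. Qed.

Lemma wedge_phi_twisted (w : Omega_nc n) : twisted_LP_form (wedge_phi (R := R) w).
Proof.
split=> [|g ug X pX]; last exact: wedge_phi_gl.
split; first exact: wedge_phi_smooth.
  by move=> X pX; exact: ip_wedge_phi.
by move=> r r0 X pX; exact: wedge_phi_scale.
Qed.

(** At g^T g the determinant is det(g)^2, so the exponent in eta produces the very power of |det(g)|
    found in [top_coef_congr]. *)
Lemma det_powR (g : 'M[R]_(2 * n)) : g \in unitmx ->
  \det (g^T *m g) `^ (- ((2 * n + 1)%:R / 2)) = (`|\det g| ^+ (2 * n).+1)^-1.
Proof.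
move=> ug; have d0 : 0 < `|\det g| by rewrite normr_gt0 -unitfE -unitmxE.
rewrite det_mulmx det_tr -expr2 -real_normK ?num_real // -powR_mulrn ?ltW //.
by rewrite -powRrM mulrN mulrCA mulfV // mulr1 powRN powR_mulrn ?addn1 // ltW.
Qed.
End SmoothForms.

Unset Implicit Arguments.

Theorem proposition3p1 (R : realType) (n : nat) (hn : (1 <= n)%N) :
  (exists2 c : int, c != 0 &
     eq_form
       (fun X : 'M[R]_(2 * n) =>
          (\prod_(1 <= k < n) beta_form k X) * phi_form X)
       (fun X : 'M[R]_(2 * n) => c%:~R *: eta_form X)) /\
  (forall w : Omega_nc n, twisted_LP_form (wedge_phi (R := R) w)) /\
  (forall w1 w2 : Omega_nc n,
     eq_form (wedge_phi (R := R) w1) (wedge_phi (R := R) w2) -> w1 = w2).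
Proof.
split; last first.
  split=> [w|w1 w2 e12]; first exact: wedge_phi_twisted.
  by apply: (wedge_phi_inj hn); apply: e12; exact: posdef1.
have [s es] := eta_vol R (2 * n); have [c ec] := kappa_int R hn.
(* [c] is [kappa] as an integer, relative to [vol]; the sign passes to the lexicographic order used
   by eta. *)
exists ((-1) ^+ s * c).
  rewrite mulf_neq0 ?signr_eq0 //; apply: contraNneq (kappa_neq0 R hn) => c0.
  by rewrite ec c0.
move=> X pX; have [g ug eX] := posdef_cholesky pX; subst X.
rewrite -[LHS]/(wedge_all _) (wedge_all_vol hn ug pX).
have -> : eta_form (g^T *m g) = (\det (g^T *m g) `^ (- ((2 * n + 1)%:R / 2)) * (-1) ^+ s) *:
    interior_product (coordinate (g^T *m g)) (vol R (2 * n)).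
  by rewrite /eta_form /euler_contract es scalerA linearZ.
rewrite scalerA det_powR //; congr (_ *: _); rewrite ec rmorphM rmorphXn rmorphN1 /=.
by rewrite [X in _ = _ * X]mulrC mulrACA -expr2 sqrr_sign mul1r.
Qed.
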